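(* Let $(X_i)_{i\ge 1}$ be iid real random variables with generic element $X$, $\mathbb{E}[X]=0$, $\mathbb{E}[X^2]=1$, and let $S_n=X_1+\cdots+X_n$. Let $p=p_n$ be a sequence of positive integers with $p_n\to\infty$ as $n\to\infty$. Assume that one of the following three conditions holds: (1) There exists $s>2$ with $\mathbb{E}[|X|^s]<\infty$, and $p=O(n^{(s-2)/2})$. (2) There exists an increasing differentiable function $g$ on $(0,\infty)$ such that $\mathbb{E}[\exp(g(|X|))]<\infty$, $g'(x)\le \tau g(x)/x$ for all sufficiently large $x$ and some $\tau<1$, and $\lim_{x\to\infty}g(x)/\log x=\infty$; and $p=\exp(o(g_n^2\wedge n^{1/3}))$, where $g_n$ is the solution of the equation $g_n^2=g(g_n\sqrt n)$. (3) There exists a constant $h>0$ with $\mathbb{E}[\exp(h|X|)]<\infty$, and $p=\exp(o(n^{1/3}))$. Then for every $x\in\mathbb{R}$, as $n\to\infty$, $$p\,\mathbb{P}\big(S_n/\sqrt n> d_p+x/d_p\big)\sim p\,\overline{\Phi}(d_p+x/d_p)\to \mathrm{e}^{-x}.$$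
   Context: $\Phi$ is the standard normal distribution function, $\overline\Phi=1-\Phi$, and $a\wedge b=\min(a,b)$. For real $q$ large enough, $$d_q=\sqrt{2\log q}-\frac{\log\log q+\log 4\pi}{2(2\log q)^{1/2}},$$ and $d_p$ means $d_{p_n}$. The notation $a_n\sim b_n$ means $a_n/b_n\to1$. *)

(* Defs.v *)
From HB Require Import structures.
From mathcomp Require Import all_boot all_order all_algebra.
From mathcomp Require Import all_classical all_reals all_analysis.

Set Implicit Arguments.
Unset Strict Implicit.
Unset Printing Implicit Defensive.

Import Order.TTheory GRing.Theory Num.Theory.
Import numFieldNormedType.Exports.

Local Open Scope classical_set_scope.
Local Open Scope ring_scope.

Definition mutually_independent (d : measure_display) (T : measurableType d)
    (R : realType) (P : probability T R) (X : nat -> {RV P >-> R}) : Prop :=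
  forall (J : seq nat) (A : nat -> set R),
    uniq J -> (forall i, measurable (A i)) ->
    P (\bigcap_(i in [set` J]) (X i @^-1` A i)) =
    (\prod_(i <- J) P (X i @^-1` A i))%E.

(* A measure is a total function on [set R] that is only meaningful on
   measurable sets, so equality in law is tested on those only. *)
Definition identically_distributed (d : measure_display) (T : measurableType d)
    (R : realType) (P : probability T R) (X : nat -> {RV P >-> R}) : Prop :=
  forall (i j : nat) (A : set R), measurable A ->
    distribution P (X i) A = distribution P (X j) A.

Definition iid (d : measure_display) (T : measurableType d)
    (R : realType) (P : probability T R) (X : nat -> {RV P >-> R}) : Prop :=
  mutually_independent X /\ identically_distributed X.

(* The sequence is indexed from 0: [X 0, ..., X n.-1] are the first n terms. *)
Definition partial_sum (d : measure_display) (T : measurableType d)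
    (R : realType) (P : probability T R) (X : nat -> {RV P >-> R})
    (n : nat) (w : T) : R :=
  \sum_(i < n) X i w.

(* [normal_prob m s] is parameterized by the standard deviation [s]. *)
Definition std_normal_cdf (R : realType) (x : R) : R :=
  fine (normal_prob (0 : R) 1 `]-oo, x]).

Definition std_normal_tail (R : realType) (x : R) : R := 1 - std_normal_cdf x.

(* Only meaningful for q > 1; [ln] and [Num.sqrt] take the value 0 outside
   their natural domains. *)
Definition gumbel_d (R : realType) (q : R) : R :=
  Num.sqrt (2 * ln q) -
  (ln (ln q) + ln (4 * pi)) / (2 * Num.sqrt (2 * ln q)).

Definition asymp_equiv (R : realType) (a b : nat -> R) : Prop :=
  a n / b n @[n --> \oo] --> (1 : R).

(* p = exp(o(r)) as n tends to infinity. *)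
Definition exp_littleo (R : realType) (p : nat -> nat) (r : nat -> R) : Prop :=
  exists e : nat -> R,
    e =o_\oo r /\ forall n, (p n)%:R = expR (e n).

(* [g] is only relevant on (0, +oo).  [g 0] is an arbitrary real number; it
   occurs in E[exp(g(|X|))] on the event X = 0, where it cannot affect
   finiteness. *)
Definition nagaev_function (R : realType) (g : R -> R) : Prop :=
  [/\ forall x y : R, 0 < x -> x <= y -> g x <= g y,
      forall x : R, 0 < x -> derivable g x 1,
      exists2 tau : R, tau < 1 &
        \forall x \near +oo%R, derive1 g x <= tau * g x / x
    & g x / ln x @[x --> +oo] --> +oo].

(* The equation u ^+ 2 = g (u * sqrt n) has, for n large, exactly one solution u
   with u * sqrt n large, but it may have none for small n, and may have further
   solutions, with u * sqrt n bounded, if g changes sign.  The latter are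
   excluded by p = exp(o(u_n^2 /\ n^(1/3))) and p --> oo, which force
   u_n --> oo. *)
Definition nagaev_solution (R : realType) (g : R -> R) (u : nat -> R) : Prop :=
  \forall n \near \oo, 0 < u n /\ u n ^+ 2 = g (u n * Num.sqrt n%:R).

(* Main.v *)
Require Import Defs.
From HB Require Import structures.
From mathcomp Require Import all_boot all_order all_algebra.
From mathcomp Require Import all_classical all_reals all_analysis.
From mathcomp Require Import measurable_realfun.
From mathcomp Require Import ring lra.

Set Implicit Arguments.
Unset Strict Implicit.
Unset Printing Implicit Defensive.

Import Order.TTheory GRing.Theory Num.Theory.
Import numFieldNormedType.Exports.

Local Open Scope classical_set_scope.
Local Open Scope ring_scope.

(** Throughout, Q is the standard normal tail and t = d_p + x / d_p.

    That p Q(t) tends to exp (- x) is a computation with Mills' ratio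
    ([mills_ratio], [gumbel_level_tail]).  The statement on S_n then says that
    the normal approximation of P(S_n / sqrt n > t) has a vanishing relative
    error ([moderate_deviation_equiv]).  It is proved by Lindeberg's replacement
    method, run with exponential weights: Fourier analysis, a change of measure
    and a Berry-Esseen bound are all avoided.

    Truncate X at a level y and put xi = X 1{|X| <= y} / sqrt n.  The indicator
    of ]t, +oo[ is replaced by z |-> Q((u - z) / h) with h = e / t, where e is a
    small constant and u is within O(1 / t) of t.  Adding to z an independent
    centred Gaussian of variance v only turns the scale h into
    sqrt (h^2 + v).  So the summands are traded for Gaussian increments by
    moving along the scales r_k = sqrt (h^2 + (n - k) / n): after k summands the
    quantity followed is the expectation of Q((u - S_k) / r_k), which is
    Q(u / sqrt (1 + h^2)) for k = 0 and the smoothed tail of the truncated sum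
    for k = n.  By a Taylor expansion in z and the heat equation in r
    ([taylor3], [tail_kernel_heat], [one_swap]), a step costs the defects of the
    first two moments of xi, the third moment weighted by exp (t |xi|), and a
    term of order n^-2, each multiplied by a derivative of the kernel.  These
    derivatives are at most powers of t, times 1 / r, times the exponential
    weight exp (t^2 r^2 / 2 + t (z - u)) ([gauss_kernel_bound]).  The expectation
    of the weight at S_k is a power of the moment generating function of xi,
    and the exponents add up to about t^2 / 2 - t u, which is - t^2 / 2 up to a
    constant, whatever k is.  As the sum of the 1 / r_k is O(n), the total error
    is o(exp (- t^2 / 2) / t) = o(Q(t)) as soon as t^3 / sqrt n tends to 0 in the
    appropriate weighted sense ([lindeberg_tail], [lindeberg_bound]).

    Kernels centred at t - a h and t + a h enclose the indicator
    ([tail_prob_upper], [tail_prob_lower]).  The corresponding normal tails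
    differ from Q(t) by factors close to exp (a e) and exp (- a e), so taking
    e = 1 / a^2 and a large closes the gap.  Truncating changes the probability
    by at most n P(|X| > y), which has to be o(1 / p).

    The growth conditions serve to choose y: it is sqrt n for power moments
    ([power_moment_deviation]), and g_n sqrt n in the second condition
    ([exponential_moment_deviation]).  The third condition is the same argument
    for the linear function g(v) = h v, with g_n = h sqrt n. *)
(** * The standard normal tail *)
Definition normal_density {R : realType} (x : R) : R :=
  (Num.sqrt (2 * pi))^-1 * expR (- x ^+ 2 / 2).

Lemma normal_densityE {R : realType} :
  normal_density = normal_pdf (0 : R) 1.
Proof.
rewrite normal_pdfE ?oner_neq0//; apply/funext => x.
rewrite /normal_density /normal_peak /normal_fun subr0 expr1n mul1r.
by congr (_ * expR _); rewrite ?mulr_natl.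
Qed.

Lemma normal_density_gt0 {R : realType} (x : R) : 0 < normal_density x.
Proof.
by rewrite mulr_gt0 ?expR_gt0// invr_gt0 sqrtr_gt0 mulr_gt0// pi_gt0.
Qed.

Lemma is_derive_std_normal_tail {R : realType} (x : R) :
  is_derive x 1 (@std_normal_tail R) (- normal_density x).
Proof.
have xx : x < x + 1 by rewrite ltrDl.
have intf : (@lebesgue_measure R).-integrable [set` Interval -oo%O (BRight (x + 1))]
    (EFin \o normal_pdf (0 : R) 1).
  by apply: (integrableS measurableT) => //; exact: integrable_normal_pdf.
have [] := continuous_FTC1 xx intf (ltNyr _)
  (@continuous_normal_pdf R 0 1 (oner_neq0 R) x).
have EF : (fun y => \int[lebesgue_measure]_(t in [set` Interval -oo%O (BRight y)])
    normal_pdf (0 : R) 1 t) = @std_normal_cdf R by [].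
rewrite EF -normal_densityE => dF F'.
have dF' : is_derive x 1 (@std_normal_cdf R) (normal_density x).
  by apply: DeriveDef; [exact: dF|rewrite -F' derive1E].
have -> : @std_normal_tail R = cst 1 - (@std_normal_cdf R).
  by apply/funext => y.
by apply: is_derive_eq; rewrite add0r.
Qed.

Lemma std_normal_cdfE {R : realType} : exists X : {RV (normal_prob (0:R) 1) >-> R},
  @std_normal_cdf R = fine \o cdf X.
Proof.
have mid : measurable_fun [set: g_sigma_algebraType (R.-ocitv.-measurable)] (idfun : _ -> R).
  by move=> _ A mA; rewrite setTI.
exists (@mfun_Sub _ default_measure_display (g_sigma_algebraType (R.-ocitv.-measurable)) R idfun (mem_set mid)).
by apply/funext => x.
Qed.

Lemma cvg_std_normal_tail_y {R : realType} :
  @std_normal_tail R x @[x --> +oo] --> (0 : R).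
Proof.
have [X EX] := @std_normal_cdfE R.
rewrite [X in _ --> X](_ : 0 = 1 - 1 :> R); last by rewrite subrr.
apply: cvgB; first exact: cvg_cst.
by rewrite EX; have /fine_cvgP[] := cvg_cdfy1 X.
Qed.

Lemma cvg_std_normal_tail_Ny {R : realType} :
  @std_normal_tail R x @[x --> -oo] --> (1 : R).
Proof.
have [X EX] := @std_normal_cdfE R.
rewrite [X in _ --> X](_ : 1 = 1 - 0 :> R); last by rewrite subr0.
apply: cvgB; first exact: cvg_cst.
by rewrite EX; have /fine_cvgP[] := cvg_cdfNy0 X.
Qed.

Lemma std_normal_tail_le1 {R : realType} (x : R) : std_normal_tail x <= 1.
Proof.
by rewrite /std_normal_tail lerBlDr lerDl /std_normal_cdf fine_ge0.
Qed.

Lemma derive_le0_nonincr {R : realType} (f df : R -> R) (a : R) :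
  (forall x, a <= x -> is_derive x 1 f (df x)) ->
  (forall x, a <= x -> df x <= 0) ->
  forall x y, a <= x -> x <= y -> f y <= f x.
Proof.
move=> f' df0 x y ax xy.
have d1 z : z \in `]x, y[%R -> is_derive z 1 f (df z).
  by move=> /[!in_itv]/andP[/ltW xz _]; apply: f'; apply: le_trans xz.
have c1 : {within `[x, y], continuous f}.
  apply: derivable_within_continuous => z /[!in_itv]/andP[xz _].
  by have [] := f' z (le_trans ax xz).
have [c /[!in_itv]/andP[xc _] E] := MVT_segment xy d1 c1.
rewrite -subr_le0 E mulr_le0_ge0 ?subr_ge0//.
exact/df0/(le_trans ax).
Qed.

(** Bounds on the normal tail are proved by this comparison: the difference of
    the two sides vanishes at infinity, so the sign of its derivative decides. *)
Lemma nonincr_cvg0_ge0 {R : realType} (f : R -> R) (a : R) :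
  (forall x y, a <= x -> x <= y -> f y <= f x) ->
  f x @[x --> +oo] --> 0 -> forall x, a <= x -> 0 <= f x.
Proof.
move=> fi f0 x ax; rewrite leNgt; apply/negP => fx0.
have : \forall y \near +oo, f x < f y.
  by move/cvgrPdist_lt : f0 => /(_ (- f x)); rewrite oppr_gt0 => /(_ fx0);
    apply: filterS => y; rewrite sub0r normrN => /ltr_normlP[]; lra.
move=> H; have [y [fxy xy]] := filter_ex (filterI H (nbhs_pinfty_ge (num_real x))).
by have := fi _ _ ax xy; rewrite leNgt fxy.
Qed.

Lemma std_normal_tail_nonincr {R : realType} (x y : R) :
  x <= y -> std_normal_tail y <= std_normal_tail x.
Proof.
move=> xy; apply: (@derive_le0_nonincr R _ (fun x => - normal_density x) x) => //.
- by move=> z _; exact: is_derive_std_normal_tail.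
- by move=> z _; rewrite oppr_le0 ltW// normal_density_gt0.
Qed.

Lemma std_normal_tail_ge0 {R : realType} (x : R) : 0 <= std_normal_tail x.
Proof.
apply: (@nonincr_cvg0_ge0 R _ x) => //; last exact: cvg_std_normal_tail_y.
by move=> a b _; exact: std_normal_tail_nonincr.
Qed.

Lemma is_derive_normal_density {R : realType} (x : R) :
  is_derive x 1 (@normal_density R) (- x * normal_density x).
Proof.
rewrite /normal_density.
apply: is_derive_eq; rewrite /GRing.scale/=.
by set c := (Num.sqrt _)^-1; set e := expR _; field.
Qed.

(** The exponent of the density at a + b is at most the sum of the exponents at
    a and b, because a * b >= 0.  The bound is what makes the part of a smoothed
    indicator that lies on the wrong side of the level negligible. *)
Lemma std_normal_tailD {R : realType} (a b : R) : 0 <= a -> 0 <= b ->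
  std_normal_tail (a + b) <= expR (- a ^+ 2 / 2) * std_normal_tail b.
Proof.
move=> a0 b0; rewrite -subr_ge0.
pose f (b : R) := expR (- a ^+ 2 / 2) * std_normal_tail b - std_normal_tail (a + b).
pose df (b : R) := expR (- a ^+ 2 / 2) * - normal_density b + normal_density (a + b).
rewrite -[leRHS]/(f b).
apply: (@nonincr_cvg0_ge0 R f 0) => //.
  apply: (@derive_le0_nonincr R f df) => x x0.
    rewrite /f /df.
    have ? := is_derive_std_normal_tail x.
    have ? := is_derive_std_normal_tail (a + x).
    have ? : is_derive x 1 (fun x => std_normal_tail (a + x)) (- normal_density (a + x)).
      have dx : is_derive x 1 (fun x : R => a + x) 1.
        by apply: is_derive_eq; rewrite add0r mulr1.
      rewrite -[- normal_density (a + x)]mulr1.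
      exact: (@is_derive1_comp R (@std_normal_tail R) (fun x => a + x)).
    by apply: is_derive_eq; rewrite /GRing.scale/=; ring.
  rewrite /df /normal_density mulrN addrC subr_le0 mulrCA ler_pM2l; last first.
    by rewrite invr_gt0 sqrtr_gt0 mulr_gt0// pi_gt0.
  rewrite -expRD ler_expR; have := mulr_ge0 a0 x0; nra.
rewrite /f [X in _ --> X](_ : 0 = expR (- a ^+ 2 / 2) * 0 - 0 :> R); last by ring.
apply: cvgB.
  by apply: cvgM; [exact: cvg_cst|exact: cvg_std_normal_tail_y].
apply: (@cvg_comp _ _ _ (fun x => a + x) (@std_normal_tail R) _ +oo); last exact: cvg_std_normal_tail_y.
by apply: cvg_addrl.
Qed.

Lemma cvg_normal_density_y {R : realType} :
  @normal_density R x @[x --> +oo] --> (0 : R).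
Proof.
rewrite -[X in _ --> X](mulr0 (Num.sqrt (2 * pi : R))^-1).
apply: cvgM; first exact: cvg_cst.
apply: (@squeeze_cvgr _ _ _ _ (cst 0) (fun x => expR (- x))).
- near=> x; rewrite expR_ge0/= ler_expR.
  have : 2 <= x by near: x; apply: nbhs_pinfty_ge; rewrite num_real.
  by nra.
- exact: cvg_cst.
- exact: cvgr_expR.
Unshelve. all: by end_near. Qed.

Lemma std_normal_tail_le_density {R : realType} (t : R) : 0 < t ->
  std_normal_tail t <= normal_density t / t.
Proof.
move=> t0; rewrite -subr_ge0.
pose f (x : R) := normal_density x * x^-1 - std_normal_tail x.
pose df (x : R) := - normal_density x / x ^+ 2.
rewrite -[leRHS]/(f t).
apply: (@nonincr_cvg0_ge0 R f t) => //.
  apply: (@derive_le0_nonincr R f df) => x x0; rewrite /f /df; last first.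
    by rewrite mulNr oppr_le0 divr_ge0 ?sqr_ge0// ltW ?normal_density_gt0.
  have xn0 : x != 0 by rewrite gt_eqF// (lt_le_trans t0).
  have ? := is_derive_std_normal_tail x.
  have ? := is_derive_normal_density x.
  have ? : is_derive x 1 (fun x : R => x^-1) (- x ^- 2 *: 1).
    exact: (@is_deriveV _ id).
  by apply: is_derive_eq; rewrite /GRing.scale/=; field.
rewrite /f [X in _ --> X](_ : 0 = 0 - 0 :> R); last by ring.
apply: cvgB; last exact: cvg_std_normal_tail_y.
apply: (@squeeze_cvgr _ _ _ _ (cst 0) normal_density).
- near=> x.
  have x1 : 1 <= x by near: x; apply: nbhs_pinfty_ge; rewrite num_real.
  have x0 : 0 < x by apply: lt_le_trans x1.
  have n0 := ltW (normal_density_gt0 x).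
  by rewrite divr_ge0 ?(ltW x0)//= ler_pdivrMr// ler_peMr.
- exact: cvg_cst.
- exact: cvg_normal_density_y.
Unshelve. all: by end_near. Qed.

Lemma std_normal_tail_ge_density {R : realType} (t : R) : 0 < t ->
  normal_density t * (t / (1 + t ^+ 2)) <= std_normal_tail t.
Proof.
move=> t0; rewrite -subr_ge0.
pose f (x : R) := std_normal_tail x - normal_density x * (x * (1 + x ^+ 2)^-1).
pose df (x : R) := - (2 * normal_density x / (1 + x ^+ 2) ^+ 2).
have x2 (x : R) : 0 < 1 + x ^+ 2 by rewrite ltr_wpDr// sqr_ge0.
rewrite -[leRHS]/(f t).
apply: (@nonincr_cvg0_ge0 R f t) => //.
  apply: (@derive_le0_nonincr R f df) => x x0; rewrite /f /df; last first.
    by rewrite oppr_le0 divr_ge0 ?sqr_ge0// mulr_ge0// ltW ?normal_density_gt0.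
  have xn0 : (1 + x ^+ 2) != 0 by rewrite gt_eqF.
  have ? := is_derive_std_normal_tail x.
  have ? := is_derive_normal_density x.
  have ? : is_derive x 1 (fun x : R => (1 + x ^+ 2)^-1) (- (1 + x ^+ 2) ^- 2 *: (x *+ 2)).
    apply: (@is_deriveV _ (fun x => 1 + x ^+ 2)) => //.
    by apply: is_derive_eq; rewrite /GRing.scale/= ; ring.
  by apply: is_derive_eq; rewrite /GRing.scale/=; field.
rewrite /f [X in _ --> X](_ : 0 = 0 - 0 :> R); last by ring.
apply: cvgB; first exact: cvg_std_normal_tail_y.
apply: (@squeeze_cvgr _ _ _ _ (cst 0) normal_density).
- near=> x.
  have x1 : 1 <= x by near: x; apply: nbhs_pinfty_ge; rewrite num_real.
  have x0 : 0 < x by apply: lt_le_trans x1.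
  have n0 := ltW (normal_density_gt0 x).
  rewrite mulr_ge0 ?divr_ge0 ?(ltW x0) ?(ltW (x2 _))//=.
  by rewrite ler_piMr// ler_pdivrMr// mul1r; nra.
- exact: cvg_cst.
- exact: cvg_normal_density_y.
Unshelve. all: by end_near. Qed.

(** Mills' ratio, squeezed between x^2 / (1 + x^2) and 1. *)
Lemma mills_ratio {R : realType} :
  x * std_normal_tail x / normal_density x @[x --> +oo] --> (1 : R).
Proof.
apply: (@squeeze_cvgr _ _ _ _ (fun x : R => 1 - x^-1) (cst 1)).
- near=> x.
  have x1 : 1 <= x by near: x; apply: nbhs_pinfty_ge; rewrite num_real.
  have x0 : 0 < x by apply: lt_le_trans x1.
  have n0 := normal_density_gt0 x.
  apply/andP; split; last first.
    rewrite ler_pdivrMr// mul1r mulrC -ler_pdivlMr//.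
    exact: std_normal_tail_le_density.
  have x2 : 0 < 1 + x ^+ 2 by nra.
  apply: (@le_trans _ _ (x * (normal_density x * (x / (1 + x ^+ 2))) / normal_density x)).
    rewrite (_ : _ / normal_density x = 1 - (1 + x ^+ 2)^-1); last first.
      by field; rewrite !gt_eqF.
    by rewrite lerD2l lerN2 lef_pV2 ?posrE//; nra.
  by rewrite ler_pM2r ?invr_gt0// ler_pM2l// std_normal_tail_ge_density.
- rewrite [X in _ --> X](_ : 1 = 1 - 0 :> R); last by ring.
  apply: cvgB; first exact: cvg_cst.
  apply/(@gtr0_cvgV0 R R (pinfty_nbhs R) _ id); last exact: cvg_id.
  exact: nbhs_pinfty_gt.
- exact: cvg_cst.
Unshelve. all: by end_near. Qed.

(** * Sums of functions of an independent sequence *)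
(** Rectangles form a pi-system that generates the product sigma-algebra, and
    both sides are finite measures in E. *)
Lemma prod_measure_scale_unique {d} {T : measurableType d} {R : realType}
    (P : probability T R) (V : T -> R * R) (C : set T) :
  measurable_fun setT V -> measurable C ->
  (forall A B, measurable A -> measurable B ->
    P (V @^-1` (A `*` B) `&` C) = P C * P (V @^-1` (A `*` B)))%E ->
  forall E, measurable E -> (P (V @^-1` E `&` C) = P C * P (V @^-1` E))%E.
Proof.
move=> mV mC H E mE.
have PC0 : 0 <= fine (P C) by rewrite fine_ge0.
have PCfin : P C \is a fin_num by exact: fin_num_measure.
pose r := NngNum PC0.
pose W : {mfun T >-> _} := mfun_Sub (mem_set mV).
pose m1 := pushforward (mrestr P mC) W.
pose m2 := mscale r (distribution P W).
pose G : set (set (R * R)) :=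
  [set C | exists A, measurable A /\ exists B, measurable B /\ C = A `*` B].
have : m1 E = m2 E.
  apply: (measure_unique G (fun=> setT)) => //.
  - rewrite measurable_prod_measurableType; congr (<<s _ >>).
    apply/seteqP; split => [_ [A mA [B mB <-]]|_ [A [mA [B [mB ->]]]]].
      by exists A; split => //; exists B.
    by exists A => //; exists B.
  - move=> _ _ [X1 [mX1 [X2 [mX2 ->]]]] [Y1 [mY1 [Y2 [mY2 ->]]]].
    rewrite -setXI; exists (X1 `&` Y1); split; first exact: measurableI.
    by exists (X2 `&` Y2); split => //; exact: measurableI.
  - by move=> _; exists setT; split => //; exists setT; rewrite setXTT.
  - by rewrite bigcup_const.
  - move=> _ [A [mA [B [mB ->]]]].
    change (P (V @^-1` (A `*` B) `&` C) = (fine (P C))%:E * P (V @^-1` (A `*` B)))%E.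
    by rewrite fineK// -H.
  - move=> _; change (P (setT `&` C) < +oo)%E.
    by rewrite setTI -ge0_fin_numE.
change (P (V @^-1` E `&` C) = (fine (P C))%:E * P (V @^-1` E) -> 
        P (V @^-1` E `&` C) = P C * P (V @^-1` E))%E.
by rewrite fineK.
Qed.

Section iid_sums.
Context {d} {T : measurableType d} {R : realType} {P : probability T R}.
Variables (X : nat -> {RV P >-> R}) (phi : R -> R).
Hypothesis mphi : measurable_fun setT phi.

Definition sum_of (k : nat) (w : T) : R := \sum_(i < k) phi (X i w).

Lemma measurable_sum_of k : measurable_fun setT (sum_of k).
Proof.
rewrite /sum_of.
by apply: measurable_sum => i; exact: measurableT_comp.
Qed.

Hypothesis iidX : iid X.

Let cyl (J : seq nat) (A : nat -> set R) :=
  \bigcap_(i in [set` J]) (X i @^-1` A i).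

Let mcyl J A : (forall i, measurable (A i)) -> measurable (cyl J A).
Proof.
move=> mA; rewrite /cyl; apply: fin_bigcap_measurable => // i _.
exact: measurable_funPTI.
Qed.

(** Independence is given by the product rule on cylinders.  To reach sums, the
    pair of the k-th partial sum and [X k] is shown to be independent of every
    cylinder in the later variables: on rectangles this is the induction
    hypothesis for the index sequence k :: J. *)
Lemma sum_of_indep k (B : set R) J A : measurable B -> uniq J ->
  (forall i, i \in J -> (k <= i)%N) -> (forall i, measurable (A i)) ->
  (P (sum_of k @^-1` B `&` cyl J A) = P (cyl J A) * P (sum_of k @^-1` B))%E.
Proof.
have [indX _] := iidX.
elim: k B J A => [|k IH] B J A mB uJ Jk mA.
  have [B0|B0] := pselect (B 0).
    rewrite (_ : sum_of 0 @^-1` B = setT) ?setTI ?probability_setT ?mule1//.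
    by apply/seteqP; split => // w _; rewrite /= /sum_of big_ord0.
  rewrite (_ : sum_of 0 @^-1` B = set0) ?set0I ?measure0 ?mule0//.
  by apply/seteqP; split => // w; rewrite /= /sum_of big_ord0.
pose V w := (sum_of k w, X k w).
have mV : measurable_fun setT V.
  by apply: measurable_fun_pair => //; exact: measurable_sum_of.
have kJ : k \notin J by apply/negP => /Jk; rewrite ltnn.
have -> : sum_of k.+1 @^-1` B = V @^-1` ((fun z => z.1 + phi z.2) @^-1` B).
  by apply/seteqP; split => w /=; rewrite /sum_of big_ord_recr.
apply: prod_measure_scale_unique => //; first exact: mcyl.
- move=> B1 B2 mB1 mB2.
  (* A' adds the constraint X k \in B2 to the cylinder; it agrees with A on J, as k \notin J *)
  pose A' i := if i == k then B2 else A i.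
  have mA' i : measurable (A' i) by rewrite /A'; case: ifP.
  have A'J i : i \in J -> A' i = A i.
    by rewrite /A'; case: eqP => // -> ; rewrite (negbTE kJ).
  have cylA' : cyl J A' = cyl J A.
    by apply: eq_bigcapr => i /= iJ; rewrite A'J.
  have VE : V @^-1` (B1 `*` B2) = sum_of k @^-1` B1 `&` cyl [:: k] A'.
    apply/seteqP; split => w /= [h1 h2]; split => //.
      by move=> i /=; rewrite inE => /eqP ->; rewrite /A' eqxx.
    by have := h2 k; rewrite /= inE eqxx /A' eqxx; apply.
  have VEJ : V @^-1` (B1 `*` B2) `&` cyl J A = sum_of k @^-1` B1 `&` cyl (k :: J) A'.
    rewrite VE -setIA -cylA'; congr (_ `&` _).
    apply/seteqP; split => w.
      move=> [h1 h2] i /=; rewrite inE => /orP[/eqP ->|iJ]; last exact: h2.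
      by apply: h1; rewrite /= inE.
    move=> h; split => i /= iJ; apply: h => /=.
      by move: iJ; rewrite !inE => ->.
    by rewrite inE iJ orbT.
  rewrite VEJ VE !IH//=.
  + rewrite -cylA' /cyl !indX//= ?kJ// !big_cons big_nil mule1.
    by rewrite !muleA; congr (_ * _)%E; rewrite muleC.
  + by move=> i; rewrite inE => /eqP ->.
  + by rewrite kJ.
  + by move=> i; rewrite inE => /orP[/eqP ->//|/Jk/ltnW].
- rewrite -[X in measurable X]setTI; apply: (_ : measurable_fun setT _) => //.
  apply: measurable_funD => //; exact: measurableT_comp.
Qed.


(** Tonelli's theorem for the law of (S_k, X_k), which is a product measure; the
    inner variable may be taken to be X_0 since all X_k have the same law. *)
Lemma integral_sum_ofS k (f : R -> \bar R) :
  measurable_fun setT f -> (forall x, 0 <= f x)%E ->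
  (\int[P]_w f (sum_of k.+1 w) =
   \int[P]_w \int[P]_w' f (sum_of k w + phi (X 0 w'))%R)%E.
Proof.
move=> mf f0; have [_ idX] := iidX.
pose V w := (sum_of k w, X k w).
have mV : measurable_fun setT V.
  by apply: measurable_fun_pair => //; exact: measurable_sum_of.
pose W : {RV P >-> _} := mfun_Sub (mem_set mV).
pose S : {RV P >-> R} := mfun_Sub (mem_set (measurable_sum_of k)).
pose m1 := distribution P S; pose m2 := distribution P (X k).
have mE E : measurable E -> (m1 \x m2)%E E = distribution P W E.
  move=> mE; apply: product_measure_unique => // A B mA mB.
  change (P (V @^-1` (A `*` B)) = P (sum_of k @^-1` A) * P (X k @^-1` B))%E.
  have cB : cyl [:: k] (fun=> B) = X k @^-1` B.
    rewrite /cyl; apply/seteqP; split => w /=.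
      by apply; rewrite /= inE.
    by move=> XB i /=; rewrite inE => /eqP ->.
  rewrite -cB [RHS]muleC -sum_of_indep//; last by move=> i; rewrite inE => /eqP ->.
  by rewrite cB; congr (P _); apply/seteqP; split => w [].
pose g (z : R * R) := f (z.1 + phi z.2)%R.
have mg : measurable_fun setT g.
  apply: measurableT_comp => //.
  by apply: measurable_funD => //; exact: measurableT_comp.
have g0 z : (0 <= g z)%E by exact: f0.
transitivity (\int[distribution P W]_z g z)%E.
  rewrite ge0_integral_distribution//.
  by apply: eq_integral => w _; rewrite /g /sum_of big_ord_recr.
transitivity (\int[m1 \x m2]_z g z)%E.
  by apply: eq_measure_integral => A mA _; exact/esym/mE.
rewrite fubini_tonelli1// ge0_integral_distribution//; last 2 first.
- exact: measurable_fun_fubini_tonelli_F.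
- by move=> x; apply: integral_ge0.
apply: eq_integral => w _ /=; rewrite /fubini_F.
transitivity (\int[distribution P (X 0%N)]_y g (sum_of k w, y))%E.
  apply: eq_measure_integral => A mA _; exact: idX.
rewrite ge0_integral_distribution//.
exact: (measurableT_comp mg).
Qed.

End iid_sums.

(** * Taylor estimates for the smoothed indicator *)
Lemma mvt_bound {R : realType} (F dF : R -> R) (a b C : R) : a <= b ->
  (forall c : R, a <= c <= b -> is_derive c 1 F (dF c)) ->
  (forall c : R, a <= c <= b -> `|dF c| <= C) ->
  `|F b - F a| <= C * (b - a).
Proof.
move=> ab dFP dFC.
have d1 z : z \in `]a, b[%R -> is_derive z 1 F (dF z).
  by rewrite in_itv/= => /andP[/ltW ? /ltW ?]; apply: dFP; apply/andP.
have c1 : {within `[a, b], continuous F}.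
  apply: derivable_within_continuous => z; rewrite in_itv/= => zab.
  by have [] := dFP z zab.
have [c] := MVT_segment ab d1 c1; rewrite in_itv/= => cab ->.
by rewrite normrM [`|b - a|]ger0_norm ?subr_ge0// ler_wpM2r ?subr_ge0// dFC.
Qed.

Lemma mvt_bound0 {R : realType} (F dF : R -> R) (rho C : R) :
  F 0 = 0 -> 0 <= C ->
  (forall c : R, `|c| <= rho -> is_derive c 1 F (dF c)) ->
  (forall c : R, `|c| <= rho -> `|dF c| <= C) ->
  forall z, `|z| <= rho -> `|F z| <= C * rho.
Proof.
move=> F0 C0 dFP dFC z zr.
have H a b : a <= b -> `|a| <= rho -> `|b| <= rho ->
    `|F b - F a| <= C * (b - a).
  move=> ab + +; rewrite (ler_norml a) (ler_norml b) => /andP[a1 a2] /andP[b1 b2].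
  apply: (@mvt_bound R F dF a b C ab) => c /andP[ac cb];
    [apply: dFP|apply: dFC]; rewrite ler_norml; lra.
have r0 : 0 <= rho by rewrite (le_trans _ zr).
have [z0|/ltW z0] := leP 0 z.
  have := H _ _ z0 _ zr; rewrite normr0 F0 !subr0 => /(_ r0) /le_trans; apply.
  by rewrite ler_wpM2l// -(ger0_norm z0).
have := H _ _ z0 zr; rewrite normr0 F0 !sub0r normrN => /(_ r0) /le_trans; apply.
by rewrite ler_wpM2l// -(ler0_norm z0).
Qed.

Lemma is_derive_shiftl {R : realType} (f : R -> R) (df x z : R) :
  is_derive (x + z) 1 f df -> is_derive z 1 (fun z => f (x + z)) df.
Proof.
move=> H; have dx : is_derive z 1 (fun z : R => x + z) 1.
  by apply: is_derive_eq; rewrite add0r mulr1.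
by rewrite -[df]mulr1; exact: (@is_derive1_comp R f (fun z => x + z)).
Qed.

(** The mean value inequality, applied three times; hence the absence of a factor 1/6. *)
Lemma taylor3 {R : realType} (f f1 f2 f3 : R -> R) (x xi B : R) :
  (forall y : R, is_derive y 1 f (f1 y)) ->
  (forall y : R, is_derive y 1 f1 (f2 y)) ->
  (forall y : R, is_derive y 1 f2 (f3 y)) ->
  (forall z, `|z| <= `|xi| -> `|f3 (x + z)| <= B) ->
  `|f (x + xi) - (f x + f1 x * xi + f2 x * (xi ^+ 2 / 2))| <= B * `|xi| ^+ 3.
Proof.
move=> d1 d2 d3 fB.
have B0 : 0 <= B by apply: le_trans (fB 0 _); rewrite ?normr0.
pose F2 z := f2 (x + z) - f2 x.
pose F1 z := f1 (x + z) - (f1 x + f2 x * z).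
pose F0 z := f (x + z) - (f x + f1 x * z + f2 x * (z ^+ 2 / 2)).
have D2 (z : R) : is_derive z 1 F2 (f3 (x + z)).
  have := is_derive_shiftl (d3 (x + z)) => H.
  by apply: is_derive_eq; rewrite subr0.
have D1 (z : R) : is_derive z 1 F1 (F2 z).
  have := is_derive_shiftl (d2 (x + z)) => H.
  by apply: is_derive_eq; rewrite /F2 /GRing.scale/=; ring.
have D0 (z : R) : is_derive z 1 F0 (F1 z).
  have := is_derive_shiftl (d1 (x + z)) => H.
  by apply: is_derive_eq; rewrite /F1 /GRing.scale/=; field.
have F20 : F2 0 = 0 by rewrite /F2 addr0 subrr.
have F10 : F1 0 = 0 by rewrite /F1 addr0 mulr0 addr0 subrr.
have F00 : F0 0 = 0 by rewrite /F0 addr0 expr0n/= mul0r !mulr0 !addr0 subrr.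
have E2 := @mvt_bound0 R F2 _ `|xi| B F20 B0 (fun (c : R) _ => D2 c) fB.
have E1 := @mvt_bound0 R F1 _ `|xi| _ F10 (mulr_ge0 B0 (normr_ge0 _)) (fun (c : R) _ => D1 c) E2.
have E0 := @mvt_bound0 R F0 _ `|xi| _ F00 (mulr_ge0 (mulr_ge0 B0 (normr_ge0 _)) (normr_ge0 _)) (fun (c : R) _ => D0 c) E1.
rewrite (_ : B * _ = B * `|xi| * `|xi| * `|xi|); last by ring.
exact: E0.
Qed.

Section tail_kernel.
Context {R : realType}.
Implicit Types w x u r : R.

(** [gauss1], ..., [gauss4] are the first four derivatives of
    w |-> std_normal_tail (- w), that is, Hermite polynomials times the
    density, up to sign. *)
Definition gauss1 w : R := normal_density w.
Definition gauss2 w : R := - w * normal_density w.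
Definition gauss3 w : R := (w ^+ 2 - 1) * normal_density w.
Definition gauss4 w : R := (3 * w - w ^+ 3) * normal_density w.

Lemma normal_densityN w : normal_density (- w) = normal_density w.
Proof. by rewrite /normal_density sqrrN. Qed.

Lemma is_derive_gauss0 w : is_derive w 1 (fun w => std_normal_tail (- w)) (gauss1 w).
Proof.
have H1 := is_derive_std_normal_tail (- w).
have H2 : is_derive w 1 (fun w : R => - w) (-1) by apply: is_derive_eq.
have := @is_derive1_comp R (@std_normal_tail R) (fun w : R => - w) w _ _ H1 H2.
by rewrite mulrN1 opprK normal_densityN.
Qed.

Lemma is_derive_gauss1 w : is_derive w 1 gauss1 (gauss2 w).
Proof. exact: is_derive_normal_density. Qed.

Lemma is_derive_gauss2 w : is_derive w 1 gauss2 (gauss3 w).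
Proof.
have ? := is_derive_normal_density w.
by rewrite /gauss2; apply: is_derive_eq; rewrite /gauss3 /GRing.scale/=; ring.
Qed.

(** The indicator of ]u, +oo[, smoothed by an independent centred Gaussian
    variable of standard deviation r. *)
Definition tail_kernel u r x : R := std_normal_tail ((u - x) / r).

Lemma is_derive_affine (F : R -> R) dF u r x j :
  (forall w : R, is_derive w 1 F (dF w)) ->
  is_derive x 1 (fun x => F ((x - u) / r) / r ^+ j) (dF ((x - u) / r) / r ^+ j.+1).
Proof.
move=> H.
have H2 : is_derive x 1 (fun x : R => (x - u) / r) r^-1.
  by apply: is_derive_eq; rewrite /GRing.scale/=; ring.
have H3 := @is_derive1_comp R F _ x _ _ (H _) H2.
have -> : (fun x => F ((x - u) / r) / r ^+ j) = (r ^+ j)^-1 *: (F \o (fun x : R => (x - u) / r)).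
  by apply/funext => y /=; rewrite mulrC.
apply: is_derive_eq; rewrite /GRing.scale/= exprS invfM.
by ring.
Qed.

Lemma is_derive_tail_kernel u r x :
  is_derive x 1 (tail_kernel u r) (gauss1 ((x - u) / r) / r).
Proof.
have := is_derive_affine u r x 0 is_derive_gauss0.
rewrite expr1; have -> // : (fun x0 => std_normal_tail (- ((x0 - u) / r)) / r ^+ 0) = tail_kernel u r.
by apply/funext => y; rewrite expr0 divr1 /tail_kernel -mulNr opprB.
Qed.

(** Completing the square with v = w + q gives
    - w^2 / 2 = - v^2 / 2 + (q^2 / 2 + q w), and exp (- v^2 / 2) absorbs a cubic
    polynomial in v.  The lower bound e on q allows constants to be absorbed
    into powers of q / e. *)
Lemma gauss_weight (w q e : R) j : 0 < e <= 1 -> e <= q -> (j <= 3)%N ->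
  (1 + `|w|) ^+ j * normal_density w <= 64 * (q / e) ^+ j * expR (q ^+ 2 / 2 + q * w).
Proof.
move=> /andP[e0 e1] eq j3.
pose v := w + q.
have qe1 : 1 <= q / e by rewrite ler_pdivlMr// mul1r.
have qqe : q <= q / e by rewrite ler_pdivlMr//; nra.
have Nw : `|w| <= `|v| + q.
  have -> : w = v - q by rewrite /v; ring.
  by rewrite (le_trans (ler_normB _ _))// [`|q|]ger0_norm//; lra.
have H1 : 1 + `|w| <= q / e * (2 + `|v|) by have := normr_ge0 v; nra.
have c1 : (Num.sqrt (2 * pi : R))^-1 <= 1.
  rewrite invf_le1 ?sqrtr_gt0 ?mulr_gt0 ?pi_gt0// -[leLHS]sqrtr1 ler_sqrt ?mulr_ge0 ?pi_ge0//.
  by have := pi_ge2 R; lra.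
have EX : expR (- w ^+ 2 / 2) = expR (- v ^+ 2 / 2) * expR (q ^+ 2 / 2 + q * w).
  by rewrite -expRD; congr expR; rewrite /v; field.
have v3 : (2 + `|v|) ^+ 3 <= 64 * expR (v ^+ 2 / 2).
  have -> : v ^+ 2 / 2 = 3%:R * (v ^+ 2 / 6) by field.
  rewrite expRM_natl.
  have -> : 64 * expR (v ^+ 2 / 6) ^+ 3 = (4 * expR (v ^+ 2 / 6)) ^+ 3 by ring.
  apply: lerXn2r; rewrite ?nnegrE ?addr_ge0 ?mulr_ge0 ?expR_ge0//.
  have := expR_ge1Dx (v ^+ 2 / 6); rewrite -(real_normK (num_real v)).
  by move=> ?; nra.
have vj : (2 + `|v|) ^+ j <= (2 + `|v|) ^+ 3.
  by rewrite ler_weXn2l//; have := normr_ge0 v; lra.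
have vjE : (2 + `|v|) ^+ j * expR (- v ^+ 2 / 2) <= 64.
  by rewrite mulNr expRN ler_pdivrMr ?expR_gt0// (le_trans vj).
rewrite /normal_density EX.
apply: (@le_trans _ _ ((q / e * (2 + `|v|)) ^+ j * (1 * (expR (- v ^+ 2 / 2) * expR (q ^+ 2 / 2 + q * w))))).
  apply: ler_pM.
  - by rewrite exprn_ge0// addr_ge0.
  - by rewrite !mulr_ge0 ?expR_ge0// invr_ge0 sqrtr_ge0.
  - by apply: lerXn2r; rewrite // nnegrE ?(le_trans _ H1)// addr_ge0.
  - by rewrite ler_wpM2r// mulr_ge0// expR_ge0.
rewrite mul1r mulrA ler_wpM2r ?expR_ge0// exprMn.
rewrite -mulrA mulrC ler_wpM2r// exprn_ge0//; lra.
Qed.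
End tail_kernel.

Section tail_kernel2.
Context {R : realType}.
Implicit Types w x u r t e : R.

(** The smoothing of z |-> exp (t (z - u)) by a centred Gaussian variable of
    standard deviation r, at the point x. *)
Definition tilt_weight t r u x : R := expR ((t * r) ^+ 2 / 2 + t * (x - u)).

(** A derivative of order j + 1 costs a factor (t / e)^j and a single factor
    1 / r.  Higher powers of 1 / r would add up to too much along the scales of
    the replacement, whereas the sum of the 1 / r_k is O(n). *)
Lemma gauss_kernel_bound (G : R -> R) j t e r u x : 0 < e <= 1 -> 0 < r ->
  e <= t * r -> (j <= 3)%N ->
  (forall w, `|G w| <= 3 * (1 + `|w|) ^+ j * normal_density w) ->
  `|G ((x - u) / r) / r ^+ j.+1| <= 192 * (t / e) ^+ j / r * tilt_weight t r u x.
Proof.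
move=> e01 r0 etr j3 HG; have [e0 e1] := andP e01.
set w := (x - u) / r.
have gw := gauss_weight w e01 etr j3.
rewrite normrM normfV normrX [`|r|]gtr0_norm// ler_pdivrMr ?exprn_gt0//.
apply: le_trans (HG w) _; rewrite -mulrA.
apply: (@le_trans _ _ (3 * (64 * (t * r / e) ^+ j * expR ((t * r) ^+ 2 / 2 + t * r * w)))).
  by rewrite ler_pM2l.
rewrite /tilt_weight (_ : t * r * w = t * (x - u)); last by rewrite /w; field; rewrite gt_eqF.
rewrite (_ : t * r / e = t / e * r); last by ring.
rewrite [(t / e * r) ^+ j]exprMn [r ^+ j.+1]exprS le_eqVlt; apply/orP; left; apply/eqP.
by set a := (t / e) ^+ j; set b := r ^+ j; set E := expR _; field; rewrite gt_eqF.
Qed.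

Lemma gauss1_le w : `|gauss1 w| <= 3 * (1 + `|w|) ^+ 0 * normal_density w.
Proof.
have := normal_density_gt0 w; rewrite /gauss1 => n0.
by rewrite gtr0_norm// expr0; lra.
Qed.

Lemma gauss2_le w : `|gauss2 w| <= 3 * (1 + `|w|) ^+ 1 * normal_density w.
Proof.
have n0 := normal_density_gt0 w; rewrite /gauss2 normrM normrN expr1.
by rewrite [`|normal_density w|]gtr0_norm// ler_pM2r//; have := normr_ge0 w; lra.
Qed.

Lemma gauss3_le w : `|gauss3 w| <= 3 * (1 + `|w|) ^+ 2 * normal_density w.
Proof.
have n0 := normal_density_gt0 w; rewrite /gauss3 normrM.
rewrite [`|normal_density w|]gtr0_norm// ler_pM2r//.
rewrite (le_trans (ler_normB _ _))// normr1 normrX.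
by have := normr_ge0 w; nra.
Qed.

Lemma gauss4_le w : `|gauss4 w| <= 3 * (1 + `|w|) ^+ 3 * normal_density w.
Proof.
have n0 := normal_density_gt0 w; rewrite /gauss4 normrM.
rewrite [`|normal_density w|]gtr0_norm// ler_pM2r//.
rewrite (le_trans (ler_normB _ _))// normrM normrX [`|3|]ger0_norm//.
have := normr_ge0 w; set v := `|w| => v0.
have := mulr_ge0 v0 v0; have := mulr_ge0 (mulr_ge0 v0 v0) v0.
by rewrite (_ : (1 + v) ^+ 3 = 1 + 3 * v + 3 * (v * v) + v * v * v);
  [rewrite (_ : v ^+ 3 = v * v * v); [lra|ring] | ring].
Qed.

Lemma is_derive_scale_param (F : R -> R) dF u r x : r != 0 ->
  (forall w : R, is_derive w 1 F (dF w)) ->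
  is_derive r 1 (fun r => F ((x - u) / r)) (- dF ((x - u) / r) * ((x - u) / r) / r).
Proof.
move=> r0 H.
have H1 : is_derive r 1 (fun r : R => r^-1) (- r ^- 2 *: 1).
  exact: (@is_deriveV _ id).
have H2 : is_derive r 1 (fun r : R => (x - u) / r) (- (x - u) / r ^+ 2).
  by apply: is_derive_eq; rewrite /GRing.scale/=; field.
have H3 := @is_derive1_comp R F _ r _ _ (H _) H2.
rewrite (_ : - dF _ * _ / r = dF ((x - u) / r) * (- (x - u) / r ^+ 2)) //.
by field.
Qed.

Lemma is_derive_tail_kernel_scale u r x : r != 0 ->
  is_derive r 1 (fun r => tail_kernel u r x) (gauss2 ((x - u) / r) / r).
Proof.
move=> r0; have := is_derive_scale_param u x r0 is_derive_gauss0.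
rewrite [X in is_derive _ _ X _ -> _](_ : _ = (fun r => tail_kernel u r x)); last first.
  by apply/funext => y; rewrite /tail_kernel -mulNr opprB.
rewrite (_ : - _ * _ / r = gauss2 ((x - u) / r) / r)// /gauss1 /gauss2.
by ring.
Qed.

Lemma is_derive_gauss2_scale u r x : r != 0 ->
  is_derive r 1 (fun r => gauss2 ((x - u) / r) / r ^+ 2)
    (r * (gauss4 ((x - u) / r) / r ^+ 4)).
Proof.
move=> r0; have H := is_derive_scale_param u x r0 is_derive_gauss2.
have H1 : is_derive r 1 (fun r : R => (r ^+ 2)^-1) (- (r ^+ 2) ^- 2 *: (r *+ 2)).
  apply: (@is_deriveV _ (fun r : R => r ^+ 2)); first by rewrite expf_neq0.
  by apply: is_derive_eq; rewrite /GRing.scale/=; ring.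
apply: is_derive_eq; rewrite /GRing.scale/= /gauss2 /gauss3 /gauss4.
by set n := normal_density _; set w := (x - u) / r; field.
Qed.

(** The kernel solves the heat equation: its derivative in the scale r is r times
    its second derivative in x.  Hence an increase of the variance r^2 by delta
    adds delta / 2 times that second derivative, up to an error of order
    delta^2.  This replaces the computation of a Gaussian convolution. *)
Lemma tail_kernel_heat u x r0 r1 B : 0 < r0 -> r0 <= r1 ->
  (forall r, r0 <= r <= r1 -> `|gauss4 ((x - u) / r) / r ^+ 4| <= B) ->
  `|tail_kernel u r1 x - tail_kernel u r0 x
     - (r1 ^+ 2 - r0 ^+ 2) / 2 * (gauss2 ((x - u) / r0) / r0 ^+ 2)|
  <= (r1 ^+ 2 - r0 ^+ 2) ^+ 2 * B.
Proof.
move=> r00 r01 HB.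
have B0 : 0 <= B by apply: le_trans (HB r0 _); rewrite // lexx.
have pos r : r0 <= r -> r != 0 by move=> h; rewrite gt_eqF// (lt_le_trans r00).
pose G2 r := gauss2 ((x - u) / r) / r ^+ 2.
(* K is the kernel minus its first order expansion in r ^+ 2 at r0 *)
pose K r := tail_kernel u r x - r ^+ 2 / 2 * G2 r0.
have G2B r : r0 <= r <= r1 -> `|G2 r - G2 r0| <= r1 * B * (r1 - r0).
  move=> /andP[r0r rr1].
  apply: le_trans (_ : _ <= r1 * B * (r - r0)) _; last first.
    by rewrite ler_wpM2l ?mulr_ge0//; lra.
  apply: (mvt_bound (F := G2) (dF := fun r => r * (gauss4 ((x - u) / r) / r ^+ 4)) r0r).
    by move=> c /andP[c0 _]; exact: is_derive_gauss2_scale (pos c c0).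
  move=> c /andP[c0 cr]; rewrite normrM; apply: ler_pM => //.
    by rewrite ger0_norm; lra.
  by apply: HB; apply/andP; split; lra.
have KB : `|K r1 - K r0| <= r1 * (r1 * B * (r1 - r0)) * (r1 - r0).
  apply: (mvt_bound (F := K) (dF := fun r => r * (G2 r - G2 r0)) r01).
    move=> c /andP[c0 _]; have := is_derive_tail_kernel_scale u x (pos c c0) => ?.
    rewrite /K; apply: is_derive_eq; rewrite /GRing.scale/= /G2.
    by set g := gauss2 _; set g' := gauss2 _; field; rewrite !pos.
  move=> c /andP[c0 c1]; rewrite normrM; apply: ler_pM => //.
    by rewrite ger0_norm; lra.
  by apply: G2B; rewrite c0.
have -> : tail_kernel u r1 x - tail_kernel u r0 x
     - (r1 ^+ 2 - r0 ^+ 2) / 2 * (gauss2 ((x - u) / r0) / r0 ^+ 2) = K r1 - K r0.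
  by rewrite /K /G2; ring.
apply: le_trans KB _.
have -> : r1 * (r1 * B * (r1 - r0)) * (r1 - r0) = (r1 * (r1 - r0)) ^+ 2 * B by ring.
rewrite ler_wpM2r// lerXn2r// ?nnegrE; nra.
Qed.

End tail_kernel2.

(** * Expectations of bounded random variables *)
Section mean.
Context {d} {T : measurableType d} {R : realType} (P : probability T R).
Implicit Types f g : T -> R.

Definition rv_mean f : R := \int[P]_w f w.

Definition bounded_rv f : Prop :=
  measurable_fun setT f /\ exists M : R, forall w, `|f w| <= M.

Lemma bounded_rv_integrable f : bounded_rv f -> P.-integrable setT (EFin \o f).
Proof.
move=> [mf [M fM]]; apply: measurable_bounded_integrable => //.
  by rewrite /= probability_setT ltry.
exists M; split; first exact: num_real.
by move=> x Mx w _; rewrite /= (le_trans (fM w))// ltW.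
Qed.

Lemma bounded_rv_cst (c : R) : bounded_rv (fun=> c).
Proof. by split; [exact: measurable_cst|exists `|c|]. Qed.

Lemma bounded_rvD f g : bounded_rv f -> bounded_rv g ->
  bounded_rv (fun w => f w + g w).
Proof.
move=> [mf [M fM]] [mg [N gN]]; split; first exact: measurable_funD.
by exists (M + N) => w; rewrite (le_trans (ler_normD _ _))// lerD.
Qed.

Lemma bounded_rvM f g : bounded_rv f -> bounded_rv g ->
  bounded_rv (fun w => f w * g w).
Proof.
move=> [mf [M fM]] [mg [N gN]]; split; first exact: measurable_funM.
by exists (M * N) => w; rewrite normrM ler_pM.
Qed.

Lemma bounded_rvN f : bounded_rv f -> bounded_rv (fun w => - f w).
Proof.
move=> [mf [M fM]]; split; first exact: measurableT_comp.
by exists M => w; rewrite normrN.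
Qed.

Lemma bounded_rv_norm f : bounded_rv f -> bounded_rv (fun w => `|f w|).
Proof.
move=> [mf [M fM]]; split; first exact: measurableT_comp.
by exists M => w; rewrite normr_id.
Qed.

Lemma bounded_rvX f k : bounded_rv f -> bounded_rv (fun w => f w ^+ k).
Proof.
move=> [mf [M fM]]; split; first exact: measurable_funX.
exists (M ^+ k) => w; rewrite normrX; apply: lerXn2r; rewrite ?nnegrE//.
by rewrite (le_trans _ (fM w)).
Qed.

Lemma bounded_rv_expR f : bounded_rv f -> bounded_rv (fun w => expR (f w)).
Proof.
move=> [mf [M fM]]; split; first exact: measurableT_comp.
exists (expR M) => w; rewrite ger0_norm ?expR_ge0// ler_expR.
by rewrite (le_trans (ler_norm _)).
Qed.

Lemma mean_cst (c : R) : rv_mean (fun=> c) = c.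
Proof.
by rewrite /rv_mean Rintegral_cst//= probability_setT/= mulr1.
Qed.

Lemma meanD f g : bounded_rv f -> bounded_rv g ->
  rv_mean (fun w => f w + g w) = rv_mean f + rv_mean g.
Proof. by move=> ? ?; rewrite /rv_mean RintegralD//; exact: bounded_rv_integrable. Qed.

Lemma meanB f g : bounded_rv f -> bounded_rv g ->
  rv_mean (fun w => f w - g w) = rv_mean f - rv_mean g.
Proof. by move=> ? ?; rewrite /rv_mean RintegralB//; exact: bounded_rv_integrable. Qed.

Lemma meanZ (c : R) f : bounded_rv f -> rv_mean (fun w => c * f w) = c * rv_mean f.
Proof. by move=> ?; rewrite /rv_mean RintegralZl//; exact: bounded_rv_integrable. Qed.

Lemma le_mean f g : bounded_rv f -> bounded_rv g ->
  (forall w, f w <= g w) -> rv_mean f <= rv_mean g.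
Proof.
by move=> ? ? fg; rewrite /rv_mean; apply: le_Rintegral => //; exact: bounded_rv_integrable.
Qed.

Lemma norm_mean_le f g : bounded_rv f -> bounded_rv g ->
  (forall w, `|f w| <= g w) -> `|rv_mean f| <= rv_mean g.
Proof.
move=> bf bg fg; apply: (@le_trans _ _ (rv_mean (fun w => `|f w|))).
  by apply: le_normr_Rintegral => //; exact: bounded_rv_integrable.
by apply: le_mean => //; exact: bounded_rv_norm.
Qed.

Lemma mean_ge0 f : (forall w, 0 <= f w) -> 0 <= rv_mean f.
Proof. by move=> f0; apply: Rintegral_ge0. Qed.

Lemma measurable_mean_shift (f : R -> R) (xi : T -> R) :
  measurable_fun setT f -> (forall x, 0 <= f x) -> measurable_fun setT xi ->
  measurable_fun setT (fun x : R => rv_mean (fun w => f (x + xi w))).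
Proof.
move=> mf f0 mxi; apply: (measurableT_comp (f := fine)) => //.
apply: (@measurable_fun_fubini_tonelli_F _ _ _ _ _ P
  (fun z : R * T => (f (z.1 + xi z.2))%:E)).
  apply/measurable_EFinP; apply: measurableT_comp => //.
  by apply: measurable_funD => //; exact: measurableT_comp.
by move=> z; rewrite lee_fin.
Qed.

End mean.

(** * Trading one summand for a Gaussian increment *)
Section swap.
Context {d} {T : measurableType d} {R : realType} (P : probability T R).
Variable xi : T -> R.
Hypothesis bxi : bounded_rv xi.
Local Notation mean := (rv_mean P).

Lemma measurable_tail_kernel (u r : R) : measurable_fun setT (tail_kernel u r).
Proof.
apply: continuous_measurable_fun => x.
have := is_derive_tail_kernel u r x => H.
by apply: differentiable_continuous; apply/derivable1_diffP; case: H.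
Qed.

Lemma tail_kernel01 (u r x : R) : 0 <= tail_kernel u r x <= 1.
Proof. by rewrite std_normal_tail_ge0 std_normal_tail_le1. Qed.

Lemma bounded_tail_kernel (u r x : R) (f : T -> R) : measurable_fun setT f ->
  bounded_rv (fun w => tail_kernel u r (x + f w)).
Proof.
move=> mf; split.
  apply: measurableT_comp; first exact: measurable_tail_kernel.
  by apply: measurable_funD.
by exists 1 => w; have /andP[a b] := tail_kernel01 u r (x + f w); rewrite ger0_norm.
Qed.

Variables (t e : R).
Hypothesis t0 : 0 < t.
Hypothesis e01 : 0 < e <= 1.

Let m1 := mean xi.
Let m2 := mean (fun w => xi w ^+ 2).
Let m3 := mean (fun w => `|xi w| ^+ 3 * expR (t * `|xi w|)).

Let b1 : bounded_rv (fun w => `|xi w| ^+ 3 * expR (t * `|xi w|)).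
Proof.
apply: bounded_rvM; first exact/bounded_rvX/bounded_rv_norm.
apply: bounded_rv_expR; apply: bounded_rvM; first exact: bounded_rv_cst.
exact: bounded_rv_norm.
Qed.

Let b2 (a b c : R) : bounded_rv (fun w => a + b * xi w + c * (xi w ^+ 2 / 2)).
Proof.
apply: bounded_rvD.
  apply: bounded_rvD; first exact: bounded_rv_cst.
  by apply: bounded_rvM; first exact: bounded_rv_cst.
apply: bounded_rvM; first exact: bounded_rv_cst.
by apply: bounded_rvM; [exact: bounded_rvX|exact: bounded_rv_cst].
Qed.

Let mean2 (a b c : R) :
  mean (fun w => a + b * xi w + c * (xi w ^+ 2 / 2)) = a + b * m1 + c * (m2 / 2).
Proof.
have -> : (fun w => a + b * xi w + c * (xi w ^+ 2 / 2)) =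
    (fun w => a + b * xi w + (c / 2) * (xi w ^+ 2)).
  by apply/funext => w; field.
have bx2 : bounded_rv (fun w => xi w ^+ 2) by exact: bounded_rvX.
rewrite meanD; last 2 first.
- apply: bounded_rvD; first exact: bounded_rv_cst.
  by apply: bounded_rvM => //; exact: bounded_rv_cst.
- by apply: bounded_rvM => //; exact: bounded_rv_cst.
rewrite meanD; last 2 first.
- exact: bounded_rv_cst.
- by apply: bounded_rvM => //; exact: bounded_rv_cst.
by rewrite mean_cst !meanZ// /m1 /m2; field.
Qed.

(** The factor exp (t |z|) in the bound on the third derivative is the growth of
    the exponential weight over a step of size z. *)
Lemma mean_taylor (f f1 f2 f3 : R -> R) (x B : R) :
  bounded_rv (fun w => f (x + xi w)) ->
  (forall y : R, is_derive y 1 f (f1 y)) ->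
  (forall y : R, is_derive y 1 f1 (f2 y)) ->
  (forall y : R, is_derive y 1 f2 (f3 y)) ->
  (forall z, `|f3 (x + z)| <= B * expR (t * `|z|)) ->
  `|mean (fun w => f (x + xi w)) - (f x + f1 x * m1 + f2 x * (m2 / 2))| <= B * m3.
Proof.
move=> bf d1 d2 d3 fB.
have B0 : 0 <= B.
  by have := fB 0; rewrite normr0 mulr0 expR0 mulr1; exact: le_trans.
rewrite -mean2 -meanB// -meanZ//.
apply: norm_mean_le.
- by apply: bounded_rvD => //; exact: bounded_rvN.
- by apply: bounded_rvM => //; exact: bounded_rv_cst.
move=> w.
rewrite (_ : B * _ = B * expR (t * `|xi w|) * `|xi w| ^+ 3); last by ring.
apply: taylor3 d1 d2 d3 _ => z zxi.
apply: le_trans (fB z) _; rewrite ler_wpM2l// ler_expR ler_wpM2l//.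
exact: ltW.
Qed.

(** The second order expansion in [xi] and the expansion of the kernel in its
    variance r^2 agree when [xi] is centred with variance r1^2 - r0^2, so only
    the defects of these two moments and the third order terms remain. *)
Lemma one_swap (u x r0 r1 : R) : 0 < r0 -> r0 <= r1 -> e <= t * r0 ->
  `|mean (fun w => tail_kernel u r0 (x + xi w)) - tail_kernel u r1 x| <=
  192 / r0 * tilt_weight t r1 u x *
  (`|m1| + t / e * `|m2 - (r1 ^+ 2 - r0 ^+ 2)| + (t / e) ^+ 2 * m3 +
   (t / e) ^+ 3 * (r1 ^+ 2 - r0 ^+ 2) ^+ 2).
Proof.
move=> r00 r01 etr.
set dl := r1 ^+ 2 - r0 ^+ 2.
have [e0 e1] := andP e01.
have te0 : 0 <= t / e by rewrite divr_ge0 ?ltW.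
have dl0 : 0 <= dl by rewrite /dl; nra.
have r10 : 0 < r1 by apply: lt_le_trans r01.
pose g1 y := gauss1 ((y - u) / r0) / r0 ^+ 1.
pose g2 y := gauss2 ((y - u) / r0) / r0 ^+ 2.
pose g3 y := gauss3 ((y - u) / r0) / r0 ^+ 3.
have wle (r r' y : R) : 0 < r -> r <= r' -> tilt_weight t r u y <= tilt_weight t r' u y.
  move=> rp rr'; rewrite ler_expR lerD2r ler_pM2r// ?invr_gt0//.
  by apply: lerXn2r; rewrite ?nnegrE ?mulr_ge0 ?ler_pM2l// ?ltW// (lt_le_trans rp).
pose W := tilt_weight t r1 u x.
have W0 : 0 <= W by exact: expR_ge0.
have c0 : 0 <= 192 / r0 by rewrite divr_ge0 ?ltW.
have kb (G : R -> R) j y : (j <= 3)%N ->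
    (forall w, `|G w| <= 3 * (1 + `|w|) ^+ j * normal_density w) ->
    `|G ((y - u) / r0) / r0 ^+ j.+1| <= 192 / r0 * tilt_weight t r1 u y * (t / e) ^+ j.
  move=> j3 HG; apply: le_trans (gauss_kernel_bound u y e01 r00 etr j3 HG) _.
  rewrite (_ : 192 * _ / r0 * _ = 192 / r0 * tilt_weight t r0 u y * (t / e) ^+ j); last by ring.
  by rewrite ler_wpM2r ?exprn_ge0// ler_wpM2l ?wle.
have T3 := @mean_taylor (tail_kernel u r0) g1 g2 g3 x (192 / r0 * W * (t / e) ^+ 2)
  (bounded_tail_kernel u r0 x bxi.1).
have {}T3 : `|mean (fun w => tail_kernel u r0 (x + xi w)) -
   (tail_kernel u r0 x + g1 x * m1 + g2 x * (m2 / 2))| <= 192 / r0 * W * (t / e) ^+ 2 * m3.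
  apply: T3.
  - by move=> y; rewrite /g1 expr1; exact: is_derive_tail_kernel.
  - by move=> y; exact: (is_derive_affine u r0 y 1 is_derive_gauss1).
  - by move=> y; exact: (is_derive_affine u r0 y 2 is_derive_gauss2).
  move=> z; apply: le_trans (kb _ _ _ _ gauss3_le) _ => //.
  rewrite [leRHS]mulrAC ler_wpM2r ?exprn_ge0// -[leRHS]mulrA ler_wpM2l// /W /tilt_weight -expRD ler_expR.
  have := ler_norm z; nra.
have H4 : `|tail_kernel u r1 x - tail_kernel u r0 x - dl / 2 * g2 x| <=
    dl ^+ 2 * (192 / r0 * W * (t / e) ^+ 3).
  apply: tail_kernel_heat => // r /andP[r0r rr1].
  have rp : 0 < r by exact: lt_le_trans r0r.
  have etr' : e <= t * r by rewrite (le_trans etr)// ler_pM2l.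
  apply: le_trans (gauss_kernel_bound u x e01 rp etr' _ gauss4_le) _ => //.
  rewrite (_ : 192 * _ / r * _ = 192 * (r^-1 * tilt_weight t r u x) * (t / e) ^+ 3); last by ring.
  rewrite ler_wpM2r ?exprn_ge0// -mulrA ler_wpM2l// ler_pM ?invr_ge0 ?expR_ge0 ?wle//.
    exact: ltW.
  by rewrite lef_pV2.
have H1 : `|g1 x * m1| <= 192 / r0 * W * `|m1|.
  rewrite normrM ler_wpM2r//; have := kb _ 0 x isT gauss1_le.
  by rewrite expr0 mulr1.
have H2 : `|g2 x * ((m2 - dl) / 2)| <= 192 / r0 * W * (t / e * `|m2 - dl|).
  rewrite normrM mulrA ler_pM//; first exact: (kb _ 1 x isT gauss2_le).
  rewrite normrM normfV [`|2|]ger0_norm// ler_pdivrMr//.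
  by have := normr_ge0 (m2 - dl); lra.
rewrite -/W !mulrDr.
set M := mean _ in T3 *; set K0 := tail_kernel u r0 x in T3 H4; set K1 := tail_kernel u r1 x in H4 *.
rewrite (_ : M - K1 = (M - (K0 + g1 x * m1 + g2 x * (m2 / 2))) + g1 x * m1 +
   g2 x * ((m2 - dl) / 2) - (K1 - K0 - dl / 2 * g2 x)); last by field.
apply: le_trans (ler_normB _ _) _.
rewrite (_ : _ * ((t / e) ^+ 3 * _) = dl ^+ 2 * (192 / r0 * W * (t / e) ^+ 3)); last by ring.
apply: lerD => //.
apply: le_trans (ler_normD _ _) _.
rewrite [leRHS]addrAC; apply: lerD => //.
apply: le_trans (ler_normD _ _) _.
by rewrite [leRHS]addrC; apply: lerD => //; rewrite [leRHS]mulrA.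
Qed.

Lemma mgf_bound : mean (fun w => expR (t * xi w)) <=
  expR (t * `|m1| + t ^+ 2 * m2 / 2 + t ^+ 3 * m3).
Proof.
have dE (y : R) : is_derive y 1 (fun y => expR (t * y)) (t * expR (t * y)).
  have H1 : is_derive y 1 (fun y : R => t * y) t.
    by apply: is_derive_eq; rewrite /GRing.scale/=; ring.
  have := @is_derive1_comp R expR (fun y => t * y) y _ _ (is_derive_expR _) H1.
  by rewrite mulrC.
have dEj (c y : R) : is_derive y 1 (fun y => c * expR (t * y)) (c * t * expR (t * y)).
  have ? := dE y; apply: is_derive_eq; rewrite /GRing.scale/=; ring.
have := @mean_taylor (fun y => expR (t * y)) (fun y => t * expR (t * y))
  (fun y => t * t * expR (t * y)) (fun y => t * t * t * expR (t * y)) 0 (t * t * t).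
rewrite mulr0 expR0.
have -> : (fun w => expR (t * (0 + xi w))) = (fun w => expR (t * xi w)).
  by apply/funext => w; rewrite add0r.
move=> /(_ _ dE (dEj t) (dEj (t * t)))/= H.
have {}H : `|mean (fun w => expR (t * xi w)) - (1 + t * 1 * m1 + t * t * 1 * (m2 / 2))| <= t * t * t * m3.
  apply: H.
    by apply: bounded_rv_expR; apply: bounded_rvM => //; exact: bounded_rv_cst.
  move=> z; rewrite add0r normrM ger0_norm; last by rewrite !mulr_ge0// ltW.
  rewrite ler_wpM2l//; first by rewrite !mulr_ge0// ltW.
  by rewrite ger0_norm ?expR_ge0// ler_expR ler_pM2l// ler_norm.
apply: le_trans (expR_ge1Dx _).
have tm : t * m1 <= t * `|m1| by rewrite ler_pM2l ?ler_norm.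
by move: H => /ler_normlP[_]; nra.
Qed.

End swap.

(** * The replacement of all summands *)
Lemma sum_invsqrt_le {R : realType} (n : nat) :
  \sum_(m < n) (Num.sqrt (m.+1%:R : R))^-1 <= 2 * Num.sqrt n%:R.
Proof.
elim: n => [|n IH]; first by rewrite big_ord0 sqrtr0 mulr0.
rewrite big_ord_recr/=.
have s0 : 0 < Num.sqrt (n.+1%:R : R) by rewrite sqrtr_gt0 ltr0n.
have t0 : 0 <= Num.sqrt (n%:R : R) by exact: sqrtr_ge0.
have s2 : Num.sqrt (n.+1%:R : R) ^+ 2 = n%:R + 1 by rewrite sqr_sqrtr// natr1.
have t2 : Num.sqrt (n%:R : R) ^+ 2 = n%:R by rewrite sqr_sqrtr.
have st : Num.sqrt (n%:R : R) <= Num.sqrt n.+1%:R by rewrite ler_wsqrtr// ler_nat.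
set s := Num.sqrt n.+1%:R in s0 s2 st *; set t := Num.sqrt n%:R in t0 t2 st IH *.
apply: (@le_trans _ _ (2 * t + s^-1)); first by rewrite lerD2r.
have -> : 2 * s = 2 * t + (2 * s * (s - t)) / s by field; rewrite gt_eqF.
rewrite lerD2l -[leLHS]mul1r ler_pM2r ?invr_gt0//.
by have := sqr_ge0 (s - t); nra.
Qed.

(** The weight at the scale r_k contributes (n - k) / n times t^2 / 2, and the
    moment generating function of k summands contributes the missing k / n: the
    total does not depend on k. *)
Lemma exponent_bound {R : realType} (n k : nat) (t e u a m b : R) :
  0 < t -> (0 < n)%N -> (k < n)%N -> m <= n%:R^-1 -> 0 <= a -> 0 <= b ->
  t ^+ 2 * ((e / t) ^+ 2 + (n - k)%:R / n%:R) / 2 - t * u +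
    k%:R * (t * a + t ^+ 2 * m / 2 + t ^+ 3 * b) <=
  e ^+ 2 / 2 + t ^+ 2 / 2 - t * u + n%:R * (t * a + t ^+ 3 * b).
Proof.
move=> t0 n0 kn mn a0 b0.
have nR0 : 0 < n%:R :> R by rewrite ltr0n.
have kR : k%:R <= n%:R :> R by rewrite ler_nat ltnW.
have a3 : k%:R * (t ^+ 2 * m / 2) <= k%:R * (t ^+ 2 * n%:R^-1 / 2).
  by rewrite ler_wpM2l// ler_pM2r// ler_pM2l ?exprn_gt0.
have a4 : k%:R * (t * a + t ^+ 3 * b) <= n%:R * (t * a + t ^+ 3 * b).
  by rewrite ler_wpM2r// addr_ge0// mulr_ge0 ?exprn_ge0// ltW.
rewrite (natrB _ (ltnW kn)).
have -> : t ^+ 2 * ((e / t) ^+ 2 + (n%:R - k%:R) / n%:R) / 2 =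
    e ^+ 2 / 2 + t ^+ 2 / 2 - k%:R * (t ^+ 2 * n%:R^-1 / 2).
  by field; rewrite !gt_eqF.
by rewrite !mulrDr in a3 a4 *; lra.
Qed.

(** A Riemann sum of v^(-1/2) over [0, 1], except for the smallest scale, which
    is h itself. *)
Lemma sum_inv_scale {R : realType} (n : nat) (h : R) : (0 < n)%N -> 0 < h ->
  \sum_(k < n) (Num.sqrt (h ^+ 2 + (n - k.+1)%:R / n%:R))^-1 <= h^-1 + 2 * n%:R.
Proof.
case: n => // n _ h0.
rewrite big_ord_recr/= addrC; apply: lerD.
  by rewrite subnn mul0r addr0 sqrtr_sqr ger0_norm// ltW.
rewrite (reindex_inj rev_ord_inj)/=.
apply: (@le_trans _ _ (\sum_(m < n) Num.sqrt n.+1%:R * (Num.sqrt (m.+1%:R : R))^-1)).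
  apply: ler_sum => m _.
  have -> : (n.+1 - (n - m.+1).+1)%N = m.+1 by rewrite subSS subKn.
  have n0 : 0 < Num.sqrt n.+1%:R :> R by rewrite sqrtr_gt0 ltr0n.
  have m0 : 0 < Num.sqrt m.+1%:R :> R by rewrite sqrtr_gt0 ltr0n.
  have h2 : 0 < h ^+ 2 by rewrite exprn_gt0.
  rewrite -[leRHS]invrK lef_pV2 ?posrE; last 2 first.
  - by rewrite sqrtr_gt0 ltr_wpDr// divr_ge0.
  - by rewrite invr_gt0 divr_gt0.
  rewrite invf_div.
  rewrite -sqrtrV// -sqrtrM//.
  by rewrite ler_wsqrtr// lerDr ltW.
rewrite -mulr_sumr.
apply: (@le_trans _ _ (Num.sqrt n.+1%:R * (2 * Num.sqrt n%:R))).
  by rewrite ler_wpM2l ?sqrtr_ge0// sum_invsqrt_le.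
rewrite mulrCA ler_pM2l//.
apply: (@le_trans _ _ (Num.sqrt n.+1%:R * Num.sqrt n.+1%:R)).
  by rewrite ler_wpM2l ?sqrtr_ge0// ler_wsqrtr// ler_nat.
by rewrite -expr2 sqr_sqrtr.
Qed.

Section lindeberg.
Context {d} {T : measurableType d} {R : realType} (P : probability T R).
Variables (X : nat -> {RV P >-> R}) (phi : R -> R) (M : R).
Hypothesis iidX : iid X.
Hypothesis mphi : measurable_fun setT phi.
Hypothesis bphi : forall x, `|phi x| <= M.
Local Notation mean := (rv_mean P).
Local Notation S := (sum_of X phi).
Let xi w := phi (X 0%N w).

Lemma bounded_phi i : bounded_rv (fun w => phi (X i w)).
Proof. by split; [exact: measurableT_comp|exists M]. Qed.

Lemma bounded_sum_of k : bounded_rv (S k).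
Proof.
split; first exact: measurable_sum_of.
exists (M *+ k) => w; rewrite /sum_of (le_trans (ler_norm_sum _ _ _))//.
by rewrite (le_trans (ler_sum _ (fun i _ => bphi _)))// sumr_const card_ord.
Qed.

Lemma mean_sum_ofS k (f : R -> R) : measurable_fun setT f -> (forall x, 0 <= f x) ->
  (forall s, bounded_rv (fun w => f (s + xi w))) ->
  mean (fun w => f (S k.+1 w)) = mean (fun w => mean (fun w' => f (S k w + xi w'))).
Proof.
move=> mf f0 bf; rewrite /rv_mean /Rintegral; congr fine.
rewrite (integral_sum_ofS mphi iidX k (f := fun x => (f x)%:E)); last 2 first.
- exact/measurable_EFinP.
- by move=> x; rewrite lee_fin.
apply: eq_integral => w _; rewrite fineK//.
apply: integrable_fin_num => //; exact: bounded_rv_integrable.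
Qed.

Variables (t e : R).
Hypothesis t0 : 0 < t.
Hypothesis e01 : 0 < e <= 1.

Let m1 := mean xi.
Let m2 := mean (fun w => xi w ^+ 2).
Let m3 := mean (fun w => `|xi w| ^+ 3 * expR (t * `|xi w|)).

Lemma bounded_exp (a : R) f : bounded_rv f -> bounded_rv (fun w : T => expR (a * f w)).
Proof.
by move=> bf; apply/bounded_rv_expR/bounded_rvM => //; exact: bounded_rv_cst.
Qed.

Lemma mgf_sum_of k :
  mean (fun w => expR (t * S k w)) = mean (fun w => expR (t * xi w)) ^+ k.
Proof.
elim: k => [|k IH].
  rewrite expr0 -[RHS](mean_cst P); congr mean; apply/funext => w.
  by rewrite /sum_of big_ord0 mulr0 expR0.
have H s : (fun w => expR (t * (s + xi w))) = (fun w => expR (t * s) * expR (t * xi w)).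
  by apply/funext => w; rewrite mulrDr expRD.
rewrite (@mean_sum_ofS k (fun x => expR (t * x))).
- have bS : bounded_rv (fun w => expR (t * S k w)) by exact/bounded_exp/bounded_sum_of.
  rewrite exprS -IH -(meanZ P _ bS).
  congr mean; apply/funext => w.
  by rewrite H (meanZ P _ (bounded_exp t (bounded_phi 0))) mulrC.
- by apply: measurableT_comp => //; exact: mulrl_measurable.
- by move=> x; exact: expR_ge0.
- move=> s; rewrite H; apply: bounded_rvM; first exact: bounded_rv_cst.
  exact/bounded_exp/bounded_phi.
Qed.

Let A (dl : R) : R := `|m1| + t / e * `|m2 - dl| + (t / e) ^+ 2 * m3 + (t / e) ^+ 3 * dl ^+ 2.

Let m30 : 0 <= m3.
Proof. by apply: mean_ge0 => w; rewrite mulr_ge0 ?exprn_ge0 ?expR_ge0. Qed.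

Let A0 (dl : R) : 0 <= dl -> 0 <= A dl.
Proof.
have [e0 _] := andP e01.
have te0 : 0 <= t / e by rewrite divr_ge0 ?ltW.
by move=> dl0; rewrite /A !addr_ge0// mulr_ge0// exprn_ge0.
Qed.

Lemma bounded_tail_sum u r k : bounded_rv (fun w => tail_kernel u r (S k w)).
Proof.
have := bounded_tail_kernel u r 0 (bounded_sum_of k).1.
by under eq_fun do rewrite add0r.
Qed.

(** [one_swap] at the points S_k, integrated; the expectation of the exponential
    weight factorizes. *)
Lemma swap_step (u r0 r1 : R) k : 0 < r0 -> r0 <= r1 -> e <= t * r0 ->
  `|mean (fun w => tail_kernel u r0 (S k.+1 w)) - mean (fun w => tail_kernel u r1 (S k w))| <=
  192 / r0 * A (r1 ^+ 2 - r0 ^+ 2) *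
    (expR ((t * r1) ^+ 2 / 2 - t * u) * mean (fun w => expR (t * xi w)) ^+ k).
Proof.
move=> r00 r01 etr.
have bxi : bounded_rv xi by exact: bounded_phi.
rewrite mean_sum_ofS; last 3 first.
- exact: measurable_tail_kernel.
- by move=> x; case/andP: (tail_kernel01 u r0 x).
- by move=> s; apply: bounded_tail_kernel; case: bxi.
have bm : bounded_rv (fun w => mean (fun w' => tail_kernel u r0 (S k w + xi w'))).
  split.
    have mg : measurable_fun setT (fun x : R => mean (fun w' => tail_kernel u r0 (x + xi w'))).
      apply: measurable_mean_shift; last by case: bxi.
        exact: measurable_tail_kernel.
      by move=> x; case/andP: (tail_kernel01 u r0 x).
    by apply: (measurableT_comp mg); case: (bounded_sum_of k).
  exists 1 => w; rewrite -[leRHS](mean_cst P); apply: norm_mean_le.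
  - by apply: bounded_tail_kernel; case: bxi.
  - exact: bounded_rv_cst.
  move=> w'; have /andP[a b] := tail_kernel01 u r0 (S k w + xi w').
  by rewrite ger0_norm.
rewrite -meanB//; last exact: bounded_tail_sum.
have bS : bounded_rv (fun w => expR (t * S k w)) by exact/bounded_exp/bounded_sum_of.
have bcS : bounded_rv (fun w => expR ((t * r1) ^+ 2 / 2 - t * u) * expR (t * S k w)).
  by apply: bounded_rvM => //; exact: bounded_rv_cst.
rewrite -mgf_sum_of -(meanZ P _ bS) -(meanZ P _ bcS).
apply: norm_mean_le.
- by apply: bounded_rvD => //; apply: bounded_rvN; exact: bounded_tail_sum.
- by apply: bounded_rvM => //; exact: bounded_rv_cst.
move=> w; apply: le_trans (one_swap P bxi t0 e01 u (S k w) r00 r01 etr) _.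
rewrite -expRD le_eqVlt; apply/orP; left; apply/eqP.
rewrite mulrAC; congr (_ * expR _).
by ring.
Qed.

(** The steps are summed along the scales sqrt ((e / t)^2 + (n - k) / n). *)
Lemma lindeberg_tail (n : nat) (u : R) : (0 < n)%N -> m2 <= n%:R^-1 ->
  `|mean (fun w => tail_kernel u (e / t) (S n w)) -
    std_normal_tail (u / Num.sqrt ((e / t) ^+ 2 + 1))| <=
  192 * (t / e + 2 * n%:R) * A n%:R^-1 *
    expR (e ^+ 2 / 2 + t ^+ 2 / 2 - t * u + n%:R * (t * `|m1| + t ^+ 3 * m3)).
Proof.
move=> n0 m2n; have [e0 e1] := andP e01.
have nR0 : 0 < n%:R :> R by rewrite ltr0n.
pose dl : R := n%:R^-1.
have dl0 : 0 < dl by rewrite invr_gt0.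
(* r k ^+ 2 is the variance of the smoothing and of the n - k summands still to come *)
pose r k : R := Num.sqrt ((e / t) ^+ 2 + (n - k)%:R / n%:R).
have h0 : 0 < e / t by rewrite divr_gt0.
have rad k : 0 < (e / t) ^+ 2 + (n - k)%:R / n%:R by rewrite ltr_wpDr ?exprn_gt0// divr_ge0.
have r2 k : r k ^+ 2 = (e / t) ^+ 2 + (n - k)%:R / n%:R by rewrite /r sqr_sqrtr// ltW.
have rp k : 0 < r k by rewrite sqrtr_gt0.
have rS k : (k < n)%N -> r k ^+ 2 - r k.+1 ^+ 2 = dl.
  move=> kn; rewrite !r2 /dl (natrB _ kn) (natrB _ (ltnW kn)) -[k.+1%:R]natr1.
  by field; rewrite !gt_eqF.
have rle k : (k < n)%N -> r k.+1 <= r k.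
  by move=> kn; rewrite /r ler_wsqrtr// lerD2l ler_pM2r ?invr_gt0// ler_nat leq_sub2l.
have hr k : e <= t * r k.
  rewrite mulrC -ler_pdivrMr// -[leLHS](ger0_norm (ltW h0)) -sqrtr_sqr.
  by rewrite ler_wsqrtr// lerDl divr_ge0.
pose D k := mean (fun w => tail_kernel u (r k) (S k w)).
have D0E : D 0%N = std_normal_tail (u / Num.sqrt ((e / t) ^+ 2 + 1)).
  rewrite /D -[RHS](mean_cst P); congr mean; apply/funext => w.
  by rewrite /tail_kernel /sum_of big_ord0 subr0 /r subn0 divff// gt_eqF.
have DnE : D n = mean (fun w => tail_kernel u (e / t) (S n w)).
  by rewrite /D /r subnn mul0r addr0 sqrtr_sqr ger0_norm// ltW.
rewrite -D0E -DnE.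
have -> : D n - D 0%N = \sum_(k < n) (D k.+1 - D k).
  by rewrite -(big_mkord xpredT (fun k => D k.+1 - D k)) telescope_sumr.
apply: le_trans (ler_norm_sum _ _ _) _.
set E := expR (e ^+ 2 / 2 + _ - _ + _).
have cA : 0 <= 192 * A dl := mulr_ge0 (ler0n _ _) (A0 (ltW dl0)).
have step (k : 'I_n) : `|D k.+1 - D k| <= 192 * A dl * E * (r k.+1)^-1.
  have kn := ltn_ord k.
  apply: le_trans (swap_step u k (rp _) (rle _ kn) (hr _)) _.
  rewrite (rS _ kn).
  rewrite (_ : 192 / r k.+1 * A dl * _ = 192 * A dl * (expR ((t * r k) ^+ 2 / 2 - t * u) *
   mean (fun w : T => expR (t * xi w)) ^+ k) * (r k.+1)^-1); last by ring.
  have rinv : 0 <= (r k.+1)^-1 by rewrite invr_ge0; exact: ltW (rp _).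
  apply: (ler_wpM2r rinv); apply: (ler_wpM2l cA).
  apply: le_trans (_ : _ <= expR ((t * r k) ^+ 2 / 2 - t * u) *
    expR (t * `|m1| + t ^+ 2 * m2 / 2 + t ^+ 3 * m3) ^+ k) _.
    apply: ler_wpM2l; first exact: expR_ge0.
    apply: lerXn2r.
    - by rewrite nnegrE; apply: mean_ge0 => w; exact: expR_ge0.
    - by rewrite nnegrE expR_ge0.
    - exact: (mgf_bound P (bounded_phi 0) t0).
  rewrite -expRM_natl -expRD ler_expR exprMn r2.
  exact: (exponent_bound e u t0 n0 kn m2n (normr_ge0 m1) m30).
apply: (@le_trans _ _ (\sum_(k < n) (192 * A dl * E * (r k.+1)^-1))).
  by apply: ler_sum => k _; exact: step.
rewrite -mulr_sumr.
rewrite (_ : 192 * (t / e + 2 * n%:R) * A n%:R^-1 * E = 192 * A dl * E * (t / e + 2 * n%:R)); last by rewrite /dl; ring.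
apply: ler_wpM2l; first exact: mulr_ge0 cA (expR_ge0 _).
by rewrite -invf_div; exact: sum_inv_scale.
Qed.

End lindeberg.

(** * Ratios of normal tails *)
Section cvg_helpers.
Context {R : realType} {I : Type} {F : set_system I} {FF : Filter F}.
Implicit Types f g : I -> R.

Lemma cvg_expR f (l : R) : f i @[i --> F] --> l -> expR (f i) @[i --> F] --> expR l.
Proof. by move=> fl; apply: (continuous_cvg _ _ fl); exact: continuous_expR. Qed.

Lemma cvg_sqrtr f (l : R) : f i @[i --> F] --> l ->
  Num.sqrt (f i) @[i --> F] --> Num.sqrt l.
Proof. by move=> fl; apply: (continuous_cvg _ _ fl); exact: sqrt_continuous. Qed.

Lemma cvg_sqr f (l : R) : f i @[i --> F] --> l -> f i ^+ 2 @[i --> F] --> l ^+ 2.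
Proof. by move=> fl; exact: (cvgM fl fl). Qed.

Lemma cvg_ext_near f g (l : R) : (\forall i \near F, f i = g i) ->
  f i @[i --> F] --> l -> g i @[i --> F] --> l.
Proof. by move=> fg; apply: cvg_trans; apply: near_eq_cvg. Qed.

Lemma cvg_invy f : f i @[i --> F] --> +oo -> (f i)^-1 @[i --> F] --> (0 : R).
Proof.
move=> foo; apply/(@gtr0_cvgV0 R I F FF) => //.
by move/cvgryPgt : foo => /(_ 0).
Qed.

Lemma cvg_le0 f g : (\forall i \near F, 0 <= f i <= g i) ->
  g i @[i --> F] --> (0 : R) -> f i @[i --> F] --> (0 : R).
Proof. by move=> fg g0; apply: (squeeze_cvgr fg) => //; exact: cvg_cst. Qed.

End cvg_helpers.

(** By Mills' ratio, the quotient of the tails behaves like the quotient of the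
    densities. *)
Lemma std_tail_ratio {R : realType} (v t : nat -> R) (c : R) :
  t n @[n --> \oo] --> +oo -> v n @[n --> \oo] --> +oo ->
  v n / t n @[n --> \oo] --> (1 : R) ->
  (v n ^+ 2 - t n ^+ 2) / 2 @[n --> \oo] --> c ->
  std_normal_tail (v n) / std_normal_tail (t n) @[n --> \oo] --> expR (- c).
Proof.
move=> too voo vt1 vtc.
pose M (x : R) := x * std_normal_tail x / normal_density x.
have Mt : M (t n) @[n --> \oo] --> (1 : R).
  exact: (cvg_comp _ _ too (@mills_ratio R)).
have Mv : M (v n) @[n --> \oo] --> (1 : R).
  exact: (cvg_comp _ _ voo (@mills_ratio R)).
have L : M (v n) / M (t n) * (v n / t n)^-1 * expR (- ((v n ^+ 2 - t n ^+ 2) / 2))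
    @[n --> \oo] --> 1 / 1 * 1^-1 * expR (- c).
  apply: cvgM; last by apply: cvg_expR; exact: cvgN.
  apply: cvgM; last by apply: cvgV => //; exact: oner_neq0.
  by apply: cvgM => //; apply: cvgV => //; exact: oner_neq0.
rewrite invr1 !mul1r in L.
apply: cvg_ext_near L; near=> n.
have t0 : 0 < t n by near: n; move/cvgryPgt : too; apply.
have v0 : 0 < v n by near: n; move/cvgryPgt : voo; apply.
have -> : expR (- ((v n ^+ 2 - t n ^+ 2) / 2)) = normal_density (v n) / normal_density (t n).
  rewrite /normal_density -mulf_div divff ?mul1r; last first.
    by rewrite gt_eqF// invr_gt0 sqrtr_gt0 mulr_gt0// pi_gt0.
  by rewrite -expRN -expRD; congr expR; field.
rewrite /M; have dt := normal_density_gt0 (t n); have dv := normal_density_gt0 (v n).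
have Qt : 0 < std_normal_tail (t n).
  apply: lt_le_trans (std_normal_tail_ge_density t0).
  by rewrite mulr_gt0// divr_gt0// ltr_pwDl// sqr_ge0.
by field; rewrite !gt_eqF.
Unshelve. all: by end_near. Qed.

Lemma std_tail_ratio_kernel {R : realType} (t : nat -> R) (c e : R) :
  t n @[n --> \oo] --> +oo ->
  std_normal_tail ((t n + c / t n) / Num.sqrt ((e / t n) ^+ 2 + 1)) /
    std_normal_tail (t n) @[n --> \oo] --> expR (- c + e ^+ 2 / 2).
Proof.
move=> too.
have ti : (t n)^-1 @[n --> \oo] --> (0 : R) by exact: cvg_invy.
have ti2 : (t n)^-1 ^+ 2 @[n --> \oo] --> (0 : R).
  by rewrite -[X in _ --> X](expr0n R 2); exact: cvg_sqr.
have q1 : (e / t n) ^+ 2 + 1 @[n --> \oo] --> (1 : R).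
  rewrite -[X in _ --> X]add0r; apply: cvgD; last exact: cvg_cst.
  rewrite -[X in _ --> X](expr0n R 2); apply: cvg_sqr.
  by rewrite -[X in _ --> X](mulr0 e); apply: cvgM => //; exact: cvg_cst.
have sq1 : Num.sqrt ((e / t n) ^+ 2 + 1) @[n --> \oo] --> (1 : R).
  by rewrite -[X in _ --> X]sqrtr1; exact: cvg_sqrtr.
have vt : (t n + c / t n) / Num.sqrt ((e / t n) ^+ 2 + 1) / t n @[n --> \oo] --> (1 : R).
  have : (1 + c * (t n)^-1 ^+ 2) / Num.sqrt ((e / t n) ^+ 2 + 1) @[n --> \oo] --> (1 + c * 0) / (1 : R).
    apply: cvgM; last by apply: cvgV => //; exact: oner_neq0.
    by apply: cvgD; [exact: cvg_cst|apply: cvgM => //; exact: cvg_cst].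
  rewrite mulr0 addr0 divr1; apply: cvg_ext_near; near=> n.
  have t0 : 0 < t n by near: n; move/cvgryPgt : too; apply.
  have s0 : 0 < Num.sqrt ((e / t n) ^+ 2 + 1) by rewrite sqrtr_gt0 ltr_wpDl// sqr_ge0.
  by field; rewrite !gt_eqF.
rewrite (_ : - c + e ^+ 2 / 2 = - (c - e ^+ 2 / 2)); last by ring.
apply: std_tail_ratio => //.
- apply/cvgryPge => A; near=> n.
  have t0 : 0 < t n by near: n; move/cvgryPgt : too; apply.
  have tA : 2 * `|A| <= t n by near: n; move/cvgryPge : too; apply.
  have : 2^-1 < (t n + c / t n) / Num.sqrt ((e / t n) ^+ 2 + 1) / t n.
    by near: n; apply: (cvgr_gt 1) => //; rewrite invf_lt1// ltr1n.
  rewrite ltr_pdivlMr// => /ltW; apply: le_trans.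
  by have := ler_norm A; lra.
- have : (c + (c ^+ 2 * (t n)^-1 ^+ 2 - e ^+ 2) / 2) / ((e / t n) ^+ 2 + 1) @[n --> \oo]
     --> (c + (c ^+ 2 * 0 - e ^+ 2) / 2) / (1 : R).
    apply: cvgM; last by apply: cvgV => //; exact: oner_neq0.
    apply: cvgD; first exact: cvg_cst.
    apply: cvgM; last exact: cvg_cst.
    apply: cvgD; last exact: cvg_cst.
    by apply: cvgM => //; exact: cvg_cst.
  rewrite mulr0 sub0r divr1 mulNr; apply: cvg_ext_near; near=> n.
  have t0 : 0 < t n by near: n; move/cvgryPgt : too; apply.
  have s0 : 0 < (e / t n) ^+ 2 + 1 by rewrite ltr_wpDl// sqr_ge0.
  rewrite (_ : ((t n + c / t n) / Num.sqrt ((e / t n) ^+ 2 + 1)) ^+ 2 =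
    (t n + c / t n) ^+ 2 / ((e / t n) ^+ 2 + 1)); last first.
    by rewrite expr_div_n sqr_sqrtr// ltW.
  have te : 0 < t n ^+ 2 + e ^+ 2 by rewrite ltr_pwDl ?exprn_gt0// sqr_ge0.
  have te' : e ^+ 2 + t n ^+ 2 != 0 by rewrite addrC gt_eqF.
  by field; rewrite ?te' !gt_eqF.
Unshelve. all: by end_near. Qed.

(** * Truncated moments *)
Section truncation.
Context {R : realType}.

Definition below (y : R) (f : R -> R) (x : R) : R := if `|x| <= y then f x else 0.
Definition above (y : R) (f : R -> R) (x : R) : R := if `|x| <= y then 0 else f x.

Lemma below_above y f x : f x = below y f x + above y f x.
Proof. by rewrite /below /above; case: ifP; rewrite ?addr0 ?add0r. Qed.

Let mle (y : R) : measurable_fun setT (fun x : R => `|x| <= y).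
Proof. by apply: measurable_fun_ler => //; exact: measurableT_comp. Qed.

Lemma measurable_below y f : measurable_fun setT f -> measurable_fun setT (below y f).
Proof. by move=> mf; apply: measurable_fun_ifT => //; exact: mle. Qed.

Lemma measurable_above y f : measurable_fun setT f -> measurable_fun setT (above y f).
Proof. by move=> mf; apply: measurable_fun_ifT => //; exact: mle. Qed.

Lemma above_le y f x : `|above y f x| <= `|f x|.
Proof. by rewrite /above; case: ifP => // _; rewrite normr0. Qed.

End truncation.

Section integrable_mean.
Context {d} {T : measurableType d} {R : realType} (P : probability T R).
Implicit Types f g : T -> R.
Local Notation mean := (rv_mean P).

Definition integrable_rv f := P.-integrable setT (EFin \o f).

Lemma dominated_integrable f g : measurable_fun setT f ->
  (forall w, `|f w| <= `|g w|) -> integrable_rv g -> integrable_rv f.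
Proof.
move=> mf fg ig; apply: (le_integrable measurableT _ _ ig).
  exact/measurable_EFinP.
by move=> w _; rewrite /= lee_fin.
Qed.

Lemma le_mean_int f g : integrable_rv f -> integrable_rv g ->
  (forall w, f w <= g w) -> mean f <= mean g.
Proof. by move=> fi gi fg; apply: le_Rintegral. Qed.

Lemma norm_mean_int_le f g : integrable_rv f -> integrable_rv g ->
  (forall w, `|f w| <= g w) -> `|mean f| <= mean g.
Proof.
move=> fi gi fg; apply: (@le_trans _ _ (mean (fun w => `|f w|))).
  exact: le_normr_Rintegral.
by apply: le_mean_int => //; exact: integrable_norm.
Qed.

Lemma ge0_integrable f : measurable_fun setT f -> (forall w, 0 <= f w) ->
  ('E_P[f] < +oo)%E -> integrable_rv f.
Proof.
move=> mf f0 foo; apply/integrableP; split; first exact/measurable_EFinP.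
apply: le_lt_trans foo; rewrite unlock le_eqVlt; apply/orP; left; apply/eqP.
by apply: eq_integral => w _; rewrite /= ger0_norm.
Qed.

Lemma mean_EFin f : integrable_rv f -> ('E_P[f] = (mean f)%:E)%E.
Proof.
move=> fi; rewrite unlock /rv_mean /Rintegral fineK//.
exact: integrable_fin_num.
Qed.

End integrable_mean.

Section truncated_moments.
Context {d} {T : measurableType d} {R : realType} (P : probability T R).
Variable (X : {RV P >-> R}).
Hypothesis X_mean : ('E_P[X] = 0)%E.
Hypothesis X_var : ('E_P[(fun w => (X w) ^+ 2)%R] = 1)%E.
Local Notation mean := (rv_mean P).

Lemma integrable_sqr : integrable_rv P (fun w => X w ^+ 2).
Proof.
apply: ge0_integrable.
- by apply: measurable_funX.
- by move=> w; exact: sqr_ge0.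
- by rewrite X_var ltry.
Qed.

Lemma integrable_rv1 : integrable_rv P X.
Proof.
apply: (@dominated_integrable _ _ _ _ _ (fun w => X w ^+ 2 + 1)) => //.
  move=> w; rewrite [leRHS]ger0_norm ?addr_ge0 ?sqr_ge0// -(real_normK (num_real (X w))).
  by have := normr_ge0 (X w); nra.
have := integrableD measurableT integrable_sqr
  (bounded_rv_integrable P (bounded_rv_cst (1 : R))).
by apply: eq_integrable => // w _.
Qed.

Lemma mean_X0 : mean X = 0.
Proof. by move: X_mean; rewrite (mean_EFin integrable_rv1) => -[]. Qed.

Lemma mean_Xsqr : mean (fun w => X w ^+ 2) = 1.
Proof. by move: X_var; rewrite (mean_EFin integrable_sqr) => -[]. Qed.

Variables (s y : R).
Hypothesis s0 : 0 < s.
Hypothesis sy : s <= y.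

Let xi w := below y (fun x => x / s) (X w).
Let B := mean (fun w => above y (fun x => x ^+ 2) (X w)).

Lemma integrable_above : integrable_rv P (fun w => above y (fun x => x ^+ 2) (X w)).
Proof.
apply: dominated_integrable integrable_sqr.
  apply: measurableT_comp => //; apply: measurable_above; exact: measurable_funX.
by move=> w; exact: above_le.
Qed.

Lemma measurable_xi : measurable_fun setT (below y (fun x => x / s)).
Proof. by apply: measurable_below; exact: measurable_funM. Qed.

Lemma below_div_le x : `|below y (fun x => x / s) x| <= y / s.
Proof.
have ys : 0 <= y / s by rewrite divr_ge0// ?(le_trans (ltW s0))// ltW.
rewrite /below; case: ifPn => [xy|]; last by rewrite normr0.
by rewrite normrM normfV [`|s|]gtr0_norm// ler_pM2r ?invr_gt0.
Qed.

Let bxi : bounded_rv xi.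
Proof.
split; first by apply: measurableT_comp => //; exact: measurable_xi.
by exists (y / s) => w; exact: below_div_le.
Qed.

Lemma mean_xi_sqr : mean (fun w => xi w ^+ 2) = (1 - B) / s ^+ 2.
Proof.
have bxi2 : bounded_rv (fun w => s ^+ 2 * xi w ^+ 2).
  by apply: bounded_rvM; [exact: bounded_rv_cst|exact: bounded_rvX].
have H : s ^+ 2 * mean (fun w => xi w ^+ 2) = 1 - B.
  rewrite -meanZ; last exact: bounded_rvX.
  rewrite -mean_Xsqr /B -RintegralB//; last 2 first.
  - exact: integrable_sqr.
  - exact: integrable_above.
  apply: eq_Rintegral => w _; rewrite /xi /below /above; case: ifP => _.
    by field; rewrite gt_eqF.
  by rewrite expr0n/= mulr0 subrr.
by rewrite -H; field; rewrite gt_eqF.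
Qed.

(** As X is centred, the truncated mean is minus the mean of the discarded part,
    on which |X| / s <= X^2 / s^2 because |X| > y >= s. *)
Lemma mean_xi_le : `|mean xi| <= B / s ^+ 2.
Proof.
have y0 : 0 < y by exact: lt_le_trans sy.
have iab : integrable_rv P (fun w => above y (fun x => x / s) (X w)).
  apply: (@dominated_integrable _ _ _ _ _ (fun w => X w / s)).
  - apply: measurableT_comp => //; apply: measurable_above; exact: measurable_funM.
  - by move=> w; exact: above_le.
  have := integrableZr measurableT s^-1 integrable_rv1.
  by apply: eq_integrable.
have -> : mean xi = - mean (fun w => above y (fun x => x / s) (X w)).
  apply/eqP; rewrite -subr_eq0 opprK -RintegralD//; last exact: bounded_rv_integrable.
  rewrite (_ : Rintegral _ _ _ = mean (fun w => X w * s^-1)).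
    by rewrite /rv_mean RintegralZr// -/(rv_mean P X) ?mean_X0 ?mul0r//; exact: integrable_rv1.
  by apply: eq_Rintegral => w _; rewrite -below_above.
have -> : B / s ^+ 2 = mean (fun w => above y (fun x => x ^+ 2) (X w) * (s ^+ 2)^-1).
  by rewrite /rv_mean RintegralZr//; exact: integrable_above.
rewrite normrN; apply: norm_mean_int_le => //.
  have := integrableZr measurableT (s ^+ 2)^-1 integrable_above.
  by apply: eq_integrable.
move=> w; rewrite /above; case: ifPn => [_|]; first by rewrite normr0 mul0r.
rewrite -ltNge => yX.
have sX : s < `|X w| by exact: le_lt_trans yX.
rewrite normrM normfV [`|s|]gtr0_norm// -(real_normK (num_real (X w))).
set v := `|X w| in sX *.
rewrite (_ : v ^+ 2 / s ^+ 2 = v / s * (v / s)); last by field; rewrite gt_eqF.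
rewrite ler_peMl// ?divr_ge0 ?ltW//; first by rewrite (lt_trans s0).
by rewrite ltr_pdivlMr// mul1r.
Qed.

Lemma mean_xi_cube t : mean (fun w => `|xi w| ^+ 3 * expR (t * `|xi w|)) =
  mean (fun w => below y (fun x => `|x| ^+ 3 * expR (t * `|x| / s)) (X w)) / s ^+ 3.
Proof.
have bG : bounded_rv (fun w => `|xi w| ^+ 3 * expR (t * `|xi w|)).
  apply: bounded_rvM; first exact/bounded_rvX/bounded_rv_norm.
  apply: bounded_rv_expR; apply: bounded_rvM; first exact: bounded_rv_cst.
  exact: bounded_rv_norm.
apply: (canRL (mulfK _)); first by rewrite expf_neq0// gt_eqF.
rewrite mulrC -meanZ//; apply: eq_Rintegral => w _.
rewrite /xi /below; case: ifP => _; last by rewrite normr0 expr0n/= mul0r mulr0.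
rewrite normrM normfV [`|s|]gtr0_norm// [in expR _]mulrA.
by rewrite expr_div_n mulrA [s ^+ 3 * _]mulrC divfK// expf_neq0// gt_eqF.
Qed.

End truncated_moments.

(** * Moderate deviations *)
Lemma std_normal_tail_lower {R : realType} (t : R) : 1 <= t ->
  expR (- t ^+ 2 / 2) <= 2 * Num.sqrt (2 * pi) * t * std_normal_tail t.
Proof.
move=> t1; have t0 : 0 < t by exact: lt_le_trans t1.
have H := std_normal_tail_ge_density t0.
have s0 : 0 < Num.sqrt (2 * pi : R) by rewrite sqrtr_gt0 mulr_gt0// pi_gt0.
apply: (@le_trans _ _ (2 * Num.sqrt (2 * pi) * t * (normal_density t * (t / (1 + t ^+ 2))))); last first.
  by rewrite ler_pM2l// !mulr_gt0.
rewrite /normal_density; set E := expR _; set q := Num.sqrt _ in s0 *.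
have E0 : 0 < E by exact: expR_gt0.
have t2 : 0 < 1 + t ^+ 2 by nra.
rewrite (_ : 2 * q * t * (q^-1 * E * (t / (1 + t ^+ 2))) = E * (2 * t ^+ 2 / (1 + t ^+ 2))); last by field; rewrite !gt_eqF.
apply: ler_peMr; first exact: ltW.
by rewrite ler_pdivlMr//; nra.
Qed.

Lemma std_normal_tail_gt0 {R : realType} (t : R) : 1 <= t -> 0 < std_normal_tail t.
Proof.
move=> t1; have t0 : 0 < t by exact: lt_le_trans t1.
apply: lt_le_trans (std_normal_tail_ge_density t0).
by rewrite mulr_gt0 ?normal_density_gt0// divr_gt0// ltr_pwDl// sqr_ge0.
Qed.

(** The exponential in [lindeberg_tail] is of order exp (- t^2 / 2), hence of order
    t times the normal tail at t: one factor t is lost, and is paid for by the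
    powers of t in H. *)
Lemma lindeberg_arith {R : realType} (N s t e c M1 B G : R) :
  0 < N -> 0 < s -> s ^+ 2 = N -> 1 <= t -> 0 < e <= 1 ->
  0 <= M1 -> M1 <= B / N -> 0 <= B -> 0 <= G ->
  let H := t ^+ 2 * B + t ^+ 3 / s * G + t ^+ 4 / N in
  H <= 1 -> t <= e * N ->
  192 * (t / e + 2 * N) *
    (M1 + t / e * (B / N) + (t / e) ^+ 2 * (G / s ^+ 3) + (t / e) ^+ 3 * N^-1 ^+ 2) *
    expR (e ^+ 2 / 2 + t ^+ 2 / 2 - t * (t + c / t) + N * (t * M1 + t ^+ 3 * (G / s ^+ 3))) <=
  2304 * Num.sqrt (2 * pi) * expR (2 - c) / e ^+ 3 * H * std_normal_tail t.
Proof.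
move=> N0 s0 s2 t1 e01 M10 m1 B0 G0 H H1 ten; have [e0 e1] := andP e01.
have t0 : 0 < t by exact: lt_le_trans t1.
have s3 : s ^+ 3 = N * s by rewrite exprS s2 mulrC.
have E1 : e ^+ 2 / 2 + t ^+ 2 / 2 - t * (t + c / t) + N * (t * M1 + t ^+ 3 * (G / s ^+ 3))
   <= - t ^+ 2 / 2 + (2 - c).
  have -> : t * (t + c / t) = t ^+ 2 + c by field; rewrite gt_eqF.
  have a1 : N * (t * M1) <= t ^+ 2 * B.
    apply: (@le_trans _ _ (t * B)); last by rewrite ler_wpM2r//; nra.
    by rewrite mulrCA ler_pM2l// mulrC -ler_pdivlMr.
  have a2 : N * (t ^+ 3 * (G / s ^+ 3)) = t ^+ 3 / s * G.
    by rewrite s3; field; rewrite !gt_eqF.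
  have a3 : 0 <= t ^+ 4 / N by rewrite divr_ge0 ?exprn_ge0// ltW.
  have a4 : e ^+ 2 <= 1 by rewrite expr_le1// ltW.
  by rewrite mulrDr a2; move: H1; rewrite /H; lra.
have EE : expR (e ^+ 2 / 2 + t ^+ 2 / 2 - t * (t + c / t) + N * (t * M1 + t ^+ 3 * (G / s ^+ 3)))
   <= expR (2 - c) * (2 * Num.sqrt (2 * pi) * t * std_normal_tail t).
  apply: (@le_trans _ _ (expR (- t ^+ 2 / 2 + (2 - c)))); first by rewrite ler_expR.
  by rewrite expRD mulrC ler_pM2l ?expR_gt0// std_normal_tail_lower.
have te1 : 1 <= t / e by rewrite ler_pdivlMr// mul1r (le_trans e1).
have e3 : 0 < e ^+ 3 by rewrite exprn_gt0.
have te0 : 0 <= t / e by exact: le_trans te1.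
have K0 : 0 <= M1 + t / e * (B / N) + (t / e) ^+ 2 * (G / s ^+ 3) + (t / e) ^+ 3 * N^-1 ^+ 2.
  have p1 : 0 <= t / e * (B / N) by apply: mulr_ge0 => //; apply: divr_ge0 => //; exact: ltW.
  have p2 : 0 <= (t / e) ^+ 2 * (G / s ^+ 3).
    apply: mulr_ge0; first exact: exprn_ge0.
    by apply: divr_ge0 => //; apply: exprn_ge0; exact: ltW.
  have p3 : 0 <= (t / e) ^+ 3 * N^-1 ^+ 2.
    apply: mulr_ge0; first exact: exprn_ge0.
    by apply: exprn_ge0; rewrite invr_ge0; exact: ltW.
  by rewrite !addr_ge0.
have tn0 : 0 <= t / e + 2 * N by apply: addr_ge0 => //; apply: mulr_ge0 => //; exact: ltW.
have AA : (t / e + 2 * N) * (M1 + t / e * (B / N) + (t / e) ^+ 2 * (G / s ^+ 3) +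
    (t / e) ^+ 3 * N^-1 ^+ 2) * t <= 6 / e ^+ 3 * H.
  have b1 : t / e + 2 * N <= 3 * N.
    have : t / e <= N by rewrite ler_pdivrMr// mulrC.
    by lra.
  have b2 : M1 <= t / e * (B / N).
    apply: le_trans m1 _; apply: ler_peMl => //.
    by apply: divr_ge0 => //; exact: ltW.
  have b3 : (M1 + t / e * (B / N) + (t / e) ^+ 2 * (G / s ^+ 3) + (t / e) ^+ 3 * N^-1 ^+ 2) * t
    <= (N * e ^+ 3)^-1 * (2 * H).
    apply: (@le_trans _ _ ((2 * (t / e * (B / N)) + (t / e) ^+ 2 * (G / s ^+ 3) + (t / e) ^+ 3 * N^-1 ^+ 2) * t)).
      by rewrite ler_pM2r//; lra.
    rewrite s3 (_ : (_ + _) * t = (N * e ^+ 3)^-1 * (2 * (e ^+ 2 * (t ^+ 2 * B)) + e * (t ^+ 3 / s * G) + t ^+ 4 / N)); last first.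
      by field; rewrite !gt_eqF.
    rewrite ler_pM2l ?invr_gt0 ?mulr_gt0// /H.
    have c1 : 0 <= t ^+ 2 * B by rewrite mulr_ge0 ?exprn_ge0// ltW.
    have c2 : 0 <= t ^+ 3 / s * G by rewrite mulr_ge0// divr_ge0 ?exprn_ge0// ltW.
    have c3 : 0 <= t ^+ 4 / N by rewrite divr_ge0 ?exprn_ge0// ltW.
    have c4 : e ^+ 2 <= 1 by rewrite expr_le1// ltW.
    by have := ler_piMl c1 c4; have := ler_piMl c2 e1; lra.
  have b4 := mulr_ge0 K0 (ltW t0).
  rewrite -mulrA; apply: le_trans (ler_pM tn0 b4 b1 b3) _.
  rewrite le_eqVlt; apply/orP; left; apply/eqP; field.
  by rewrite !gt_eqF.
set K := (M1 + _ + _ + _) in AA K0 *.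
apply: (@le_trans _ _ (192 * (t / e + 2 * N) * K * (expR (2 - c) * (2 * Num.sqrt (2 * pi) * t * std_normal_tail t)))).
  by apply: (ler_wpM2l _ EE); apply: (mulr_ge0 _ K0); apply: mulr_ge0 (ler0n _ _) tn0.
set Q := std_normal_tail t; set q := Num.sqrt (2 * pi); set E := expR (2 - c).
have QqE : 0 <= 384 * q * E * Q.
  apply: mulr_ge0; last exact: std_normal_tail_ge0.
  apply: mulr_ge0; last exact: expR_ge0.
  by apply: mulr_ge0 (ler0n _ _) _; exact: sqrtr_ge0.
have := ler_wpM2l QqE AA.
rewrite (_ : 384 * q * E * Q * (6 / e ^+ 3 * H) = 2304 * q * E / e ^+ 3 * H * Q); last by field; rewrite gt_eqF.
apply: le_trans; rewrite le_eqVlt; apply/orP; left; apply/eqP; ring.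
Qed.

Section moderate_deviations.
Context {d} {T : measurableType d} {R : realType} (P : probability T R).
Variables (X : nat -> {RV P >-> R}).
Hypothesis iidX : iid X.
Hypothesis X_mean : ('E_P[X 0%N] = 0)%E.
Hypothesis X_var : ('E_P[(fun w => (X 0%N w) ^+ 2)%R] = 1)%E.
Local Notation mean := (rv_mean P).

Definition tail_sqr (y : R) := mean (fun w => above y (fun x => x ^+ 2) (X 0%N w)).
Definition tilted_cube (y l : R) :=
  mean (fun w => below y (fun x => `|x| ^+ 3 * expR (l * `|x|)) (X 0%N w)).
Definition tail_prob (y : R) := fine (P [set w | y < `|X 0%N w|]).

Definition trunc_sum (y : R) n w : R :=
  sum_of X (below y (fun x => x / Num.sqrt n%:R)) n w.

Lemma tail_sqr_ge0 y : 0 <= tail_sqr y.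
Proof. by apply: mean_ge0 => w; rewrite /above; case: ifP => // _; exact: sqr_ge0. Qed.

Lemma tilted_cube_ge0 y l : 0 <= tilted_cube y l.
Proof.
by apply: mean_ge0 => w; rewrite /below; case: ifP => // _; rewrite mulr_ge0 ?exprn_ge0 ?expR_ge0.
Qed.

Lemma lindeberg_bound (n : nat) (t e c y : R) : (0 < n)%N -> 1 <= t -> 0 < e <= 1 ->
  Num.sqrt n%:R <= y ->
  let G := tilted_cube y (t / Num.sqrt n%:R) in
  let B := tail_sqr y in
  let H := t ^+ 2 * B + t ^+ 3 / Num.sqrt n%:R * G + t ^+ 4 / n%:R in
  H <= 1 -> t <= e * n%:R ->
  `|mean (fun w => tail_kernel (t + c / t) (e / t) (trunc_sum y n w)) -
    std_normal_tail ((t + c / t) / Num.sqrt ((e / t) ^+ 2 + 1))| <=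
  2304 * Num.sqrt (2 * pi) * expR (2 - c) / e ^+ 3 * H * std_normal_tail t.
Proof.
rewrite /trunc_sum => n0 t1 e01; have [e0 e1] := andP e01.
move s_eq : (Num.sqrt n%:R) => s sy.
set G := tilted_cube y (t / s); set B := tail_sqr y.
set H := t ^+ 2 * B + t ^+ 3 / s * G + t ^+ 4 / n%:R; move=> H1 ten.
have t0 : 0 < t by exact: lt_le_trans t1.
have nR0 : 0 < n%:R :> R by rewrite ltr0n.
have s0 : 0 < s by rewrite -s_eq sqrtr_gt0.
have s2 : s ^+ 2 = n%:R by rewrite -s_eq sqr_sqrtr// ltW.
have mxi := measurable_xi s y.
have bx := below_div_le s0 sy.
have B0 : 0 <= B by exact: tail_sqr_ge0.
have G0 : 0 <= G by exact: tilted_cube_ge0.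
have hm : (1 - B) / n%:R <= n%:R^-1.
  by rewrite ler_pdivrMr// mulVf ?gt_eqF// gerBl.
have m1 := mean_xi_le X_mean X_var s0 sy.
have m2 := mean_xi_sqr X_var s0 sy.
have m3 := mean_xi_cube (X 0%N) s0 sy t.
have m3' : mean (fun w => below y (fun x => `|x| ^+ 3 * expR (t * `|x| / s)) (X 0%N w)) = G.
  apply: eq_Rintegral => w _; rewrite /below; case: ifP => // _.
  by congr (_ * expR _); rewrite mulrAC.
have L := @lindeberg_tail _ _ _ _ _ _ _ iidX mxi bx t e t0 e01 n (t + c / t) n0.
rewrite m3 m3' m2 s2 -/B in L.
rewrite s2 -/B in m1.
apply: le_trans (L hm) _.
rewrite (_ : (1 - B) / n%:R - n%:R^-1 = - (B / n%:R)); last by field; rewrite gt_eqF.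
rewrite normrN (ger0_norm (divr_ge0 B0 (ltW nR0))).
exact: (lindeberg_arith c nR0 s0 s2 t1 e01 (normr_ge0 _) m1 B0 G0 H1 ten).
Qed.

End moderate_deviations.

Lemma measurable_gt {d} {T : measurableType d} {R : realType} (S : T -> R) (t : R) : measurable_fun setT S ->
  measurable [set w | t < S w].
Proof.
move=> mS; rewrite (_ : [set w | t < S w] = S @^-1` `]t, +oo[); last first.
  by apply/seteqP; split => w /=; rewrite in_itv/= andbT.
by rewrite -[X in measurable X]setTI; exact: mS.
Qed.

Section sandwich.
Context {d} {T : measurableType d} {R : realType} (P : probability T R).
Local Notation mean := (rv_mean P).

Lemma mean_indic (A : set T) : measurable A -> mean (\1_A) = fine (P A).
Proof. by move=> mA; rewrite /rv_mean /Rintegral integral_indic// setIT. Qed.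

Lemma bounded_indic (A : set T) : measurable A -> bounded_rv (\1_A : T -> R).
Proof.
move=> mA; split; first exact: measurable_indic.
by exists 1 => w; rewrite indicE; case: (_ \in _); rewrite /= ?normr1 ?normr0.
Qed.

Variables (S : T -> R) (t a h : R).
Hypothesis mS : measurable_fun setT S.
Hypotheses (a0 : 0 <= a) (h0 : 0 < h).

Let mA : measurable [set w | t < S w].
Proof. exact: measurable_gt. Qed.

Let bk u : bounded_rv (fun w => tail_kernel u h (S w)).
Proof.
have := bounded_tail_kernel u h 0 mS.
by under eq_fun do rewrite add0r.
Qed.

(** On the event S > t the kernel centred at t - a h is at least Q(- a). *)
Lemma tail_prob_upper : 0 < std_normal_tail (- a) ->
  fine (P [set w | t < S w]) <=
  mean (fun w => tail_kernel (t - a * h) h (S w)) / std_normal_tail (- a).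
Proof.
move=> Qa; rewrite -mean_indic// ler_pdivlMr// mulrC -meanZ//; last exact: bounded_indic.
apply: le_mean => //.
  by apply: bounded_rvM; [exact: bounded_rv_cst|exact: bounded_indic].
move=> w; rewrite indicE; case: (boolP (w \in _)) => [|_]; last first.
  by rewrite mulr0 std_normal_tail_ge0.
rewrite inE/= mulr1 => tS; apply: std_normal_tail_nonincr.
by rewrite ler_pdivrMr//; lra.
Qed.

(** Where S <= t, the kernel centred at t + a h is at most exp (- a^2 / 2) times
    the kernel centred at t, by [std_normal_tailD]. *)
Lemma tail_prob_lower :
  mean (fun w => tail_kernel (t + a * h) h (S w)) <=
  fine (P [set w | t < S w]) +
    expR (- a ^+ 2 / 2) * mean (fun w => tail_kernel t h (S w)).
Proof.
have b2 : bounded_rv (fun w => expR (- a ^+ 2 / 2) * tail_kernel t h (S w)).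
  by apply: bounded_rvM => //; exact: bounded_rv_cst.
have b1 := bounded_indic mA.
rewrite -mean_indic// -meanZ// -meanD//; apply: le_mean => //.
  exact: bounded_rvD.
move=> w; rewrite indicE; case: (boolP (w \in _)) => [_|].
  rewrite (le_trans (std_normal_tail_le1 _))// lerDl.
  by rewrite mulr_ge0 ?expR_ge0 ?std_normal_tail_ge0.
rewrite notin_setE/= add0r => /negP; rewrite -leNgt => St.
rewrite /tail_kernel (_ : (t + a * h - S w) / h = a + (t - S w) / h); last by field; rewrite gt_eqF.
by apply: std_normal_tailD => //; rewrite divr_ge0 ?subr_ge0// ltW.
Qed.

End sandwich.

Lemma ratio_upper {R : realType} (p0 p1 N A Qa Q b : R) : 0 < Q ->
  p0 <= p1 + N -> p1 <= A / Qa -> A / Q / Qa + N / Q < b -> p0 / Q < b.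
Proof.
move=> Q0 h1 h2; apply: le_lt_trans.
rewrite (_ : A / Q / Qa + N / Q = (A / Qa + N) / Q); last by ring.
by rewrite ler_pM2r ?invr_gt0//; lra.
Qed.

Lemma ratio_lower {R : realType} (p0 p1 N A A0 E Q b : R) : 0 < Q ->
  p1 - N <= p0 -> A <= p1 + E * A0 ->
  b < A / Q - E * (A0 / Q) - N / Q -> b < p0 / Q.
Proof.
move=> Q0 h1 h2 h3; apply: lt_le_trans h3 _.
rewrite (_ : A / Q - E * (A0 / Q) - N / Q = (A - E * A0 - N) / Q); last by ring.
by rewrite ler_pM2r ?invr_gt0//; lra.
Qed.

Section moderate_deviations_limit.
Context {d} {T : measurableType d} {R : realType} (P : probability T R).
Variables (X : nat -> {RV P >-> R}).
Hypothesis iidX : iid X.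
Hypothesis X_mean : ('E_P[X 0%N] = 0)%E.
Hypothesis X_var : ('E_P[(fun w => (X 0%N w) ^+ 2)%R] = 1)%E.
Local Notation mean := (rv_mean P).

Lemma measurable_trunc_sum y n : measurable_fun setT (trunc_sum X y n).
Proof. by apply: measurable_sum_of; exact: measurable_xi. Qed.

Lemma measurable_partial_sum n : measurable_fun setT (fun w => partial_sum X n w / Num.sqrt n%:R).
Proof.
apply: measurable_funM => //; rewrite /partial_sum.
exact: measurable_sum.
Qed.

(** The two sums coincide unless one of the n variables exceeds y. *)
Lemma truncation_error (n : nat) (t y : R) :
  `|fine (P [set w | t < partial_sum X n w / Num.sqrt n%:R]) -
    fine (P [set w | t < trunc_sum X y n w])| <= n%:R * tail_prob X y.
Proof.
have [_ idX] := iidX.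
set A := [set w | t < partial_sum X n w / _].
set A' := [set w | t < trunc_sum X y n w].
pose V i := [set w | y < `|X i w|].
pose U := \big[setU/set0]_(i < n) V i.
have mA : measurable A by apply: measurable_gt; exact: measurable_partial_sum.
have mA' : measurable A' by apply: measurable_gt; exact: measurable_trunc_sum.
have mV i : measurable (V i) by apply: measurable_gt; exact: measurableT_comp.
have mU : measurable U by exact: bigsetU_measurable.
have eqS w : ~ U w -> partial_sum X n w / Num.sqrt n%:R = trunc_sum X y n w.
  move=> nU; rewrite /partial_sum /trunc_sum /sum_of mulr_suml; apply: eq_bigr => i _.
  rewrite /below; case: ifPn => //; rewrite -ltNge => yX; case: nU.
  by rewrite /U -bigcup_mkord; exists i => /=.
have PV i : P (V i) = (tail_prob X y)%:E.
  have mB : measurable [set x : R | y < `|x|].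
    by apply: (@measurable_gt _ _ _ (fun x : R => `|x|)); exact: measurableT_comp.
  rewrite /tail_prob fineK; first exact: (idX i 0%N _ mB).
  by have := mV 0%N; exact: fin_num_measure.
have PU : (P U <= (n%:R * tail_prob X y)%:E)%E.
  apply: (le_trans (Boole_inequality P _)) => //.
  rewrite (eq_bigr (fun=> (tail_prob X y)%:E)); last by move=> i _; exact: PV.
  by rewrite sumEFin sumr_const card_ord mulr_natl.
have AA' : (P A <= P A' + P U)%E.
  apply: (@le_trans _ _ (P (A' `|` U))); last exact: measureU2.
  apply: le_measure; rewrite ?inE//.
    exact: measurableU.
  move=> w Aw; have [Uw|nU] := pselect (U w); first by right.
  by left; rewrite /A' /= -eqS.
have A'A : (P A' <= P A + P U)%E.
  apply: (@le_trans _ _ (P (A `|` U))); last exact: measureU2.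
  apply: le_measure; rewrite ?inE//.
    exact: measurableU.
  move=> w Aw; have [Uw|nU] := pselect (U w); first by right.
  by left; rewrite /A /= eqS.
have fA := fin_num_measure P _ mA; have fA' := fin_num_measure P _ mA'.
have fU := fin_num_measure P _ mU.
have PU' : fine (P U) <= n%:R * tail_prob X y by rewrite -lee_fin fineK.
apply: le_trans PU'; rewrite ler_distl.
by rewrite lerBlDr -!lee_fin !EFinD !fineK// AA' A'A.
Qed.

Variables (t y : nat -> R).
Hypothesis t_oo : t n @[n --> \oo] --> +oo.
Hypothesis y_ge : \forall n \near \oo, Num.sqrt n%:R <= y n.
Hypothesis moments : t n ^+ 2 * tail_sqr X (y n) +
  t n ^+ 3 / Num.sqrt n%:R * tilted_cube X (y n) (t n / Num.sqrt n%:R) +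
  t n ^+ 4 / n%:R @[n --> \oo] --> (0 : R).

Lemma smoothed_tail_equiv (c e : R) : 0 < e <= 1 ->
  mean (fun w => tail_kernel (t n + c / t n) (e / t n) (trunc_sum X (y n) n w)) /
    std_normal_tail (t n) @[n --> \oo] --> expR (- c + e ^+ 2 / 2).
Proof.
move=> e01; have [e0 e1] := andP e01.
pose H n := t n ^+ 2 * tail_sqr X (y n) +
  t n ^+ 3 / Num.sqrt n%:R * tilted_cube X (y n) (t n / Num.sqrt n%:R) +
  t n ^+ 4 / n%:R.
have H0 : H n @[n --> \oo] --> (0 : R) := moments.
pose m n := mean (fun w => tail_kernel (t n + c / t n) (e / t n) (trunc_sum X (y n) n w)).
pose v n := std_normal_tail ((t n + c / t n) / Num.sqrt ((e / t n) ^+ 2 + 1)).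
pose K := 2304 * Num.sqrt (2 * pi) * expR (2 - c) / e ^+ 3.
have D0 : (m n - v n) / std_normal_tail (t n) @[n --> \oo] --> (0 : R).
  have KH : K * H n @[n --> \oo] --> (0 : R).
    by rewrite -(mulr0 K); apply: cvgM => //; exact: cvg_cst.
  have NKH : - (K * H n) @[n --> \oo] --> (0 : R).
    by rewrite -oppr0; exact: cvgN.
  apply: squeeze_cvgr NKH KH; near=> n.
  have t1 : 1 <= t n by near: n; move/cvgryPge : t_oo; apply.
  have t0 : 0 < t n by exact: lt_le_trans t1.
  have n0 : (0 < n)%N by near: n; exists 1%N.
  have sy : Num.sqrt n%:R <= y n by near: n.
  have H1 : H n <= 1 by near: n; apply: (cvgr_le 0).
  have He : H n <= e by near: n; apply: (cvgr_le 0).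
  have Qt := std_normal_tail_gt0 t1.
  have nR0 : 0 < n%:R :> R by rewrite ltr0n.
  have ten : t n <= e * n%:R.
    have t4 : t n ^+ 4 / n%:R <= H n.
      rewrite /H lerDr addr_ge0// mulr_ge0 ?tail_sqr_ge0 ?tilted_cube_ge0 ?sqr_ge0//.
      by rewrite divr_ge0 ?sqrtr_ge0// exprn_ge0// ltW.
    have : t n ^+ 4 <= e * n%:R by rewrite -ler_pdivrMr// (le_trans t4).
    apply: le_trans; rewrite exprS ler_peMr ?(ltW t0)//.
    by rewrite exprn_ege1.
  have L := lindeberg_bound iidX X_mean X_var c n0 t1 e01 sy H1 ten.
  rewrite -/(m n) -/(v n) -/K in L.
  move: L => /ler_normlP[L1 L2].
  rewrite ler_pdivlMr// ler_pdivrMr// mulNr L2 andbT.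
  by rewrite lerNl.
have V := @std_tail_ratio_kernel R t c e t_oo.
rewrite -[X in _ --> X]add0r.
rewrite (_ : (fun n => _) = (fun n => (m n - v n) / std_normal_tail (t n) + v n / std_normal_tail (t n))).
  exact: cvgD.
by apply/funext => n; rewrite -mulrDl subrK.
Unshelve. all: by end_near. Qed.

Hypothesis tail_small :
  n%:R * tail_prob X (y n) / std_normal_tail (t n) @[n --> \oo] --> (0 : R).

Let ratio n := fine (P [set w | t n < partial_sum X n w / Num.sqrt n%:R]) /
  std_normal_tail (t n).

Let cvg_upper : expR (x^-1 + x^-1 ^+ 4 / 2) / std_normal_tail (- x)
  @[x --> +oo] --> (1 : R).
Proof.
have i0 : x^-1 @[x --> +oo] --> (0 : R) by exact: (@cvg_invy R R (pinfty_nbhs R) _ id (@cvg_id _ _)).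
rewrite [X in _ --> X](_ : 1 = expR (0 + (0 ^+ 2) ^+ 2 / 2) / 1 :> R); last first.
  by rewrite !expr2 !mulr0 mul0r addr0 expR0 divr1.
apply: cvgM.
  apply: cvg_expR; apply: cvgD => //; apply: cvgM; last exact: cvg_cst.
  under eq_fun do rewrite -[4%N]/(2 * 2)%N exprM.
  by apply: cvg_sqr; exact: cvg_sqr.
apply: cvgV; first exact: oner_neq0.
by have := @cvg_std_normal_tail_Ny R; rewrite cvgNy_compNP.
Qed.

Let cvg_lower : expR (- x^-1 + x^-1 ^+ 4 / 2) -
  expR (- x ^+ 2 / 2) * expR (x^-1 ^+ 4 / 2) @[x --> +oo] --> (1 : R).
Proof.
have i0 : x^-1 @[x --> +oo] --> (0 : R) by exact: (@cvg_invy R R (pinfty_nbhs R) _ id (@cvg_id _ _)).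
have i4 : x^-1 ^+ 4 / 2 @[x --> +oo] --> ((0 ^+ 2) ^+ 2 / 2 : R).
  apply: cvgM; last exact: cvg_cst.
  under eq_fun do rewrite -[4%N]/(2 * 2)%N exprM.
  by apply: cvg_sqr; exact: cvg_sqr.
rewrite !expr2 !mulr0 mul0r in i4.
rewrite [X in _ --> X](_ : 1 = expR (- 0 + 0) - 0 * expR 0 :> R); last first.
  by rewrite oppr0 addr0 expR0 mul0r subr0.
apply: cvgB.
  by apply: cvg_expR; apply: cvgD => //; exact: cvgN.
apply: cvgM; last exact: cvg_expR.
apply: (@squeeze_cvgr _ _ _ _ (cst 0) (fun x => expR (- x))).
- near=> x; rewrite expR_ge0/= ler_expR.
  have : 2 <= x by near: x; apply: nbhs_pinfty_ge; rewrite num_real.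
  by nra.
- exact: cvg_cst.
- exact: cvgr_expR.
Unshelve. all: by end_near. Qed.

(** For each a, the two enclosing kernels with e = a^-2 have asymptotic ratios to
    the normal tail that are given by the expressions in [cvg_upper] and
    [cvg_lower]; both tend to 1 as a grows. *)
Theorem moderate_deviation_equiv : ratio n @[n --> \oo] --> (1 : R).
Proof.
apply/cvgrPdist_lt => eps eps0.
have eps2 : 0 < eps / 2 by rewrite divr_gt0.
have /cvgrPdist_lt /(_ _ eps2) HU := cvg_upper.
have /cvgrPdist_lt /(_ _ eps2) HL := cvg_lower.
have /cvgrPdist_lt /(_ 1 ltr01) HQ := @cvg_std_normal_tail_Ny R.
have [a [[Ua La] [a1 Qa]]] : exists a : R,
   (`|1 - expR (a^-1 + a^-1 ^+ 4 / 2) / std_normal_tail (- a)| < eps / 2 /\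
    `|1 - (expR (- a^-1 + a^-1 ^+ 4 / 2) -
       expR (- a ^+ 2 / 2) * expR (a^-1 ^+ 4 / 2))| < eps / 2) /\
    (1 <= a /\ `|1 - std_normal_tail (- a)| < 1).
  have HQ' : \forall x \near +oo, `|1 - std_normal_tail (- x : R)| < 1.
    have := @cvg_std_normal_tail_Ny R; rewrite cvgNy_compNP.
    by move/cvgrPdist_lt => /(_ 1 ltr01).
  exact: filter_ex (filterI (filterI HU HL)
    (filterI (nbhs_pinfty_ge (num_real (1 : R))) HQ')).
have {}Qa : 0 < std_normal_tail (- a) by move: Qa => /ltr_normlP[]; lra.
have a0 : 0 < a by exact: lt_le_trans a1.
(* a * e = a^-1 makes the shift of the level, and e the smoothing, negligible for large a *)
pose e := a^-1 ^+ 2.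
have e01 : 0 < e <= 1.
  by rewrite exprn_gt0 ?invr_gt0//= exprn_ile1 ?invr_ge0 ?(ltW a0)// invf_le1.
have [e0 e1] := andP e01.
have ae : a * e = a^-1 by rewrite /e expr2 mulrA divff ?mul1r// gt_eqF.
have e2 : e ^+ 2 = a^-1 ^+ 4 by rewrite /e -exprM.
pose m c n := mean (fun w => tail_kernel (t n + c / t n) (e / t n) (trunc_sum X (y n) n w)).
have M c := @smoothed_tail_equiv c e e01; rewrite e2 in M.
pose err n := n%:R * tail_prob X (y n) / std_normal_tail (t n).
have U1 : m (- a^-1) n / std_normal_tail (t n) / std_normal_tail (- a) + err n @[n --> \oo] -->
    expR (a^-1 + a^-1 ^+ 4 / 2) / std_normal_tail (- a) + 0.
  apply: cvgD => //; apply: cvgM; last exact: cvg_cst.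
  by have := M (- a^-1); rewrite opprK.
have L1 : m (a^-1) n / std_normal_tail (t n) - 
    expR (- a ^+ 2 / 2) * (m 0 n / std_normal_tail (t n)) - err n @[n --> \oo] -->
    expR (- a^-1 + a^-1 ^+ 4 / 2) - expR (- a ^+ 2 / 2) * expR (a^-1 ^+ 4 / 2) - 0.
  apply: cvgB => //; apply: cvgB; first exact: M.
  by apply: cvgM; [exact: cvg_cst|have := M 0; rewrite oppr0 add0r].
rewrite addr0 in U1; rewrite subr0 in L1.
have {}U1 := cvgr_lt _ U1 (1 + eps) _; have {}L1 := cvgr_gt _ L1 (1 - eps) _.
near=> n.
have t1 : 1 <= t n by near: n; move/cvgryPge : t_oo; apply.
have t0 : 0 < t n by exact: lt_le_trans t1.
have Qt := std_normal_tail_gt0 t1.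
have u1 : m (- a^-1) n / std_normal_tail (t n) / std_normal_tail (- a) + err n < 1 + eps.
  by near: n; apply: U1; move: Ua => /ltr_normlP[]; lra.
have l1 : 1 - eps < m (a^-1) n / std_normal_tail (t n) - 
    expR (- a ^+ 2 / 2) * (m 0 n / std_normal_tail (t n)) - err n.
  by near: n; apply: L1; move: La => /ltr_normlP[]; lra.
have TE := truncation_error n (t n) (y n).
have h0 : 0 < e / t n by rewrite divr_gt0.
have mS := measurable_trunc_sum (y n) n.
have TU := tail_prob_upper P (t n) mS h0 Qa.
have TL := tail_prob_lower P (t n) mS (ltW a0) h0.
rewrite mulrA ae -mulNr -/(m (- a^-1) n) in TU.
rewrite mulrA ae -/(m (a^-1) n) in TL.
have m0E : mean (fun w : T => tail_kernel (t n) (e / t n) (trunc_sum X (y n) n w)) = m 0 n.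
  by rewrite /m mul0r addr0.
rewrite m0E in TL.
rewrite ler_distl in TE; case/andP: TE => te2 te1.
move: te1 te2 TU TL; rewrite /ratio.
move: (fine (P [set w | t n < trunc_sum X (y n) n w])) => p1.
move: (fine (P [set w | t n < partial_sum X n w / _])) => p0 te1 te2 TU TL.
have r1 := ratio_upper Qt te1 TU u1.
have r2 := ratio_lower Qt te2 TL l1.
by rewrite distrC ltr_distl r2 r1.
Unshelve. all: by end_near. Qed.

End moderate_deviations_limit.

(** * The Gumbel normalization *)
Lemma cvg_ln_y {R : realType} : @ln R x @[x --> +oo] --> +oo.
Proof.
apply/cvgryPge => A; near=> x.
have x0 : 0 < x by near: x; apply: nbhs_pinfty_gt; rewrite num_real.
have Ax : expR A <= x by near: x; apply: nbhs_pinfty_ge; rewrite num_real.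
by rewrite -(expRK A) ler_ln ?posrE ?expR_gt0.
Unshelve. all: by end_near. Qed.

Lemma cvg_sqrt_y {R : realType} : @Num.sqrt R x @[x --> +oo] --> +oo.
Proof.
apply/cvgryPge => A; near=> x.
have Ax : A ^+ 2 <= x by near: x; apply: nbhs_pinfty_ge; rewrite num_real.
by apply: le_trans (ler_norm A) _; rewrite -sqrtr_sqr ler_wsqrtr.
Unshelve. all: by end_near. Qed.

Lemma ln_le_sqrt {R : realType} (x : R) : 0 < x -> ln x <= 2 * Num.sqrt x.
Proof.
move=> x0; have s0 : 0 < Num.sqrt x by rewrite sqrtr_gt0.
rewrite -{1}(sqr_sqrtr (ltW x0)) lnXn// mulr2n.
by have := ln_sublinear s0; lra.
Qed.

Section gumbel.
Context {R : realType}.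
Variables (p : nat -> nat) (x : R).
Hypothesis p_oo : p n @[n --> \oo] --> \oo.

Let r n : R := Num.sqrt (2 * ln (p n)%:R).
Let dn n : R := gumbel_d (p n)%:R.
Let t n : R := dn n + x / dn n.
Let delta n : R := (ln (2 * pi) + 2 * ln (r n)) / (2 * r n).

Let pR_oo : (p n)%:R @[n --> \oo] --> (+oo : set_system R).
Proof. exact/cvgrnyP. Qed.

Lemma cvg_r : r n @[n --> \oo] --> +oo.
Proof.
apply: (cvg_comp (fun n => 2 * ln (p n)%:R) (@Num.sqrt R)); last exact: cvg_sqrt_y.
apply/cvgryPge => A; near=> n.
rewrite -ler_pdivrMl//; near: n.
by have /cvgryPge := cvg_comp _ _ pR_oo (@cvg_ln_y R); apply.
Unshelve. all: by end_near. Qed.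

Let r_gt1 : \forall n \near \oo, 1 < r n.
Proof. by move/cvgryPgt : cvg_r; apply. Qed.

Let r_sqr n : 1 < r n -> r n ^+ 2 = 2 * ln (p n)%:R.
Proof.
move=> r1; rewrite /r sqr_sqrtr// leNgt; apply/negP => h.
by move: r1; rewrite /r ltr0_sqrtr// ltr10.
Qed.

Let dnE n : 1 < r n -> dn n = r n - delta n.
Proof.
move=> r1; have r0 : 0 < r n by exact: lt_trans r1.
rewrite /dn /gumbel_d -/(r n) /delta; congr (_ - _ / _).
have L : ln (p n)%:R = r n ^+ 2 / 2 by rewrite r_sqr//; field.
rewrite L -lnM ?posrE ?divr_gt0 ?exprn_gt0 ?mulr_gt0 ?pi_gt0//.
rewrite (_ : r n ^+ 2 / 2 * (4 * pi) = 2 * pi * r n ^+ 2); last by field.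
rewrite lnM ?posrE ?exprn_gt0 ?mulr_gt0 ?pi_gt0// lnXn//.
by rewrite -[ln (r n) *+ 2]mulr_natl.
Qed.

Let cvg_delta : delta n @[n --> \oo] --> (0 : R).
Proof.
have i1 : (r n)^-1 @[n --> \oo] --> (0 : R) by apply: cvg_invy; exact: cvg_r.
have i2 : (Num.sqrt (r n))^-1 @[n --> \oo] --> (0 : R).
  by apply: cvg_invy; exact: (cvg_comp _ _ cvg_r (@cvg_sqrt_y R)).
have l1 : ln (r n) / r n @[n --> \oo] --> (0 : R).
  have u : 2 * (Num.sqrt (r n))^-1 @[n --> \oo] --> (0 : R).
    by rewrite -[X in _ --> X](mulr0 2); apply: cvgM => //; exact: cvg_cst.
  apply: cvg_le0 u; near=> n.
  have r1 : 1 < r n by near: n.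
  have r0 : 0 < r n by exact: lt_trans r1.
  have s0 : 0 < Num.sqrt (r n) by rewrite sqrtr_gt0.
  rewrite divr_ge0 ?ln_ge0 ?(ltW r0) ?(ltW r1)//=.
  rewrite ler_pdivrMr// -[X in _ * X](sqr_sqrtr (ltW r0)).
  rewrite (_ : _ * _ = 2 * Num.sqrt (r n)); last by field; rewrite gt_eqF.
  exact: ln_le_sqrt.
rewrite (_ : delta = (fun n => ln (2 * pi) / 2 * (r n)^-1 + ln (r n) / r n)).
  rewrite [X in _ --> X](_ : 0 = ln (2 * pi) / 2 * 0 + 0); last by rewrite mulr0 addr0.
  by apply: cvgD => //; apply: cvgM => //; exact: cvg_cst.
apply/funext => n; rewrite /delta invfM mulrDl; congr (_ + _); first by rewrite mulrA.
by rewrite mulrACA divff// mul1r.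
Unshelve. all: by end_near. Qed.

Let cvg_ratio_d : dn n / r n @[n --> \oo] --> (1 : R).
Proof.
have i1 : (r n)^-1 @[n --> \oo] --> (0 : R) by apply: cvg_invy; exact: cvg_r.
have : 1 - delta n * (r n)^-1 @[n --> \oo] --> (1 - 0 * 0 : R).
  by apply: cvgB; [exact: cvg_cst|exact: cvgM].
rewrite mul0r subr0; apply: cvg_ext_near; near=> n.
have r1 : 1 < r n by near: n.
by rewrite dnE//; field; rewrite gt_eqF// (lt_trans _ r1).
Unshelve. all: by end_near. Qed.

Let cvg_of_ratio (f : nat -> R) : f n / r n @[n --> \oo] --> (1 : R) ->
  f n @[n --> \oo] --> +oo.
Proof.
move=> fr; apply/cvgryPge => A; near=> n.
have r1 : 1 < r n by near: n.
have r0 : 0 < r n by exact: lt_trans r1.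
have rA : 2 * `|A| <= r n by near: n; move/cvgryPge : cvg_r; apply.
have : 2^-1 < f n / r n by near: n; apply: (cvgr_gt 1) => //; rewrite invf_lt1// ltr1n.
rewrite ltr_pdivlMr// => /ltW; apply: le_trans.
by have := ler_norm A; lra.
Unshelve. all: by end_near. Qed.

Let cvg_dn : dn n @[n --> \oo] --> +oo.
Proof. exact: cvg_of_ratio. Qed.

Let cvg_ratio_t : t n / r n @[n --> \oo] --> (1 : R).
Proof.
have i1 : (r n)^-1 @[n --> \oo] --> (0 : R) by apply: cvg_invy; exact: cvg_r.
have i2 : (dn n)^-1 @[n --> \oo] --> (0 : R) by apply: cvg_invy; exact: cvg_dn.
rewrite (_ : (fun n => _) = (fun n => dn n / r n + x * (dn n)^-1 * (r n)^-1)).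
  rewrite [X in _ --> X](_ : 1 = 1 + x * 0 * 0 :> R); last by rewrite !mulr0 addr0.
  by apply: cvgD => //; apply: cvgM => //; apply: cvgM => //; exact: cvg_cst.
by apply/funext => n; rewrite /t mulrDl.
Qed.

Lemma cvg_gumbel_level : t n @[n --> \oo] --> +oo.
Proof. exact: cvg_of_ratio. Qed.

Lemma gumbel_level_sqr_le : \forall n \near \oo, t n ^+ 2 <= 8 * ln (p n)%:R.
Proof.
near=> n.
have r1 : 1 < r n by near: n.
have r0 : 0 < r n by exact: lt_trans r1.
have t0 : 0 < t n by near: n; move/cvgryPgt : cvg_gumbel_level; apply.
have : t n / r n < 2 by near: n; apply: (cvgr_lt 1) => //; rewrite ltr1n.
rewrite ltr_pdivrMr// => tr.
have := r_sqr r1; nra.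
Unshelve. all: by end_near. Qed.

(** With r = sqrt (2 ln p) and delta = r - d, the relations p = exp (r^2 / 2) and
    exp (delta r) = sqrt (2 pi) r turn p times density(t) / t into (r / t) times
    exp (- delta^2 / 2 - x - x^2 / (2 d^2)): the correction term in d is there
    to cancel the factor sqrt (2 pi) r. *)
Lemma gumbel_level_tail :
  (p n)%:R * std_normal_tail (t n) @[n --> \oo] --> expR (- x).
Proof.
have i2 : (dn n)^-1 @[n --> \oo] --> (0 : R) by apply: cvg_invy; exact: cvg_dn.
have Mt := cvg_comp _ _ cvg_gumbel_level (@mills_ratio R).
have : t n * std_normal_tail (t n) / normal_density (t n) * (t n / r n)^-1 *
   expR (- delta n ^+ 2 / 2 - x - x ^+ 2 * (dn n)^-1 ^+ 2 / 2) @[n --> \oo] -->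
   1 * 1^-1 * expR (- 0 ^+ 2 / 2 - x - x ^+ 2 * 0 ^+ 2 / 2).
  apply: cvgM.
    by apply: cvgM => //; apply: cvgV => //; exact: oner_neq0.
  apply: cvg_expR; apply: cvgB.
    apply: cvgB; last exact: cvg_cst.
    apply: cvgM; last exact: cvg_cst.
    by apply: cvgN; exact: cvg_sqr.
  apply: cvgM; last exact: cvg_cst.
  by apply: cvgM; [exact: cvg_cst|exact: cvg_sqr].
rewrite !expr0n/= oppr0 mulr0 !mul0r add0r subr0 invr1 !mul1r.
apply: cvg_ext_near; near=> n.
have r1 : 1 < r n by near: n.
have r0 : 0 < r n by exact: lt_trans r1.
have t0 : 0 < t n by near: n; move/cvgryPgt : cvg_gumbel_level; apply.
have d0 : 0 < dn n by near: n; move/cvgryPgt : cvg_dn; apply.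
have p0 : 0 < (p n)%:R :> R by near: n; move/cvgryPgt : pR_oo; apply.
have pE : (p n)%:R = expR (r n ^+ 2 / 2).
  by rewrite r_sqr// mulrAC divff// mul1r lnK.
have s0 : 0 < Num.sqrt (2 * pi) * r n by rewrite mulr_gt0// sqrtr_gt0 mulr_gt0// pi_gt0.
have E : Num.sqrt (2 * pi) * r n = expR (delta n * r n).
  rewrite -[LHS]lnK ?posrE//; congr expR.
  have two : 2 * ln (Num.sqrt (2 * pi) * r n) = ln (2 * pi) + 2 * ln (r n).
    rewrite [LHS]mulr_natl -lnXn// exprMn sqr_sqrtr ?mulr_ge0 ?pi_ge0//.
    by rewrite [LHS]lnM ?posrE ?exprn_gt0 ?mulr_gt0 ?pi_gt0// lnXn// -[ln (r n) *+ 2]mulr_natl.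
  by rewrite /delta -two; field; rewrite gt_eqF.
rewrite /normal_density.
have -> : expR (- delta n ^+ 2 / 2 - x - x ^+ 2 * (dn n)^-1 ^+ 2 / 2) =
    expR (- t n ^+ 2 / 2) * expR (r n ^+ 2 / 2) / expR (delta n * r n).
  rewrite -expRD -expRN -expRD; congr expR.
  have dl : delta n = r n - dn n by rewrite dnE//; ring.
  by rewrite dl /t; field; rewrite gt_eqF.
rewrite -E -pE; set q := Num.sqrt (2 * pi) in s0 *.
have q0 : 0 < q by move: s0; rewrite pmulr_lgt0.
have e0 := expR_gt0 (- t n ^+ 2 / 2).
move: (std_normal_tail (t n)) => Q.
by field; rewrite !gt_eqF.
Unshelve. all: by end_near. Qed.

End gumbel.

(** * Exponential moments *)
Section reduction.
Context {d} {T : measurableType d} {R : realType} (P : probability T R).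
Variables (X : nat -> {RV P >-> R}) (p : nat -> nat) (x : R).
Hypothesis iidX : iid X.
Hypothesis X_mean : ('E_P[X 0%N] = 0)%E.
Hypothesis X_var : ('E_P[(fun w => (X 0%N w) ^+ 2)%R] = 1)%E.
Hypothesis p_gt0 : forall n, (0 < p n)%N.
Hypothesis p_oo : p n @[n --> \oo] --> \oo.
Local Notation mean := (rv_mean P).

Let t n : R := gumbel_d (p n)%:R + x / gumbel_d (p n)%:R.

(** Since p Q(t) has a positive limit, an error is o(Q(t)) when it is o(1 / p). *)
Lemma deviation_reduction (y : nat -> R) :
  (\forall n \near \oo, Num.sqrt n%:R <= y n) ->
  n%:R * (p n)%:R * tail_prob X (y n) @[n --> \oo] --> (0 : R) ->
  t n ^+ 2 * tail_sqr X (y n) +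
    t n ^+ 3 / Num.sqrt n%:R * tilted_cube X (y n) (t n / Num.sqrt n%:R) +
    t n ^+ 4 / n%:R @[n --> \oo] --> (0 : R) ->
  asymp_equiv
      (fun n => (p n)%:R *
        fine (P [set w | partial_sum X n w / Num.sqrt n%:R > t n]))
      (fun n => (p n)%:R * std_normal_tail (t n))
    /\ (p n)%:R * std_normal_tail (t n) @[n --> \oo] --> expR (- x).
Proof.
move=> y_ge tails moments.
have t_oo := cvg_gumbel_level x p_oo; rewrite -/t in t_oo.
have pQ := @gumbel_level_tail R p x p_oo.
split; last exact: pQ.
have tail_small : n%:R * tail_prob X (y n) / std_normal_tail (t n) @[n --> \oo] --> (0 : R).
  rewrite (_ : (fun n => _) = (fun n => n%:R * (p n)%:R * tail_prob X (y n) *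
     ((p n)%:R * std_normal_tail (t n))^-1)).
    rewrite -[X in _ --> X](mul0r (expR (- x))^-1).
    by apply: cvgM => //; apply: cvgV => //; rewrite gt_eqF// expR_gt0.
  apply/funext => n; have pn : (p n)%:R != 0 :> R by rewrite pnatr_eq0 -lt0n.
  rewrite invfM; move: (tail_prob _ _) (std_normal_tail _)^-1 => A B.
  by field.
have H := moderate_deviation_equiv iidX X_mean X_var t_oo y_ge moments tail_small.
rewrite /asymp_equiv (_ : (fun n => _) = (fun n =>
  fine (P [set w | partial_sum X n w / Num.sqrt n%:R > t n]) / std_normal_tail (t n))) //.
apply/funext => n.
have pn : (p n)%:R != 0 :> R by rewrite pnatr_eq0 -lt0n.
by rewrite -mulf_div divff// mul1r.
Qed.

Lemma markov_tail_prob (F : T -> R) (y c : R) : integrable_rv P F ->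
  (forall w, 0 <= F w) -> (forall w, y < `|X 0%N w| -> c <= F w) ->
  tail_prob X y * c <= mean F.
Proof.
move=> iF F0 Fc.
have mV : measurable [set w | y < `|X 0%N w|].
  by apply: measurable_gt; exact: measurableT_comp.
have bI := bounded_indic mV.
rewrite /tail_prob -mean_indic// mulrC -meanZ//.
apply: le_mean_int => //.
  apply: bounded_rv_integrable; apply: bounded_rvM => //; exact: bounded_rv_cst.
move=> w; rewrite indicE; case: (boolP (w \in _)) => [|_]; last by rewrite mulr0.
by rewrite inE/= mulr1; exact: Fc.
Qed.

Lemma four_times_le (a b l : R) : 0 < a -> 0 < b ->
  a ^+ 2 <= 8 * l -> l <= (8^-1 / 16) * b ^+ 2 -> 4 * a <= b.
Proof.
move=> a0 b0 al lb; rewrite leNgt; apply/negP => ba.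
have : b * b < (4 * a) * (4 * a) by apply: ltr_pM => //; exact: ltW.
by move: al lb; rewrite !expr2; lra.
Qed.

Section exponential.
Variables (g : R -> R) (u : nat -> R) (x0 : R).
Hypothesis g_incr : forall a b, 0 < a -> a <= b -> g a <= g b.
Hypothesis g_slope : forall a b, x0 <= a -> a <= b -> g b * a <= g a * b.
Hypothesis g_ln : \forall a \near +oo, 8 * ln a <= g a.
Hypothesis g_int : ('E_P[(fun w => expR (g `|X 0%N w|))%R] < +oo)%E.
Hypothesis u_sol : \forall n \near \oo, 0 < u n /\ u n ^+ 2 = g (u n * Num.sqrt n%:R).
Hypothesis p_u : forall e : R, 0 < e -> \forall n \near \oo, ln (p n)%:R <= e * u n ^+ 2.
Hypothesis p_n : forall e : R, 0 < e -> \forall n \near \oo, ln (p n)%:R <= e * (n%:R `^ 3^-1).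

(** Monotonicity makes g measurable on ]0, +oo[ only, whence the detour through
    z |-> g (expR z), which is monotone on the whole line. *)
Let measurable_gabs : measurable_fun setT (fun z : R => expR (g `|z|)).
Proof.
have mh : measurable_fun setT (fun z : R => g (expR z)).
  apply: nondecreasing_measurable => // a b ab.
  by apply: g_incr; rewrite ?expR_gt0// ler_expR.
have -> : (fun z : R => expR (g `|z|)) =
    (fun z => if z == 0 then expR (g 0) else expR (g (expR (ln `|z|)))).
  apply/funext => z; case: eqVneq => [->|z0]; first by rewrite normr0.
  by rewrite lnK// posrE normr_gt0.
apply: measurable_fun_ifT => //.
  by apply: measurable_fun_eqr.
apply: measurableT_comp => //.
apply: (measurableT_comp mh); apply: measurableT_comp; first exact: measurable_ln.
exact: normr_measurable.
Qed.

Let G w := expR (g `|X 0%N w|).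

Let G_int : integrable_rv P G.
Proof.
apply: ge0_integrable => //; last by move=> w; exact: expR_ge0.
exact: (measurableT_comp measurable_gabs).
Qed.

Let M := mean G.

Let M0 : 0 <= M.
Proof. by apply: mean_ge0 => w; exact: expR_ge0. Qed.

Let L n : R := ln (p n)%:R.

Let pR_oo : (p n)%:R @[n --> \oo] --> (+oo : set_system R).
Proof. exact/cvgrnyP. Qed.

Let L_oo : L n @[n --> \oo] --> +oo.
Proof. exact: (cvg_comp _ _ pR_oo (@cvg_ln_y R)). Qed.

Let u2_oo : u n ^+ 2 @[n --> \oo] --> +oo.
Proof.
apply/cvgryPge => A; near=> n.
have h1 : A <= L n by near: n; move/cvgryPge : L_oo; apply.
apply: le_trans h1 _; rewrite -[leRHS]mul1r.
by near: n; apply: p_u.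
Unshelve. all: by end_near. Qed.

Let u_ge1 : \forall n \near \oo, 1 <= u n.
Proof.
near=> n.
have u0 : 0 < u n by near: n; apply: filterS u_sol => n [].
have : 1 <= u n ^+ 2 by near: n; move/cvgryPge : u2_oo; apply.
by rewrite -[X in X <= _](expr1n _ 2) ler_sqr ?nnegrE// ltW.
Unshelve. all: by end_near. Qed.

Let y n := u n * Num.sqrt n%:R.

Let y_ge : \forall n \near \oo, Num.sqrt n%:R <= y n.
Proof.
near=> n; rewrite /y ler_peMl ?sqrtr_ge0//.
by near: n.
Unshelve. all: by end_near. Qed.

Let sqrtn_oo : Num.sqrt n%:R @[n --> \oo] --> (+oo : set_system R).
Proof. by apply: (cvg_comp _ _ _ (@cvg_sqrt_y R)); exact: cvgr_idn. Qed.

Let y_oo : y n @[n --> \oo] --> +oo.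
Proof.
apply/cvgryPge => A; near=> n.
have h : A <= Num.sqrt n%:R by near: n; move/cvgryPge : sqrtn_oo; apply.
by apply: le_trans h _; near: n.
Unshelve. all: by end_near. Qed.

Let x1 : {x1 : R | 1 <= x1 /\ x0 <= x1 /\ forall a, x1 <= a -> 8 * ln a <= g a}.
Proof.
apply: cid; move: g_ln => [m [_ Hm]].
exists (Num.max 1 (Num.max x0 (m + 1))).
rewrite !le_max !lexx /=; split => //; split; first by rewrite orbT.
by move=> a; rewrite !ge_max => /and3P[_ _ ma]; apply: Hm; lra.
Qed.

Let lnn_le : \forall n \near \oo, 4 * ln n%:R <= u n ^+ 2.
Proof.
have [z [z1 [_ zg]]] := x1.
near=> n.
have n0 : (0 < n)%N by near: n; exists 1%N.
have [u0 uE] : 0 < u n /\ u n ^+ 2 = g (y n) by near: n.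
have yz : z <= y n by near: n; move/cvgryPge : y_oo; apply.
have sy : Num.sqrt n%:R <= y n by near: n.
have s0 : 0 < Num.sqrt n%:R :> R by rewrite sqrtr_gt0 ltr0n.
rewrite uE; apply: le_trans (zg _ yz).
have : ln (Num.sqrt n%:R) <= ln (y n) by rewrite ler_ln ?posrE// (lt_le_trans s0).
have : ln (n%:R : R) = 2 * ln (Num.sqrt n%:R).
  by rewrite mulr_natl -lnXn// sqr_sqrtr.
by lra.
Unshelve. all: by end_near. Qed.

Let exp_u_0 : expR (- (u n ^+ 2 / 4)) @[n --> \oo] --> (0 : R).
Proof.
apply: (cvg_comp (fun n => u n ^+ 2 / 4) (fun v => expR (- v))); last exact: cvgr_expR.
apply/cvgryPge => A; near=> n.
by rewrite ler_pdivlMr//; near: n; move/cvgryPge : u2_oo; apply.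
Unshelve. all: by end_near. Qed.

Let tails : n%:R * (p n)%:R * tail_prob X (y n) @[n --> \oo] --> (0 : R).
Proof.
have U : M * expR (- (u n ^+ 2 / 4)) @[n --> \oo] --> (0 : R).
  by rewrite -[X in _ --> X](mulr0 M); apply: cvgM => //; exact: cvg_cst.
apply: cvg_le0 U; near=> n.
have n0 : (0 < n)%N by near: n; exists 1%N.
have nR0 : 0 < n%:R :> R by rewrite ltr0n.
have pR0 : 0 < (p n)%:R :> R by rewrite ltr0n.
have T0 : 0 <= tail_prob X (y n) by rewrite fine_ge0.
rewrite mulr_ge0 ?mulr_ge0 ?(ltW nR0) ?(ltW pR0)//=.
have [u0 uE] : 0 < u n /\ u n ^+ 2 = g (y n) by near: n.
have y0 : 0 < y n by rewrite mulr_gt0// sqrtr_gt0.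
have H := @markov_tail_prob G (y n) (expR (u n ^+ 2)) G_int (fun w => expR_ge0 _).
have {}H : tail_prob X (y n) * expR (u n ^+ 2) <= M.
  by apply: H => w yX; rewrite ler_expR uE; apply: g_incr => //; exact: ltW.
have E : n%:R * (p n)%:R <= expR (u n ^+ 2) * expR (- (u n ^+ 2 / 4)).
  have -> : n%:R * (p n)%:R = expR (ln n%:R + L n).
    by rewrite expRD !lnK.
  rewrite -expRD ler_expR.
  have : 4 * ln n%:R <= u n ^+ 2 by near: n.
  have : L n <= 2^-1 * u n ^+ 2 by near: n; apply: p_u.
  by lra.
apply: (@le_trans _ _ (expR (u n ^+ 2) * expR (- (u n ^+ 2 / 4)) * tail_prob X (y n))).
  by rewrite ler_wpM2r.
rewrite mulrC mulrA ler_wpM2r ?expR_ge0//.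
Unshelve. all: by end_near. Qed.

Let t2L : \forall n \near \oo, t n ^+ 2 <= 8 * L n.
Proof. exact: gumbel_level_sqr_le. Qed.

Let t_oo : t n @[n --> \oo] --> +oo.
Proof. exact: cvg_gumbel_level. Qed.

Let part_sqr : t n ^+ 2 * tail_sqr X (y n) @[n --> \oo] --> (0 : R).
Proof.
have [z [z1 [_ zg]]] := x1.
have U : M * expR (- (u n ^+ 2 / 4)) @[n --> \oo] --> (0 : R).
  by rewrite -[X in _ --> X](mulr0 M); apply: cvgM => //; exact: cvg_cst.
apply: cvg_le0 U; near=> n.
rewrite mulr_ge0 ?sqr_ge0 ?tail_sqr_ge0//=.
have [u0 uE] : 0 < u n /\ u n ^+ 2 = g (y n) by near: n.
have yz : z <= y n by near: n; move/cvgryPge : y_oo; apply.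
have y0 : 0 < y n by lra.
have H : tail_sqr X (y n) <= M * expR (- (u n ^+ 2 / 2)).
  rewrite mulrC -RintegralZl//; apply: le_mean_int.
  - exact: integrable_above.
  - have := integrableZl measurableT (expR (- (u n ^+ 2 / 2))) G_int.
    by apply: eq_integrable.
  move=> w; rewrite /above; case: ifPn => [_|]; first by rewrite mulr_ge0 ?expR_ge0.
  rewrite -ltNge -(real_normK (num_real (X 0%N w))) /G.
  move: `|X 0%N w| => v yv; have v0 : 0 < v by exact: lt_trans yv.
  rewrite -[v]lnK// -expRM_natl -expRD ler_expR lnK//.
  have := zg v (le_trans yz (ltW yv)).
  have := g_incr y0 (ltW yv); rewrite -uE; have := sqr_ge0 (u n); lra.
have L4 : t n ^+ 2 <= u n ^+ 2 / 4.
  have := (_ : t n ^+ 2 <= 8 * L n); have : L n <= 32^-1 * u n ^+ 2 by near: n; apply: p_u.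
  move=> h1 /(_ _) h2; have {}h2 : t n ^+ 2 <= 8 * L n by near: n.
  by lra.
apply: (@le_trans _ _ (expR (u n ^+ 2 / 4) * (M * expR (- (u n ^+ 2 / 2))))).
  apply: ler_pM; rewrite ?sqr_ge0 ?tail_sqr_ge0//.
  by have := expR_ge1Dx (u n ^+ 2 / 4); lra.
rewrite mulrCA -expRD ler_wpM2l// ler_expR; lra.
Unshelve. all: by end_near. Qed.

Let t3n : t n ^+ 3 / Num.sqrt n%:R @[n --> \oo] --> (0 : R).
Proof.
have H (e : R) : 0 < e -> \forall n \near \oo, t n ^+ 3 / Num.sqrt n%:R <= e.
  move=> e0; pose e' := Num.min 1 (e ^+ 2) / 8.
  have e'0 : 0 < e' by rewrite divr_gt0// lt_min ltr01 exprn_gt0.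
  near=> n.
  have n0 : (0 < n)%N by near: n; exists 1%N.
  have nR0 : 0 < n%:R :> R by rewrite ltr0n.
  have s0 : 0 < Num.sqrt n%:R :> R by rewrite sqrtr_gt0.
  have t1 : 1 <= t n by near: n; move/cvgryPge : t_oo; apply.
  have t0 : 0 <= t n by lra.
  pose q : R := n%:R `^ 3^-1.
  have q0 : 0 <= q by exact: powR_ge0.
  have q3 : q ^+ 3 = n%:R.
    by rewrite -powR_mulrn// -powRrM mulVf// powRr1// ltW.
  have Lq : L n <= e' * q by rewrite /q; near: n; exact: p_n.
  have tL : t n ^+ 2 <= 8 * L n by near: n.
  rewrite ler_pdivrMr// -ler_sqr ?nnegrE ?mulr_ge0 ?exprn_ge0 ?(ltW e0) ?(ltW s0)//.
  rewrite [leRHS]exprMn sqr_sqrtr ?(ltW nR0)// -exprM mulnC exprM -q3.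
  pose m := Num.min 1 (e ^+ 2).
  have m1 : m <= 1 by rewrite /m ge_min lexx.
  have me : m <= e ^+ 2 by rewrite /m ge_min lexx orbT.
  have m0 : 0 < m by rewrite lt_min ltr01 exprn_gt0.
  have tm : t n ^+ 2 <= m * q.
    by apply: le_trans tL _; move: Lq; rewrite /e' -/m; lra.
  apply: (@le_trans _ _ ((m * q) ^+ 3)).
    by apply: lerXn2r; rewrite ?nnegrE ?sqr_ge0 ?mulr_ge0 ?(ltW m0).
  rewrite exprMn ler_wpM2r ?exprn_ge0// (le_trans _ me)//.
  by rewrite ler_iXnr// ltW.
apply/cvgrPdist_le => e e0; near=> n.
have t1 : 1 <= t n by near: n; move/cvgryPge : t_oo; apply.
rewrite sub0r normrN ger0_norm; last first.
  by rewrite divr_ge0 ?sqrtr_ge0// exprn_ge0//; lra.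
by near: n; exact: H.
Unshelve. all: by end_near. Qed.

(** For v >= z, the slope condition between v and a * s gives
    g v / v >= a / s >= 4 l, so the exponential takes up at most a quarter of
    g v, while the cube takes up at most three eighths of it. *)
Lemma cube_exp_bound (z a s l v : R) : 1 <= z -> x0 <= z ->
  (forall b, z <= b -> 8 * ln b <= g b) -> 0 < a -> 0 < s -> a ^+ 2 = g (a * s) ->
  0 <= l -> l <= 1 -> 4 * (l * s) <= a -> 0 <= v -> v <= a * s ->
  v ^+ 3 * expR (l * v) <= z ^+ 3 * expR z + expR (g v).
Proof.
move=> z1 z0 zg a0 s0 aE l0 l1 las v0 vy.
have [vz|zv] := leP v z.
  apply: (@le_trans _ _ (z ^+ 3 * expR z)); last by rewrite lerDl expR_ge0.
  apply: ler_pM; rewrite ?exprn_ge0 ?expR_ge0//.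
    by apply: lerXn2r; rewrite ?nnegrE// (le_trans v0).
  by rewrite ler_expR; nra.
apply: (@le_trans _ _ (expR (g v))); last first.
  rewrite lerDr; apply: mulr_ge0; last exact: expR_ge0.
  by apply: exprn_ge0; lra.
have vp : 0 < v by lra.
have -> : v ^+ 3 = expR (3%:R * ln v) by rewrite expRM_natl lnK.
rewrite -expRD ler_expR.
have h1 := zg v (ltW zv).
have h2 : 4 * (l * v) <= g v.
  have h3 := g_slope (le_trans z0 (ltW zv)) vy; rewrite -aE in h3.
  have h4 : a * v <= g v * s.
    rewrite -(ler_pM2l a0); apply: le_trans (_ : _ <= a ^+ 2 * v) _; first by rewrite expr2 mulrA.
    by apply: le_trans h3 _; rewrite mulrCA.
  rewrite -(ler_pM2r s0); apply: le_trans h4.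
  rewrite (_ : 4 * (l * v) * s = 4 * (l * s) * v); last by ring.
  by rewrite ler_pM2r.
have h5 : 0 <= ln v by apply: ln_ge0; lra.
lra.
Qed.

Let part_cube : t n ^+ 3 / Num.sqrt n%:R * tilted_cube X (y n) (t n / Num.sqrt n%:R)
  @[n --> \oo] --> (0 : R).
Proof.
have [z [z1 [z0 zg]]] := x1.
pose C := z ^+ 3 * expR z + M.
have U : t n ^+ 3 / Num.sqrt n%:R * C @[n --> \oo] --> (0 : R).
  by rewrite -[X in _ --> X](mul0r C); apply: cvgM => //; exact: cvg_cst.
apply: cvg_le0 U; near=> n.
have n0 : (0 < n)%N by near: n; exists 1%N.
have s0 : 0 < Num.sqrt n%:R :> R by rewrite sqrtr_gt0 ltr0n.
have t1 : 1 <= t n by near: n; move/cvgryPge : t_oo; apply.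
have ts0 : 0 <= t n ^+ 3 / Num.sqrt n%:R.
  by rewrite divr_ge0 ?sqrtr_ge0// exprn_ge0//; lra.
rewrite mulr_ge0 ?tilted_cube_ge0//= ler_wpM2l//.
have [u0 uE] : 0 < u n /\ u n ^+ 2 = g (y n) by near: n.
have yz : z <= y n by near: n; move/cvgryPge : y_oo; apply.
have y0 : 0 < y n by lra.
pose l := t n / Num.sqrt n%:R; rewrite -/l.
have l0 : 0 <= l by rewrite /l divr_ge0 ?sqrtr_ge0//; lra.
have l1 : l <= 1.
  have : t n ^+ 3 / Num.sqrt n%:R <= 1 by near: n; apply: (cvgr_le 0).
  by apply: le_trans; rewrite ler_pM2r ?invr_gt0// ler_eXnr.
have tu : 4 * t n <= u n.
  have h1 : L n <= (8^-1 / 16) * u n ^+ 2 by near: n; apply: p_u.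
  have h2 : t n ^+ 2 <= 8 * L n by near: n.
  exact: four_times_le (lt_le_trans ltr01 t1) u0 h2 h1.
have iG : integrable_rv P (fun w => z ^+ 3 * expR z + G w).
  have := integrableD measurableT
    (bounded_rv_integrable P (bounded_rv_cst (z ^+ 3 * expR z))) G_int.
  by apply: eq_integrable.
have CE : C = mean (fun w => z ^+ 3 * expR z + G w).
  rewrite /C -[X in X + _](mean_cst P) -RintegralD//.
  by apply: bounded_rv_integrable; exact: bounded_rv_cst.
have z3 : 0 <= z ^+ 3 * expR z by rewrite mulr_ge0 ?expR_ge0// exprn_ge0//; lra.
have B w : 0 <= below (y n) (fun x => `|x| ^+ 3 * expR (l * `|x|)) (X 0%N w) <=
    z ^+ 3 * expR z + G w.
  rewrite /below /G; case: ifPn => [Xy|_]; last first.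
    by rewrite lexx/= addr_ge0// expR_ge0.
  apply/andP; split.
    by apply: mulr_ge0; [apply: exprn_ge0|exact: expR_ge0].
  apply: (cube_exp_bound z1 z0 zg u0 s0 uE l0 l1 _ (normr_ge0 _) Xy).
  by rewrite /l divfK// gt_eqF.
rewrite CE; apply: le_mean_int => //; last by move=> w; case/andP: (B w).
apply: dominated_integrable iG.
  apply: measurableT_comp => //; apply: measurable_below.
  apply: measurable_funM; first by apply: measurable_funX; exact: normr_measurable.
  apply: measurableT_comp => //; apply: measurable_funM; first exact: measurable_cst.
  exact: normr_measurable.
move=> w; have /andP[b1 b2] := B w.
by rewrite ger0_norm// ger0_norm// (le_trans b1).
Unshelve. all: by end_near. Qed.

Let part_four : t n ^+ 4 / n%:R @[n --> \oo] --> (0 : R).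
Proof.
have U : (t n ^+ 3 / Num.sqrt n%:R) ^+ 2 @[n --> \oo] --> (0 : R).
  by rewrite -[X in _ --> X](expr0n R 2); exact: cvg_sqr.
apply: cvg_le0 U; near=> n.
have n0 : (0 < n)%N by near: n; exists 1%N.
have nR0 : 0 < n%:R :> R by rewrite ltr0n.
have t1 : 1 <= t n by near: n; move/cvgryPge : t_oo; apply.
rewrite divr_ge0 ?exprn_ge0 ?(ltW nR0)//=; last by lra.
rewrite expr_div_n sqr_sqrtr ?(ltW nR0)// ler_pM2r ?invr_gt0// -exprM.
by rewrite ler_weXn2l.
Unshelve. all: by end_near. Qed.

Theorem exponential_moment_deviation :
  asymp_equiv
      (fun n => (p n)%:R *
        fine (P [set w | partial_sum X n w / Num.sqrt n%:R > t n]))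
      (fun n => (p n)%:R * std_normal_tail (t n))
    /\ (p n)%:R * std_normal_tail (t n) @[n --> \oo] --> expR (- x).
Proof.
apply: (deviation_reduction y_ge tails).
rewrite [X in _ --> X](_ : 0 = 0 + 0 + 0 :> R); last by rewrite !addr0.
by apply: cvgD => //; exact: cvgD.
Qed.

End exponential.
End reduction.

(** * Power moments *)
Lemma cvg_mean_above {d} {T : measurableType d} {R : realType} (P : probability T R)
    (X : {RV P >-> R}) (F : R -> R) (y : nat -> R) :
  measurable_fun setT F -> integrable_rv P (fun w => F (X w)) ->
  y n @[n --> \oo] --> +oo ->
  rv_mean P (fun w => above (y n) F (X w)) @[n --> \oo] --> (0 : R).
Proof.
move=> mF iF yoo.
have [] := @dominated_convergence _ T R P setT measurableT
  (fun n w => (above (y n) F (X w))%:E) (cst 0%E) (fun w => `|F (X w)|%:E).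
- by move=> n; apply/measurable_EFinP; apply: measurableT_comp => //; exact: measurable_above.
- exact: measurable_cst.
- apply: aeW => w _; apply: cvg_near_cst; near=> n.
  rewrite /above ifT//; near: n; move/cvgryPge : yoo; apply.
- exact: integrable_norm.
- by apply: aeW => w n _; rewrite /= lee_fin above_le.
move=> _ _; rewrite integral_cst// mul0e => H.
by have /fine_cvgP[_ h] := H; exact: h.
Unshelve. all: by end_near. Qed.

Section power.
Context {d} {T : measurableType d} {R : realType} (P : probability T R).
Variables (X : nat -> {RV P >-> R}) (p : nat -> nat) (x : R).
Hypothesis iidX : iid X.
Hypothesis X_mean : ('E_P[X 0%N] = 0)%E.
Hypothesis X_var : ('E_P[(fun w => (X 0%N w) ^+ 2)%R] = 1)%E.
Hypothesis p_gt0 : forall n, (0 < p n)%N.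
Hypothesis p_oo : p n @[n --> \oo] --> \oo.
Local Notation mean := (rv_mean P).
Let t n : R := gumbel_d (p n)%:R + x / gumbel_d (p n)%:R.

Variables (s k : R).
Hypothesis s2 : 2 < s.
Hypothesis s_int : ('E_P[(fun w => `|X 0%N w| `^ s)%R] < +oo)%E.
Hypothesis k0 : 0 < k.
Hypothesis p_le : \forall n \near \oo, (p n)%:R <= k * n%:R `^ ((s - 2) / 2).

Let measurable_powabs (a : R) : measurable_fun setT (fun z : R => `|z| `^ a).
Proof.
apply: (measurableT_comp (f := fun z : R => z `^ a)); first exact: measurable_powR.
exact: normr_measurable.
Qed.

Let pow_int : integrable_rv P (fun w => `|X 0%N w| `^ s).
Proof.
apply: ge0_integrable s_int; last by move=> w; exact: powR_ge0.
exact: (measurableT_comp (measurable_powabs s)).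
Qed.

(** The exponent is capped at 3: for |X| <= sqrt n, the cube of |X| is compared
    with its power [sg] by paying a power of sqrt n. *)
Let sg : R := Num.min s 3.
Let kp : R := (sg - 2) / 2.

Let sg_bounds : [/\ 2 < sg, sg <= s & sg <= 3].
Proof. by rewrite /sg lt_min s2 !ge_min !lexx orbT /= ltr_nat. Qed.

Let F w := `|X 0%N w| `^ sg.
Let D := mean F.

Let F_int : integrable_rv P F.
Proof.
have [_ sgs _] := sg_bounds.
apply: (@dominated_integrable _ _ _ _ _ (fun w => 1 + `|X 0%N w| `^ s)).
- exact: (measurableT_comp (measurable_powabs sg)).
- move=> w; rewrite [leLHS]ger0_norm ?powR_ge0// [leRHS]ger0_norm ?addr_ge0 ?powR_ge0// /F.
  move: `|X 0%N w| (normr_ge0 (X 0%N w)) => v v0.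
  have [v1|v1] := leP v 1.
    rewrite (@le_trans _ _ 1)// ?lerDl ?powR_ge0//.
    have -> : 1 = 1 `^ sg :> R by rewrite powR1.
    apply: ge0_ler_powR; rewrite ?nnegrE//.
    by have [] := sg_bounds; lra.
  rewrite -[leLHS]add0r; apply: lerD => //; apply: ler_powR => //; exact: ltW.
- have := integrableD measurableT (bounded_rv_integrable P (bounded_rv_cst (1 : R))) pow_int.
  by apply: eq_integrable.
Qed.

Let D0 : 0 <= D.
Proof. by apply: mean_ge0 => w; exact: powR_ge0. Qed.

Let lnn_oo : ln (n%:R : R) @[n --> \oo] --> +oo.
Proof. by apply: (cvg_comp _ _ _ (@cvg_ln_y R)); exact: cvgr_idn. Qed.

Let sqrtn_oo : Num.sqrt n%:R @[n --> \oo] --> (+oo : set_system R).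
Proof. by apply: (cvg_comp _ _ _ (@cvg_sqrt_y R)); exact: cvgr_idn. Qed.

Let t_oo : t n @[n --> \oo] --> +oo.
Proof. exact: cvg_gumbel_level. Qed.

Lemma powR_sqrt_nat (n : nat) (a : R) : (0 < n)%N ->
  Num.sqrt (n%:R : R) `^ a = expR (a / 2 * ln n%:R).
Proof.
move=> n0; have nR : 0 < n%:R :> R by rewrite ltr0n.
have sR : 0 < Num.sqrt (n%:R : R) by rewrite sqrtr_gt0.
have -> : ln (n%:R : R) = 2 * ln (Num.sqrt n%:R).
  by rewrite mulr_natl -lnXn// sqr_sqrtr// ltW.
rewrite -[LHS]lnK ?posrE ?powR_gt0// ln_powR; congr expR.
by field.
Qed.

Lemma above_sqr_le (n : nat) (v : R) : (0 < n)%N -> Num.sqrt n%:R < v ->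
  v ^+ 2 <= v `^ sg * expR (- (kp * ln n%:R)).
Proof.
move=> n0 sv; have [sg2 _ _] := sg_bounds.
have sR : 0 < Num.sqrt (n%:R : R) by rewrite sqrtr_gt0 ltr0n.
have v0 : 0 < v by exact: lt_trans sv.
have -> : v `^ sg = v ^+ 2 * v `^ (sg - 2).
  by rewrite -powR_mulrn ?ltW// -powRD; [congr (_ `^ _); ring|apply/implyP => _; rewrite gt_eqF].
rewrite -mulrA; apply: ler_peMr; first exact: sqr_ge0.
rewrite expRN ler_pdivlMr ?expR_gt0// mul1r.
have := powR_sqrt_nat (sg - 2) n0; rewrite -/kp => <-.
by apply: ge0_ler_powR; rewrite ?nnegrE ?sqrtr_ge0 ?(ltW v0) ?(ltW sv)// subr_ge0 ltW.
Qed.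

Lemma below_cube_le (n : nat) (v : R) : (0 < n)%N -> 0 <= v -> v <= Num.sqrt n%:R ->
  v ^+ 3 <= v `^ sg * expR ((2^-1 - kp) * ln n%:R).
Proof.
move=> n0; rewrite le_eqVlt => /predU1P[<- _|v0 vs].
  by rewrite expr0n/= mulr_ge0 ?expR_ge0// powR_ge0.
have [sg2 _ sg3] := sg_bounds.
have -> : v ^+ 3 = v `^ sg * v `^ (3 - sg).
  rewrite -powRD; last by apply/implyP => _; rewrite gt_eqF.
  by rewrite addrC subrK powR_mulrn// ltW.
rewrite ler_wpM2l ?powR_ge0//.
have -> : 2^-1 - kp = (3 - sg) / 2 by rewrite /kp; field.
rewrite -powR_sqrt_nat//.
by apply: ge0_ler_powR; rewrite ?nnegrE ?sqrtr_ge0 ?(ltW v0)// subr_ge0.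
Qed.

Let tail_sqr_le (n : nat) : (0 < n)%N ->
  tail_sqr X (Num.sqrt n%:R) <= D * expR (- (kp * ln n%:R)).
Proof.
move=> n0; rewrite /D -RintegralZr//; apply: le_mean_int.
- exact: integrable_above.
- have := integrableZr measurableT (expR (- (kp * ln n%:R))) F_int.
  by apply: eq_integrable.
move=> w; rewrite /above; case: ifPn => [_|].
  by rewrite mulr_ge0 ?expR_ge0// powR_ge0.
rewrite -ltNge => sX; rewrite -(real_normK (num_real (X 0%N w))).
exact: above_sqr_le.
Qed.

Let tilted_cube_le (n : nat) (l : R) : (0 < n)%N -> 0 <= l ->
  tilted_cube X (Num.sqrt n%:R) (l / Num.sqrt n%:R) <=
  D * expR (l + (2^-1 - kp) * ln n%:R).
Proof.
move=> n0 l0.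
have sR : 0 < Num.sqrt (n%:R : R) by rewrite sqrtr_gt0 ltr0n.
rewrite /D -RintegralZr//.
have iG : integrable_rv P (fun w => F w * expR (l + (2^-1 - kp) * ln n%:R)).
  have := integrableZr measurableT (expR (l + (2^-1 - kp) * ln n%:R)) F_int.
  by apply: eq_integrable.
have B w : 0 <= below (Num.sqrt n%:R) (fun x => `|x| ^+ 3 * expR (l / Num.sqrt n%:R * `|x|)) (X 0%N w)
    <= F w * expR (l + (2^-1 - kp) * ln n%:R).
  rewrite /below /F; case: ifPn => [Xy|_]; last first.
    by rewrite lexx/= mulr_ge0 ?expR_ge0// powR_ge0.
  apply/andP; split; first by apply: mulr_ge0; [exact: exprn_ge0|exact: expR_ge0].
  rewrite expRD [expR l * _]mulrC mulrA; apply: ler_pM.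
  - exact: exprn_ge0.
  - exact: expR_ge0.
  - exact: below_cube_le.
  rewrite ler_expR -mulrA -[leRHS]mulr1 ler_wpM2l//.
  by rewrite mulrC ler_pdivrMr// mul1r.
apply: le_mean_int => //; last by move=> w; case/andP: (B w).
apply: dominated_integrable iG.
  apply: measurableT_comp => //; apply: measurable_below.
  apply: measurable_funM; first by apply: measurable_funX; exact: normr_measurable.
  apply: measurableT_comp => //; apply: measurable_funM; first exact: measurable_cst.
  exact: normr_measurable.
move=> w; have /andP[b1 b2] := B w.
by rewrite ger0_norm// ger0_norm// (le_trans b1).
Qed.

(** Here p is only O(n^((s - 2) / 2)), so Markov's inequality has to be used with
    the tail of the moment of order s, which tends to 0. *)
Let tails : n%:R * (p n)%:R * tail_prob X (Num.sqrt n%:R) @[n --> \oo] --> (0 : R).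
Proof.
pose Ts n := mean (fun w => above (Num.sqrt n%:R) (fun z => `|z| `^ s) (X 0%N w)).
have Ts0 : Ts n @[n --> \oo] --> (0 : R).
  by apply: cvg_mean_above => //; exact: measurable_powabs.
have U : k * Ts n @[n --> \oo] --> (0 : R).
  by rewrite -[X in _ --> X](mulr0 k); apply: cvgM => //; exact: cvg_cst.
apply: cvg_le0 U; near=> n.
have n0 : (0 < n)%N by near: n; exists 1%N.
have nR0 : 0 < n%:R :> R by rewrite ltr0n.
have sR : 0 < Num.sqrt (n%:R : R) by rewrite sqrtr_gt0.
have tp0 : 0 <= tail_prob X (Num.sqrt n%:R) by rewrite fine_ge0.
rewrite mulr_ge0 ?mulr_ge0 ?ler0n//=.
have H : tail_prob X (Num.sqrt n%:R) * (Num.sqrt n%:R `^ s) <= Ts n.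
  apply: markov_tail_prob.
  - apply: dominated_integrable pow_int.
      by apply: measurableT_comp => //; apply: measurable_above; exact: measurable_powabs.
    by move=> w; exact: above_le.
  - by move=> w; rewrite /above; case: ifP => // _; exact: powR_ge0.
  - move=> w sX; rewrite /above ifF; last by apply/negbTE; rewrite -ltNge.
    have sge0 : 0 <= s by apply/ltW/(lt_trans _ s2); rewrite ltr0n.
    by apply: (ge0_ler_powR sge0); rewrite ?nnegrE ?sqrtr_ge0//; exact: ltW.
have pn : n%:R * (p n)%:R <= k * Num.sqrt n%:R `^ s.
  have pk : (p n)%:R <= k * n%:R `^ ((s - 2) / 2) by near: n.
  apply: (@le_trans _ _ (n%:R * (k * n%:R `^ ((s - 2) / 2)))); first by rewrite ler_pM2l.
  rewrite mulrCA ler_pM2l// powR_sqrt_nat// -{1}[n%:R]powRr1 ?ler0n// -powRD; last first.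
    by apply/implyP => _; rewrite gt_eqF.
  rewrite -[X in X <= _]lnK ?posrE ?powR_gt0// ln_powR ler_expR.
  by rewrite le_eqVlt; apply/orP; left; apply/eqP; field.
apply: (@le_trans _ _ (k * Num.sqrt n%:R `^ s * tail_prob X (Num.sqrt n%:R))).
  by rewrite ler_wpM2r.
by rewrite -mulrA ler_pM2l// mulrC.
Unshelve. all: by end_near. Qed.

(** As t^2 = O(ln n), t is o(ln n): the factors exp (4 t) are beaten by any power
    of n. *)
Let t_small : \forall n \near \oo, 4 * t n <= kp / 2 * ln n%:R.
Proof.
have kp0 : 0 < kp by have [] := sg_bounds; rewrite /kp; lra.
have s0 : 0 < s by rewrite (lt_trans _ s2)// ltr0n.
near=> n.
have n0 : (0 < n)%N by near: n; exists 1%N.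
have nR0 : 0 < n%:R :> R by rewrite ltr0n.
have pR0 : 0 < (p n)%:R :> R by rewrite ltr0n.
have t1 : 1 <= t n by near: n; move/cvgryPge : t_oo; apply.
have tL : t n ^+ 2 <= 8 * ln (p n)%:R by near: n; exact: gumbel_level_sqr_le.
have pk : (p n)%:R <= k * n%:R `^ ((s - 2) / 2) by near: n.
have Nk : ln k <= ln n%:R by near: n; move/cvgryPge : lnn_oo; apply.
have NK : 4 * s * (8 / kp) ^+ 2 <= ln n%:R by near: n; move/cvgryPge : lnn_oo; apply.
have L : ln (p n)%:R <= s / 2 * ln n%:R.
  have : ln (p n)%:R <= ln (k * n%:R `^ ((s - 2) / 2)).
    by rewrite ler_ln ?posrE ?mulr_gt0 ?powR_gt0.
  rewrite lnM ?posrE ?powR_gt0// ln_powR; lra.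
move: NK Nk L tL; move: (ln n%:R) (ln (p n)%:R) => N L NK Nk LN tL.
have N0 : 0 <= N by apply: le_trans NK; rewrite mulr_ge0 ?sqr_ge0//; lra.
have k8 : 0 < (kp / 8) ^+ 2 by apply: exprn_gt0; apply: divr_gt0.
have sN : 4 * s <= (kp / 8) ^+ 2 * N.
  move: NK; rewrite -(ler_pM2l k8); apply: le_trans.
  by rewrite le_eqVlt; apply/orP; left; apply/eqP; field; rewrite gt_eqF.
have tN : t n ^+ 2 <= (kp / 8 * N) ^+ 2.
  apply: (@le_trans _ _ (4 * s * N)); first by lra.
  rewrite (_ : (kp / 8 * N) ^+ 2 = (kp / 8) ^+ 2 * N * N); last by ring.
  exact: ler_wpM2r.
have kN : 0 <= kp / 8 * N.
  by apply: mulr_ge0 => //; apply: divr_ge0 => //; exact: ltW.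
have tn0 : 0 <= t n by exact: le_trans t1.
have tkN : t n <= kp / 8 * N.
  by rewrite -ler_sqr ?nnegrE.
lra.
Unshelve. all: by end_near. Qed.

Let moments : t n ^+ 2 * tail_sqr X (Num.sqrt n%:R) +
    t n ^+ 3 / Num.sqrt n%:R * tilted_cube X (Num.sqrt n%:R) (t n / Num.sqrt n%:R) +
    t n ^+ 4 / n%:R @[n --> \oo] --> (0 : R).
Proof.
have [sg2 _ sg3] := sg_bounds.
have kp0 : 0 < kp by rewrite /kp; lra.
have kp1 : kp <= 1 by rewrite /kp; lra.
pose C := 2 * D + 1.
have U : C * expR (- (kp / 2 * ln n%:R)) @[n --> \oo] --> (0 : R).
  rewrite -[X in _ --> X](mulr0 C); apply: cvgM; first exact: cvg_cst.
  apply: (cvg_comp (fun n => kp / 2 * ln n%:R) (fun v => expR (- v))); last exact: cvgr_expR.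
  apply/cvgryPge => A; near=> n.
  have kp2 : 0 < kp / 2 by lra.
  rewrite -ler_pdivrMl//; near: n.
  by move/cvgryPge : lnn_oo; apply.
apply: cvg_le0 U; near=> n.
have n0 : (0 < n)%N by near: n; exists 1%N.
have nR0 : 0 < n%:R :> R by rewrite ltr0n.
have sR : 0 < Num.sqrt (n%:R : R) by rewrite sqrtr_gt0.
have t1 : 1 <= t n by near: n; move/cvgryPge : t_oo; apply.
have tN : 4 * t n <= kp / 2 * ln n%:R by near: n.
have t0 : 0 <= t n by lra.
have N0 : 0 <= ln (n%:R : R) by rewrite ln_ge0// ler1n.
have a1 := tail_sqr_le n0; have a2 := tilted_cube_le n0 t0.
have b1 : 0 <= t n ^+ 2 by exact: sqr_ge0.
have b2 : 0 <= t n ^+ 3 / Num.sqrt n%:R by rewrite divr_ge0 ?sqrtr_ge0 ?exprn_ge0.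
have b3 : 0 <= t n ^+ 4 / n%:R by rewrite divr_ge0 ?exprn_ge0// ltW.
have tE : t n <= expR (t n) by have := expR_ge1Dx (t n); lra.
have tEk j : t n ^+ j <= expR (j%:R * t n).
  by rewrite expRM_natl; apply: lerXn2r; rewrite ?nnegrE ?expR_ge0.
set E := expR (- (kp / 2 * ln n%:R)).
have c1 : t n ^+ 2 * tail_sqr X (Num.sqrt n%:R) <= D * E.
  apply: (@le_trans _ _ (expR (2%:R * t n) * (D * expR (- (kp * ln n%:R))))).
    by apply: ler_pM => //; exact: tail_sqr_ge0.
  rewrite mulrCA -expRD; apply: (ler_wpM2l D0); rewrite ler_expR; lra.
have c2 : t n ^+ 3 / Num.sqrt n%:R * tilted_cube X (Num.sqrt n%:R) (t n / Num.sqrt n%:R) <= D * E.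
  have sE : (Num.sqrt (n%:R : R))^-1 = expR (- (2^-1 * ln n%:R)).
    rewrite expRN -[X in X^-1](@powRr1 _ (Num.sqrt n%:R)) ?sqrtr_ge0// powR_sqrt_nat//.
    by rewrite mul1r.
  apply: (@le_trans _ _ (expR (3%:R * t n) * expR (- (2^-1 * ln n%:R)) * (D * expR (t n + (2^-1 - kp) * ln n%:R)))).
    apply: ler_pM => //; first exact: tilted_cube_ge0.
    by rewrite sE ler_wpM2r ?expR_ge0//; exact: (tEk 3%N).
  rewrite mulrCA -!expRD; apply: (ler_wpM2l D0); rewrite ler_expR; lra.
have c3 : t n ^+ 4 / n%:R <= E.
  rewrite (_ : n%:R^-1 = expR (- ln n%:R)); last by rewrite expRN lnK.
  apply: (@le_trans _ _ (expR (4%:R * t n) * expR (- ln n%:R))).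
    by rewrite ler_wpM2r ?expR_ge0//; exact: (tEk 4%N).
  rewrite -expRD ler_expR.
  have : kp * ln n%:R <= ln n%:R :> R by rewrite ler_piMl.
  lra.
rewrite !addr_ge0 ?(mulr_ge0 b1) ?(mulr_ge0 b2) ?tail_sqr_ge0 ?tilted_cube_ge0//=.
rewrite (_ : C * E = D * E + D * E + E); last by rewrite /C; ring.
exact: lerD (lerD c1 c2) c3.
Unshelve. all: by end_near. Qed.

Theorem power_moment_deviation :
  asymp_equiv
      (fun n => (p n)%:R *
        fine (P [set w | partial_sum X n w / Num.sqrt n%:R > t n]))
      (fun n => (p n)%:R * std_normal_tail (t n))
    /\ (p n)%:R * std_normal_tail (t n) @[n --> \oo] --> expR (- x).
Proof.
apply: (deviation_reduction (x := x) iidX X_mean X_var p_gt0 p_oo (y := fun n => Num.sqrt n%:R)) => //.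
by near=> n.
Unshelve. all: by end_near. Qed.

End power.

(** * The three growth conditions *)
Lemma exp_littleo_ln {R : realType} (p : nat -> nat) (r : nat -> R) :
  exp_littleo p r -> forall e : R, 0 < e ->
  \forall n \near \oo, ln ((p n)%:R : R) <= e * `|r n|.
Proof.
move=> [f [fo pE]] e e0; move/eqoP : fo => /(_ e e0).
by apply: filterS => n; rewrite pE expRK; apply: le_trans; exact: ler_norm.
Qed.

(** The derivative of g(v) / v is at most (tau - 1) g(v) / v^2, which is negative
    once g is positive. *)
Lemma nagaev_slope {R : realType} (g : R -> R) : nagaev_function g ->
  exists x0 : R, forall a b, x0 <= a -> a <= b -> g b * a <= g a * b.
Proof.
move=> [_ dg [tau tau1 tauP] gln].
have G8 : \forall a \near +oo, 1 < g a / ln a by move/cvgryPgt : gln; apply.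
have [m [_ Hm]] : \forall a \near +oo,
    [/\ derive1 g a <= tau * g a / a, 1 < g a / ln a & 1 < a].
  near=> a; split; near: a => //; apply: nbhs_pinfty_gt; exact: num_real.
exists (Num.max 1 (m + 1)) => a b ma ab.
have H c : Num.max 1 (m + 1) <= c -> [/\ derive1 g c <= tau * g c / c, 0 < g c & 0 < c].
  rewrite ge_max => /andP[c1 mc]; have [] := Hm c; first lra.
  move=> h1 h2 c1'; split => //; last by lra.
  have lc : 0 < ln c by rewrite ln_gt0.
  by move: h2; rewrite ltr_pdivlMr// mul1r; exact: lt_trans.
have [_ _ a0] := H a ma; have [_ _ b0] := H b (le_trans ma ab).
suff : g b * b^-1 <= g a * a^-1.
  by rewrite ler_pdivrMr// mulrAC ler_pdivlMr.
apply: (@derive_le0_nonincr R (fun c => g c * c^-1)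
  (fun c => derive1 g c * c^-1 - g c * c ^- 2) (Num.max 1 (m + 1))) => //.
- move=> c mc; have [_ _ c0] := H c mc.
  have d1 : is_derive c 1 g (derive1 g c) by apply: DeriveDef; [exact: dg|rewrite derive1E].
  have d2 : is_derive c 1 (fun c : R => c^-1) (- c ^- 2 *: 1).
    by apply: (@is_deriveV _ id); rewrite gt_eqF.
  by apply: is_derive_eq; rewrite /GRing.scale/=; ring.
- move=> c mc; have [h g0 c0] := H c mc.
  rewrite (_ : _ - _ = (derive1 g c - g c / c) / c); last by field; rewrite gt_eqF.
  rewrite pmulr_lle0 ?invr_gt0// subr_le0 (le_trans h)// ler_pM2r ?invr_gt0//.
  by rewrite ler_piMl// ltW.
Unshelve. all: by end_near. Qed.

Theorem theorem2p1 (R : realType) (d : measure_display) (T : measurableType d)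
    (P : probability T R) (X : nat -> {RV P >-> R}) (p : nat -> nat)
    (X_iid : iid X)
    (X_mean : ('E_P[X 0%N] = 0)%E)
    (X_var : ('E_P[(fun w => (X 0%N w) ^+ 2)%R] = 1)%E)
    (p_gt0 : forall n, (0 < p n)%N)
    (p_oo : p n @[n --> \oo] --> \oo)
    (p_growth :
      (exists s : R,
        [/\ 2 < s,
            ('E_P[(fun w => `|X 0%N w| `^ s)%R] < +oo)%E
          & (fun n => (p n)%:R : R) =O_\oo
            (fun n => n%:R `^ ((s - 2) / 2))])
      \/
      (exists (g : R -> R) (gn : nat -> R),
        [/\ nagaev_function g,
            ('E_P[(fun w => expR (g `|X 0%N w|))%R] < +oo)%E,
            nagaev_solution g gn
          & exp_littleo p (fun n => Num.min (gn n ^+ 2) (n%:R `^ 3^-1))])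
      \/
      (exists h : R,
        [/\ 0 < h,
            ('E_P[(fun w => expR (h * `|X 0%N w|))%R] < +oo)%E
          & exp_littleo p (fun n => (n%:R : R) `^ 3^-1)])) :
  forall x : R,
    let t := fun n => gumbel_d (p n)%:R + x / gumbel_d (p n)%:R in
    asymp_equiv
      (fun n => (p n)%:R *
        fine (P [set w | partial_sum X n w / Num.sqrt n%:R > t n]))
      (fun n => (p n)%:R * std_normal_tail (t n))
    /\ (p n)%:R * std_normal_tail (t n) @[n --> \oo] --> expR (- x).
Proof.
move=> x; case: p_growth => [[s [s2 s_int p_le]]|[[g [u [g_nagaev g_int u_sol p_o]]]|[h [h0 h_int p_o]]]].
- have [k k0 pk] : exists2 k : R, 0 < k &
      \forall n \near \oo, (p n)%:R <= k * n%:R `^ ((s - 2) / 2).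
    move/eqO_exP : p_le => [k [k0 pk]]; exists k => //.
    by apply: filterS pk => n; rewrite !ger0_norm ?powR_ge0.
  exact: (power_moment_deviation x X_iid X_mean X_var p_gt0 p_oo s2 s_int k0 pk).
- have [g_incr _ _ gln] := g_nagaev.
  have [x0 slope] := nagaev_slope g_nagaev.
  have po := exp_littleo_ln p_o.
  apply: (@exponential_moment_deviation _ _ _ _ _ _ x X_iid X_mean X_var p_gt0 p_oo g u x0) => //.
  + have G8 : \forall a \near +oo, 8 <= g a / ln a by move/cvgryPge : gln; apply.
    near=> a.
    have a1 : 1 < a by near: a; apply: nbhs_pinfty_gt; exact: num_real.
    have : 8 <= g a / ln a by near: a.
    by rewrite ler_pdivlMr// ln_gt0.
  + move=> e e0; near=> n.
    have H : ln ((p n)%:R : R) <= e * `|Num.min (u n ^+ 2) (n%:R `^ 3^-1)|.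
      by near: n; exact: po.
    apply: le_trans H _; rewrite ler_pM2l// ger0_norm ?ge_min ?lexx//.
    by rewrite le_min sqr_ge0 powR_ge0.
  + move=> e e0; near=> n.
    have H : ln ((p n)%:R : R) <= e * `|Num.min (u n ^+ 2) (n%:R `^ 3^-1)|.
      by near: n; exact: po.
    apply: le_trans H _; rewrite ler_pM2l// ger0_norm ?ge_min ?lexx ?orbT//.
    by rewrite le_min sqr_ge0 powR_ge0.
- have po e : 0 < e -> \forall n \near \oo, ln ((p n)%:R : R) <= e * n%:R `^ 3^-1.
    move=> e0; have := exp_littleo_ln p_o e0.
    by apply: filterS => n; rewrite [`|_|]ger0_norm ?powR_ge0.
  apply: (@exponential_moment_deviation _ _ _ _ _ _ x X_iid X_mean X_var p_gt0 p_oo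
    (fun v => h * v) (fun n => h * Num.sqrt n%:R) 0) => //.
  + by move=> a b _ ab; rewrite ler_pM2l.
  + by move=> a b _ _; rewrite -mulrA -mulrA [b * a]mulrC.
  + near=> a.
    have a0 : 0 < a by near: a; apply: nbhs_pinfty_gt; exact: num_real.
    have sa : 16 / h <= Num.sqrt a by near: a; move/cvgryPge : (@cvg_sqrt_y R); apply.
    have s0 : 0 < Num.sqrt a by rewrite sqrtr_gt0.
    have l := ln_le_sqrt a0.
    apply: (@le_trans _ _ (16 * Num.sqrt a)); first by lra.
    rewrite -[X in h * X](sqr_sqrtr (ltW a0)) expr2 mulrA ler_pM2r//.
    by move: sa; rewrite ler_pdivrMr// mulrC.
  + near=> n.
    have n0 : (0 < n)%N by near: n; exists 1%N.
    by rewrite mulr_gt0 ?sqrtr_gt0 ?ltr0n//; split => //; rewrite exprMn expr2; ring.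
  + move=> e e0; near=> n.
    have n1 : 1 <= n%:R :> R by rewrite ler1n; near: n; exists 1%N.
    have n0 : 0 <= n%:R :> R by exact: ler0n.
    have H : ln ((p n)%:R : R) <= e * h ^+ 2 * n%:R `^ 3^-1.
      by near: n; apply: po; rewrite mulr_gt0// exprn_gt0.
    apply: le_trans H _.
    rewrite (_ : e * (h * Num.sqrt n%:R) ^+ 2 = e * h ^+ 2 * n%:R); last first.
      by rewrite exprMn sqr_sqrtr// mulrA.
    apply: ler_wpM2l; first by apply: mulr_ge0; [exact: ltW|exact: sqr_ge0].
    by apply: ler1_powR => //; rewrite invf_le1// ler1n.
Unshelve. all: by end_near. Qed.
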